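(* Let $\mathbb{K}$ be a field of characteristic $0$ that is big enough (a splitting field for all groups $C_G(H)$, $H\le G$). For every finite group $G$, the pseudo-functor $\mathcal{P}_{\mathbb{K}}$ maps the Mackey $2$-motive $$G\simeq\bigoplus_{H\in\mathrm{C}(G),\ \theta\in\mathrm{Irr}(\mathbb{K}C_G(H))}(G,e_{H,\theta})$$ to the cohomological Mackey $2$-motive $$G\simeq\bigoplus_{H\in\mathrm{C}(G),\ \theta\in\mathrm{Irr}(\mathbb{K}C_G(H))}(G,\rho_G(e_{H,\theta}))\simeq\bigoplus_{\theta\in\mathrm{Irr}(\mathbb{K}G)}(G,\rho_G(e_{1,\theta}))\simeq\bigoplus_{\theta\in\mathrm{Irr}(\mathbb{K}G)}(G,e_{\theta}).$$ Here the first equivalence is in the bicategory of $\mathbb{K}$-linear Mackey $2$-motives, the others are in the bicategory of $\mathbb{K}$-linear cohomological Mackey $2$-motives, and $e_\theta$ is the primitive idempotent of $Z\mathbb{K}G$ attached to $\theta\in\mathrm{Irr}(\mathbb{K}G)$.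
   Context: Let $\mathbb{k}$ be a commutative ring (here $\mathbb{k}=\mathbb{K}$). $\mathrm{C}(G)$ is a set of representatives of conjugacy classes of subgroups of $G$; $\mathrm{Irr}(\mathbb{K}L)$ is the set of irreducible $\mathbb{K}$-characters of a group $L$; $Z$ denotes the center. Crossed Burnside ring. A crossed $G$-set is a finite $G$-set $X$ with a $G$-map $\alpha$ to $G^{\mathrm c}$ ($G$ acting on itself by conjugation). $B^{\mathrm c}(G)$ is the Grothendieck group of crossed $G$-sets under disjoint union, with product $(X,\alpha)(Y,\beta)=(X\times Y,(x,y)\mapsto\alpha(x)\beta(y))$; $B^{\mathrm c}_{\mathbb{k}}(G)=\mathbb{k}\otimes B^{\mathrm c}(G)$. It has basis $[H,a]_G$, the class of $(G/H, gH\mapsto gag^{-1})$, for $H\le G$, $a\in C_G(H)$ up to conjugacy. The ring homomorphism $\rho_G:B^{\mathrm c}_{\mathbb{k}}(G)\to Z(\mathbb{k}G)$ is $[H,a]_G\mapsto\sum_{x\in [G/H]}xax^{-1}$. Idempotents $e_{H,\theta}$. For $H\le G$ let $\varphi_H^{\mathbb{K}}:B^{\mathrm c}_{\mathbb{K}}(G)\to Z\mathbb{K}C_G(H)$, $[D,s]_G\mapsto\sum_{gD\in(G/D)^H}gsg^{-1}$. Then $\varphi^{\mathbb{K}}=(\varphi_H^{\mathbb{K}})_{H\le G}$ is a ring isomorphism from $B^{\mathrm c}_{\mathbb{K}}(G)$ onto the $G$-fixed subring $\left(\prod_{H\le G}Z\mathbb{K}C_G(H)\right)^G$. For $H\le G$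 and $\theta\in\mathrm{Irr}(\mathbb{K}C_G(H))$, let $\widetilde{\epsilon}_{H,\theta}$ be the primitive idempotent of this fixed subring whose component at $K\le G$ is the sum of the primitive central idempotents $e_{\theta'}\in Z\mathbb{K}C_G(K)$ over all $\theta'\in \mathrm{Irr}(\mathbb{K}C_G(K))$ with $(K,\theta')$ $G$-conjugate to $(H,\theta)$. Put $e_{H,\theta}=(\varphi^{\mathbb{K}})^{-1}(\widetilde{\epsilon}_{H,\theta})$; these are the primitive idempotents of $B^{\mathrm c}_{\mathbb{K}}(G)$. Mackey $2$-motives (Balmer–Dell'Ambrogio). The bicategory $\mathbb{k}\widehat{\mathsf{Span}}^{\mathsf{rf}}$ has as objects finite groupoids (a group is a one-object groupoid). Its 1-cells $G\to H$ are spans $G\xleftarrow{u}P\xrightarrow{i}H$ of finite groupoids with $i$ faithful, composed by iso-comma squares. Its 2-cells from $(u,P,i)$ to $(v,P',j)$ form the $\mathbb{k}$-module obtained, by group completion and extension of scalars to $\mathbb{k}$, from the commutative monoid (under coproduct of $Q$) of isomorphism classes of spans $P\xleftarrow{b}Q\xrightarrow{c}P'$ with $b,c$ faithful, equipped with natural isomorphisms $ub\cong vc$ and $ib\cong jc$; these are composed by iso-comma squares. For a finite group $G$, the endomorphism ring of the identity 1-cell $\mathrm{Id}_G$ is identified with $B^{\mathrm c}_{\mathbb{k}}(G)$: $[H,a]_G$ corresponds to $Q=H$ with both legs the inclusion $H\hookrightarrow G$, one natural isomorphism being the identity and the other given by the element $a\in C_G(H)$. Block completion. For a $\mathbb{k}$-linear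 bicategory $\mathcal{B}$, $\mathcal{B}^{\flat}$ is its block completion. Objects are formal finite direct sums $\bigoplus_i(G_i,e_i)$ with $e_i$ an idempotent 2-cell of $\mathrm{Id}_{G_i}$. The Hom category from $(G,e)$ to $(H,f)$ is the full subcategory of the additive idempotent completion of $\mathcal{B}(G,H)$ on the objects on which both $e$ and $f$ (acting by whiskering) act as the identity. 1-cells between formal sums are matrices. One writes $G=(G,1)$, and $(G,0)\simeq 0$. The bicategory of ($\mathbb{k}$-linear) Mackey $2$-motives is $(\mathbb{k}\widehat{\mathsf{Span}}^{\mathsf{rf}})^{\flat}$. Cohomological Mackey $2$-motives. $\mathsf{biperm}^{\mathsf{rf}}_{\mathbb{k}}$ is the bicategory with objects finite groupoids, 1-cells $G\to H$ the right-free permutation $(\mathbb{k}H,\mathbb{k}G)$-bimodules ($\mathbb{k}$-linearizations of finite right-free $(H,G)$-bisets), composed by tensor product, and 2-cells the bimodule homomorphisms; thus $\mathrm{End}(\mathrm{Id}_G)=Z(\mathbb{k}G)$. The bicategory of cohomological Mackey $2$-motives is $(\mathsf{biperm}^{\mathsf{rf}}_{\mathbb{k}})^{\flat}$. The pseudo-functor $\mathcal{P}_{\mathbb{k}}$ from Mackey $2$-motives to cohomological Mackey $2$-motives is the extension to block completions of the pseudo-functor which is the identity on objects and sends a span $(u,P,i)$ to the bimodule $\mathbb{k}H\otimes_{\mathbb{k}P}\mathbb{k}G$ representing $i_!u^*$ (induction along $i$ after restriction along $u$). It sends a 2-cell $P\xleftarrow{b}Q\xrightarrow{c}P'$ to the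 bimodule map representing $i_!u^*\to i_!b_!b^*u^*\cong j_!c_!c^*v^*\to j_!v^*$ (unit of $b^*\dashv b_!$, the given isomorphisms, counit of $c_!\dashv c^*$). On $\mathrm{End}(\mathrm{Id}_G)$ it is $\rho_G$, and it sends $\bigoplus_i(G_i,e_i)$ to $\bigoplus_i(G_i,\rho_{G_i}(e_i))$.
   Formalization: In the sums over H in C(G), θ runs over representatives of Irr(KC_G(H)) modulo N_G(H)-conjugacy, not over all of Irr(KC_G(H)); otherwise a primitive idempotent is counted twice (e.g. G=S_3, H=A_3) and the first equivalence fails. *)

(* Defs.v *)
From HB Require Import structures.
From Stdlib Require Import ClassicalEpsilon.
From mathcomp Require Import all_boot all_order all_algebra all_fingroup.
From mathcomp Require Import mxrepresentation.

Set Implicit Arguments.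
Unset Strict Implicit.
Unset Printing Implicit Defensive.

Import GRing.Theory.

Local Obligation Tactic := idtac.

Declare Scope gpd_scope.
Delimit Scope gpd_scope with gpd.

(** * Finite groupoids *)

Record gpd := Gpd {
  gob :> finType;
  hom : gob -> gob -> finType;
  gid : forall x, hom x x;
  gcomp : forall x y z, hom y z -> hom x y -> hom x z;
  ginv : forall x y, hom x y -> hom y x;
  gcompA : forall x y z t (h : hom z t) (g : hom y z) (f : hom x y),
    gcomp h (gcomp g f) = gcomp (gcomp h g) f;
  gid_l : forall x y (f : hom x y), gcomp (gid y) f = f;
  gid_r : forall x y (f : hom x y), gcomp f (gid x) = f;
  ginv_l : forall x y (f : hom x y), gcomp (ginv f) f = gid x;
  ginv_r : forall x y (f : hom x y), gcomp f (ginv f) = gid y }.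

Arguments gid {_} x.
Arguments gcomp {_ x y z} _ _.
Arguments ginv {_ x y} _.

Notation "g ∘ f" := (gcomp g f) (at level 40, left associativity) : gpd_scope.
Local Open Scope gpd_scope.

Section GpdTheory.
Variable G : gpd.

Lemma gcompKl (x y z : G) (g : hom y z) (f : hom x y) : ginv g ∘ (g ∘ f) = f.
Proof. by rewrite gcompA ginv_l gid_l. Qed.
Lemma gcompVKl (x y z : G) (g : hom z y) (f : hom x y) : g ∘ (ginv g ∘ f) = f.
Proof. by rewrite gcompA ginv_r gid_l. Qed.
Lemma gcompKr (x y z : G) (g : hom y z) (f : hom x y) : (g ∘ f) ∘ ginv f = g.
Proof. by rewrite -gcompA ginv_r gid_r. Qed.
Lemma gcompVKr (x y z : G) (g : hom y z) (f : hom y x) : (g ∘ ginv f) ∘ f = g.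
Proof. by rewrite -gcompA ginv_l gid_r. Qed.
Lemma gcompIl (x y z : G) (g : hom y z) : injective (fun f : hom x y => g ∘ f).
Proof. by move=> f f' /(congr1 (gcomp (ginv g))); rewrite !gcompKl. Qed.
Lemma gcompIr (x y z : G) (f : hom x y) : injective (fun g : hom y z => g ∘ f).
Proof. by move=> g g' /(congr1 (fun h => h ∘ ginv f)); rewrite !gcompKr. Qed.
Lemma ginvM (x y z : G) (g : hom y z) (f : hom x y) :
  ginv (g ∘ f) = ginv f ∘ ginv g.
Proof. by apply: (gcompIl (g := g ∘ f)); rewrite /= ginv_r gcompA gcompKr ginv_r. Qed.
Lemma ginvK (x y : G) (f : hom x y) : ginv (ginv f) = f.
Proof. by apply: (gcompIl (g := ginv f)); rewrite /= ginv_r ginv_l. Qed.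
Lemma ginv1 (x : G) : ginv (gid x) = gid x.
Proof. by apply: (gcompIl (g := gid x)); rewrite /= ginv_r gid_l. Qed.
End GpdTheory.

(** A group as a one-object groupoid. *)
Definition grp (gT : finGroupType) : gpd :=
  @Gpd unit (fun _ _ => gT) (fun _ => 1%g)
    (fun _ _ _ g f => (g * f)%g) (fun _ _ f => f^-1%g)
    (fun _ _ _ _ h g f => mulgA h g f) (fun _ _ f => mul1g f)
    (fun _ _ f => mulg1 f) (fun _ _ f => mulVg f) (fun _ _ f => mulgV f).

Record gfun (G H : gpd) := GFun {
  fob :> G -> H;
  fmor : forall x y, hom x y -> hom (fob x) (fob y);
  fmor1 : forall x, fmor (gid x) = gid (fob x);
  fmorM : forall x y z (g : hom y z) (f : hom x y),
    fmor (g ∘ f) = fmor g ∘ fmor f }.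
Arguments fmor {G H} _ {x y} _.

Lemma fmorV (G H : gpd) (F : gfun G H) (x y : G) (f : hom x y) :
  fmor F (ginv f) = ginv (fmor F f).
Proof.
by apply: (gcompIl (g := fmor F f)); rewrite /= -fmorM !ginv_r fmor1.
Qed.

Definition gfun_id (G : gpd) : gfun G G :=
  @GFun G G id (fun _ _ f => f) (fun _ => erefl) (fun _ _ _ _ _ => erefl).

Program Definition gfun_comp (G H L : gpd) (F' : gfun H L) (F : gfun G H) :
  gfun G L := @GFun G L (fun x => F' (F x)) (fun _ _ f => fmor F' (fmor F f)) _ _.
Next Obligation. by move=> * /=; rewrite !fmor1. Qed.
Next Obligation. by move=> * /=; rewrite !fmorM. Qed.

Definition faithful (G H : gpd) (F : gfun G H) :=
  forall x y : G, injective (@fmor G H F x y).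

Lemma faithful_comp (G H L : gpd) (F' : gfun H L) (F : gfun G H) :
  faithful F' -> faithful F -> faithful (gfun_comp F' F).
Proof. by move=> h' h x y f g /= /h' /h. Qed.

(** Natural transformations; they are automatically invertible. *)
Record nat_iso (G H : gpd) (F F' : gfun G H) := NatIso {
  ncomp :> forall x : G, hom (F x) (F' x);
  natural : forall x y (f : hom x y), ncomp y ∘ fmor F f = fmor F' f ∘ ncomp x }.

Definition is_equiv (G H : gpd) (F : gfun G H) := exists F' : gfun H G,
  inhabited (nat_iso (gfun_comp F' F) (gfun_id G)) /\
  inhabited (nat_iso (gfun_comp F F') (gfun_id H)).

(** Iso-comma groupoid of [F : A -> C <- B : F']. *)
Section IsoComma.
Variables (A B C : gpd) (F : gfun A C) (F' : gfun B C).

Definition ic_ob : finType := {ab : A * B & hom (F ab.1) (F' ab.2)}.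
Definition ic_hom (z z' : ic_ob) : finType :=
  {m : hom (tag z).1 (tag z').1 * hom (tag z).2 (tag z').2 |
    fmor F' m.2 ∘ tagged z == tagged z' ∘ fmor F m.1}.

Lemma ic_id_subproof (z : ic_ob) :
  fmor F' (gid (tag z).2) ∘ tagged z == tagged z ∘ fmor F (gid (tag z).1).
Proof. by rewrite !fmor1 gid_l gid_r. Qed.
Lemma ic_comp_subproof (z1 z2 z3 : ic_ob) (m' : ic_hom z2 z3) (m : ic_hom z1 z2) :
  fmor F' ((val m').2 ∘ (val m).2) ∘ tagged z1
    == tagged z3 ∘ fmor F ((val m').1 ∘ (val m).1).
Proof.
case: m' m => [m' /= /eqP e'] [m /= /eqP e].
by rewrite !fmorM -gcompA e !gcompA e'.
Qed.
Lemma ic_inv_subproof (z1 z2 : ic_ob) (m : ic_hom z1 z2) :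
  fmor F' (ginv (val m).2) ∘ tagged z2 == tagged z1 ∘ fmor F (ginv (val m).1).
Proof.
case: m => [m /= /eqP e]; rewrite !fmorV; apply/eqP.
by apply: (gcompIl (g := fmor F' m.2)); rewrite /= gcompVKl gcompA e gcompKr.
Qed.

Program Definition isocomma : gpd := @Gpd ic_ob ic_hom
  (fun z => exist _ (gid (tag z).1, gid (tag z).2) (ic_id_subproof z))
  (fun z1 z2 z3 m' m => exist _
    ((val m').1 ∘ (val m).1, (val m').2 ∘ (val m).2) (ic_comp_subproof m' m))
  (fun z1 z2 m => exist _ (ginv (val m).1, ginv (val m).2) (ic_inv_subproof m))
  _ _ _ _ _.
Next Obligation. by move=> *; apply: val_inj; rewrite /= !gcompA. Qed.
Next Obligation. by move=> ? ? [[]] *; apply: val_inj; rewrite /= !gid_l. Qed.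
Next Obligation. by move=> ? ? [[]] *; apply: val_inj; rewrite /= !gid_r. Qed.
Next Obligation. by move=> *; apply: val_inj; rewrite /= !ginv_l. Qed.
Next Obligation. by move=> *; apply: val_inj; rewrite /= !ginv_r. Qed.

Definition ic_l : gfun isocomma A := @GFun isocomma A (fun z => (tag z).1)
  (fun _ _ m => (val m).1) (fun _ => erefl) (fun _ _ _ _ _ => erefl).
Definition ic_r : gfun isocomma B := @GFun isocomma B (fun z => (tag z).2)
  (fun _ _ m => (val m).2) (fun _ => erefl) (fun _ _ _ _ _ => erefl).

Lemma ic_l_faithful : faithful F' -> faithful ic_l.
Proof.
move=> fF z z' [[m1 m2] em] [[n1 n2] en] /= emn.
have /= /eqP e := em; have /= /eqP e' := en.
apply: val_inj => /=; congr pair => //; apply: fF.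
by apply: (gcompIr (f := tagged z)); rewrite /= e e' emn.
Qed.
Lemma ic_r_faithful : faithful F -> faithful ic_r.
Proof.
move=> fF z z' [[m1 m2] em] [[n1 n2] en] /= emn.
have /= /eqP e := em; have /= /eqP e' := en.
apply: val_inj => /=; congr pair => //; apply: fF.
by apply: (gcompIl (g := tagged z')); rewrite /= -e -e' emn.
Qed.
End IsoComma.

(** Coproduct of groupoids. *)
Section Coproduct.
Variables A B : gpd.

Definition cp_hom (x y : A + B) : finType :=
  match x, y with
  | inl a, inl a' => hom a a'
  | inr b, inr b' => hom b b'
  | _, _ => void
  end.
Definition cp_id (x : A + B) : cp_hom x x :=
  match x with inl a => gid a | inr b => gid b end.
Definition cp_comp (x y z : A + B) : cp_hom y z -> cp_hom x y -> cp_hom x z :=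
  match x, y, z with
  | inl a, inl a', inl a'' => fun g f => g ∘ f
  | inr b, inr b', inr b'' => fun g f => g ∘ f
  | inl _, inr _, _ => fun _ (f : void) => of_void _ f
  | inr _, inl _, _ => fun _ (f : void) => of_void _ f
  | inl _, inl _, inr _ => fun (f : void) _ => of_void _ f
  | inr _, inr _, inl _ => fun (f : void) _ => of_void _ f
  end.
Definition cp_inv (x y : A + B) : cp_hom x y -> cp_hom y x :=
  match x, y with
  | inl a, inl a' => fun f => ginv f
  | inr b, inr b' => fun f => ginv f
  | inl _, inr _ => fun f : void => of_void _ f
  | inr _, inl _ => fun f : void => of_void _ f
  end.

Program Definition gsum : gpd := @Gpd (A + B)%type cp_hom cp_id cp_comp cp_inv _ _ _ _ _.
Next Obligation.
move=> [x|x] [y|y] [z|z] [t|t] //= h g f; rewrite ?gcompA //.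
all: by [case: f | case: g | case: h].
Qed.
Next Obligation. by move=> [x|x] [y|y] //= f; rewrite gid_l. Qed.
Next Obligation. by move=> [x|x] [y|y] //= f; rewrite gid_r. Qed.
Next Obligation. by move=> [x|x] [y|y] //= f; rewrite ginv_l. Qed.
Next Obligation. by move=> [x|x] [y|y] //= f; rewrite ginv_r. Qed.

Section Copair.
Variables (C : gpd) (F : gfun A C) (F' : gfun B C).
Definition cop_ob (x : gsum) : C := match x with inl a => F a | inr b => F' b end.
Definition cop_mor (x y : gsum) : hom x y -> hom (cop_ob x) (cop_ob y) :=
  match x, y with
  | inl _, inl _ => fun f => fmor F f
  | inr _, inr _ => fun f => fmor F' f
  | inl _, inr _ => fun f : void => of_void _ f
  | inr _, inl _ => fun f : void => of_void _ f
  end.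
Program Definition copair : gfun gsum C := @GFun gsum C cop_ob cop_mor _ _.
Next Obligation. by move=> [x|x] /=; rewrite fmor1. Qed.
Next Obligation.
move=> [x|x] [y|y] [z|z] //= g f; rewrite ?fmorM //.
all: by [case: f | case: g].
Qed.
Lemma copair_faithful : faithful F -> faithful F' -> faithful copair.
Proof.
move=> fF fF' [x|x] [y|y]; [exact: fF | by case | by case | exact: fF'].
Qed.
End Copair.
End Coproduct.

(** * Spans of finite groupoids with faithful right leg *)

Record span (G H : gpd) := Span {
  apex : gpd;
  legl : gfun apex G;
  legr : gfun apex H;
  legr_faithful : faithful legr }.

(** Spans [apex s <- apx -> apex t] representing the 2-cells from [s] to [t]. *)
Record span2 (G H : gpd) (s t : span G H) := Span2 {
  apx : gpd;
  bleg : gfun apx (apex s);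
  cleg : gfun apx (apex t);
  bleg_faithful : faithful bleg;
  cleg_faithful : faithful cleg;
  lnat : nat_iso (gfun_comp (legl s) bleg) (gfun_comp (legl t) cleg);
  rnat : nat_iso (gfun_comp (legr s) bleg) (gfun_comp (legr t) cleg) }.

(** Isomorphism of 2-cell spans is taken, as usual for spans in the
    (2,1)-category of groupoids, to be an equivalence of the apices over both
    feet, up to natural isomorphisms compatible with [lnat] and [rnat]. *)
Definition iso2 (G H : gpd) (s t : span G H) (x y : span2 s t) : Prop :=
  exists (F : gfun (apx x) (apx y))
         (p : nat_iso (bleg x) (gfun_comp (bleg y) F))
         (q : nat_iso (cleg x) (gfun_comp (cleg y) F)),
    [/\ is_equiv F,
        forall a, fmor (legl t) (q a) ∘ lnat x a
                = lnat y (F a) ∘ fmor (legl s) (p a)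
      & forall a, fmor (legr t) (q a) ∘ rnat x a
                = rnat y (F a) ∘ fmor (legr s) (p a)].

Section SpanOps.
Variables G H : gpd.
Implicit Types s t r : span G H.

Definition sum2_nat (A B C D E : gpd) (L : gfun C E) (L' : gfun D E)
    (b : gfun A C) (b' : gfun B C) (c : gfun A D) (c' : gfun B D)
    (n : nat_iso (gfun_comp L b) (gfun_comp L' c))
    (n' : nat_iso (gfun_comp L b') (gfun_comp L' c')) :
  nat_iso (gfun_comp L (copair b b')) (gfun_comp L' (copair c c')).
Proof.
exists (fun x : gsum A B =>
  match x return hom (L (copair b b' x)) (L' (copair c c' x)) with
  | inl a => n a | inr a => n' a end).
move=> [x|x] [y|y] f //=; [exact: (natural n) | exact: (natural n')].
Defined.

Definition sum2 s t (x y : span2 s t) : span2 s t :=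
  @Span2 G H s t (gsum (apx x) (apx y))
    (copair (bleg x) (bleg y)) (copair (cleg x) (cleg y))
    (copair_faithful (@bleg_faithful _ _ _ _ x) (@bleg_faithful _ _ _ _ y))
    (copair_faithful (@cleg_faithful _ _ _ _ x) (@cleg_faithful _ _ _ _ y))
    (sum2_nat (lnat x) (lnat y)) (sum2_nat (rnat x) (rnat y)).

Program Definition nat_id (A B : gpd) (F : gfun A B) : nat_iso F F :=
  @NatIso A B F F (fun x => gid (F x)) _.
Next Obligation. by move=> *; rewrite gid_l gid_r. Qed.

Program Definition nat_inv (A B : gpd) (F F' : gfun A B) (n : nat_iso F F') :
  nat_iso F' F := @NatIso A B F' F (fun x => ginv (n x)) _.
Next Obligation.
move=> A B F F' n x y f.
by apply: (gcompIl (g := n y)); rewrite /= gcompVKl gcompA natural gcompKr.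
Qed.

Lemma id_faithful (A : gpd) : faithful (gfun_id A).
Proof. by move=> x y f g. Qed.

Definition span2_id s : span2 s s :=
  @Span2 G H s s (apex s) (gfun_id _) (gfun_id _) (@id_faithful _) (@id_faithful _)
    (nat_id _) (nat_id _).

Definition span2_rev s t (x : span2 s t) : span2 t s :=
  @Span2 G H t s (apx x) (cleg x) (bleg x)
    (@cleg_faithful _ _ _ _ x) (@bleg_faithful _ _ _ _ x)
    (nat_inv (lnat x)) (nat_inv (rnat x)).

Program Definition vc_nat (A B P Q R E : gpd) (L : gfun P E) (L' : gfun Q E)
    (L'' : gfun R E) (b : gfun A P) (c : gfun A Q) (b' : gfun B Q) (c' : gfun B R)
    (n : nat_iso (gfun_comp L b) (gfun_comp L' c))
    (n' : nat_iso (gfun_comp L' b') (gfun_comp L'' c')) :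
  nat_iso (gfun_comp L (gfun_comp b (ic_l c b')))
          (gfun_comp L'' (gfun_comp c' (ic_r c b'))) :=
  @NatIso _ _ _ _
    (fun z : isocomma c b' => n' (tag z).2 ∘ fmor L' (tagged z) ∘ n (tag z).1) _.
Next Obligation.
move=> A B P Q R E L L' L'' b c b' c' n n' z z' m /=.
have /eqP em := valP m.
have /= e1 := natural n (val m).1; have /= e2 := natural n' (val m).2.
have e3 : fmor L' (tagged z') ∘ fmor L' (fmor c (val m).1)
        = fmor L' (fmor b' (val m).2) ∘ fmor L' (tagged z) by rewrite -!fmorM -em.
by rewrite -gcompA e1 !gcompA -e2 -(gcompA _ (fmor L' (tagged z'))) e3 !gcompA.
Qed.

(** Vertical composite [y \o x], by iso-comma over the middle foot. *)
Definition span2_vcomp s t r (y : span2 t r) (x : span2 s t) : span2 s r :=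
  @Span2 G H s r (isocomma (cleg x) (bleg y))
    (gfun_comp (bleg x) (ic_l _ _)) (gfun_comp (cleg y) (ic_r _ _))
    (faithful_comp (@bleg_faithful _ _ _ _ x)
       (ic_l_faithful (F := cleg x) (@bleg_faithful _ _ _ _ y)))
    (faithful_comp (@cleg_faithful _ _ _ _ y)
       (ic_r_faithful (F' := bleg y) (@cleg_faithful _ _ _ _ x)))
    (vc_nat (lnat x) (lnat y)) (vc_nat (rnat x) (rnat y)).
End SpanOps.

Definition span_id (G : gpd) : span G G :=
  Span (gfun_id G) (@id_faithful G).

Definition span_comp (G H L : gpd) (v : span H L) (u : span G H) : span G L :=
  @Span G L (isocomma (legr u) (legl v))
    (gfun_comp (legl u) (ic_l _ _)) (gfun_comp (legr v) (ic_r _ _))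
    (faithful_comp (@legr_faithful _ _ v)
       (ic_r_faithful (F' := legl v) (@legr_faithful _ _ u))).

(** The functor to an iso-comma groupoid defined by a square. *)
Section IcPair.
Variables (A B C W : gpd) (F : gfun A C) (F' : gfun B C).
Variables (a : gfun W A) (b : gfun W B).
Variable n : nat_iso (gfun_comp F a) (gfun_comp F' b).

Definition icp_ob (w : W) : isocomma F F' :=
  existT (fun ab : A * B => hom (F ab.1) (F' ab.2) : Type) (a w, b w) (n w).
Lemma icp_subproof (w w' : W) (m : hom w w') :
  fmor F' (fmor b m) ∘ n w == n w' ∘ fmor F (fmor a m).
Proof. by apply/eqP; rewrite -(natural n). Qed.
Program Definition ic_pair : gfun W (isocomma F F') := @GFun W (isocomma F F') icp_ob
  (fun w w' m => exist _ (fmor a m, fmor b m) (icp_subproof m)) _ _.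
Next Obligation. by move=> w; apply: val_inj; rewrite /= !fmor1. Qed.
Next Obligation. by move=> *; apply: val_inj; rewrite /= !fmorM. Qed.

Lemma ic_pair_faithful :
  (forall (w w' : W) (m m' : hom w w'),
     fmor a m = fmor a m' -> fmor b m = fmor b m' -> m = m') -> faithful ic_pair.
Proof. by move=> h w w' m m' /(congr1 val) /= [/h h' /h']. Qed.
End IcPair.

(** Horizontal composite of 2-cell spans. *)
Section HComp.
Variables (G H L : gpd) (u u' : span G H) (v v' : span H L).
Variables (y : span2 v v') (x : span2 u u').

Let W := isocomma (gfun_comp (legr u) (bleg x)) (gfun_comp (legl v) (bleg y)).
Let Wl : gfun W (apx x) := ic_l _ _.
Let Wr : gfun W (apx y) := ic_r _ _.

Program Definition hc_bnat :
  nat_iso (gfun_comp (legr u) (gfun_comp (bleg x) Wl))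
          (gfun_comp (legl v) (gfun_comp (bleg y) Wr)) :=
  @NatIso _ _ _ _ (fun w : W => tagged w) _.
Next Obligation. by move=> w w' m; have /eqP em := valP m; rewrite /= -em. Qed.

Program Definition hc_cnat :
  nat_iso (gfun_comp (legr u') (gfun_comp (cleg x) Wl))
          (gfun_comp (legl v') (gfun_comp (cleg y) Wr)) :=
  @NatIso _ _ _ _
    (fun w : W => lnat y (tag w).2 ∘ tagged w ∘ ginv (rnat x (tag w).1)) _.
Next Obligation.
move=> w w' m /=; have /= /eqP em := valP m.
have /= e1 := natural (nat_inv (rnat x)) (val m).1.
have /= e2 := natural (lnat y) (val m).2.
by rewrite -gcompA e1 !gcompA -e2 -(gcompA _ (tagged w')) -em !gcompA.
Qed.

Program Definition hc_lnat :
  nat_iso (gfun_comp (legl (span_comp v u)) (ic_pair hc_bnat))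
          (gfun_comp (legl (span_comp v' u')) (ic_pair hc_cnat)) :=
  @NatIso _ _ _ _ (fun w : W => lnat x (tag w).1) _.
Next Obligation. by move=> w w' m; exact: (natural (lnat x)). Qed.

Program Definition hc_rnat :
  nat_iso (gfun_comp (legr (span_comp v u)) (ic_pair hc_bnat))
          (gfun_comp (legr (span_comp v' u')) (ic_pair hc_cnat)) :=
  @NatIso _ _ _ _ (fun w : W => rnat y (tag w).2) _.
Next Obligation. by move=> w w' m; exact: (natural (rnat y)). Qed.

Lemma hc_bfaithful : faithful (ic_pair hc_bnat).
Proof.
apply: ic_pair_faithful => w w' [[m1 m2] em] [[n1 n2] en] /=.
by move=> /bleg_faithful e1 /bleg_faithful e2; apply: val_inj; rewrite /= e1 e2.
Qed.
Lemma hc_cfaithful : faithful (ic_pair hc_cnat).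
Proof.
apply: ic_pair_faithful => w w' [[m1 m2] em] [[n1 n2] en] /=.
by move=> /cleg_faithful e1 /cleg_faithful e2; apply: val_inj; rewrite /= e1 e2.
Qed.

Definition span2_hcomp : span2 (span_comp v u) (span_comp v' u') :=
  @Span2 G L (span_comp v u) (span_comp v' u') W (ic_pair hc_bnat)
    (ic_pair hc_cnat) hc_bfaithful hc_cfaithful hc_lnat hc_rnat.
End HComp.

(** Unitors: both are induced by the projections of the iso-comma groupoids. *)
Section Unitors.
Variables (G H : gpd) (u : span G H).

Program Definition ru_lnat :
  nat_iso (gfun_comp (legl (span_comp u (span_id G))) (gfun_id _))
          (gfun_comp (legl u) (ic_r (gfun_id G) (legl u))) :=
  @NatIso _ _ _ _ (fun w : isocomma (gfun_id G) (legl u) => tagged w) _.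
Next Obligation. by move=> w w' m; have /eqP em := valP m; rewrite /= -em. Qed.
Program Definition ru_rnat :
  nat_iso (gfun_comp (legr (span_comp u (span_id G))) (gfun_id _))
          (gfun_comp (legr u) (ic_r (gfun_id G) (legl u))) :=
  @NatIso _ _ _ _
    (fun w : isocomma (gfun_id G) (legl u) => gid (legr u (tag w).2)) _.
Next Obligation. by move=> w w' m; rewrite /= gid_l gid_r. Qed.

Definition span_runit : span2 (span_comp u (span_id G)) u :=
  @Span2 G H (span_comp u (span_id G)) u _ (gfun_id _) (ic_r _ _)
    (@id_faithful _) (ic_r_faithful (F' := legl u) (@id_faithful G))
    ru_lnat ru_rnat.

Program Definition lu_lnat :
  nat_iso (gfun_comp (legl (span_comp (span_id H) u)) (gfun_id _))
          (gfun_comp (legl u) (ic_l (legr u) (gfun_id H))) :=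
  @NatIso _ _ _ _
    (fun w : isocomma (legr u) (gfun_id H) => gid (legl u (tag w).1)) _.
Next Obligation. by move=> w w' m; rewrite /= gid_l gid_r. Qed.
Program Definition lu_rnat :
  nat_iso (gfun_comp (legr (span_comp (span_id H) u)) (gfun_id _))
          (gfun_comp (legr u) (ic_l (legr u) (gfun_id H))) :=
  @NatIso _ _ _ _
    (fun w : isocomma (legr u) (gfun_id H) => ginv (tagged w)) _.
Next Obligation.
move=> w w' m; have /= /eqP em := valP m.
apply: (gcompIl (g := tagged w')).
by rewrite /= gcompVKl gcompA -em gcompKr.
Qed.

Definition span_lunit : span2 (span_comp (span_id H) u) u :=
  @Span2 G H (span_comp (span_id H) u) u _ (gfun_id _) (ic_l _ _)
    (@id_faithful _) (ic_l_faithful (F := legr u) (@id_faithful H))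
    lu_lnat lu_rnat.
End Unitors.

Local Open Scope ring_scope.

(** * The 2-cells of the linear span bicategory *)

(** Formal [k]-linear combinations of elements of a commutative monoid given by
    generators up to [iso] and an addition [add].  [lc_eq] is equality in the
    [k]-module obtained by group completion and extension of scalars, expressed
    by its universal property. *)
Section LinearCombinations.
Variables (k : comNzRingType) (T : Type).

Definition lcomb := seq (k * T).

Definition lc_eval (V : lmodType k) (f : T -> V) (s : lcomb) : V :=
  \sum_(x <- s) x.1 *: f x.2.

Definition lc_eq (iso : T -> T -> Prop) (add : T -> T -> T) (s t : lcomb) :=
  forall (V : lmodType k) (f : T -> V),
    (forall x y, iso x y -> f x = f y) ->
    (forall x y, f (add x y) = f x + f y) ->
    lc_eval f s = lc_eval f t.
End LinearCombinations.

Definition lc_map (k : comNzRingType) (T U : Type) (f : T -> U) (s : lcomb k T) :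
  lcomb k U := [seq (x.1, f x.2) | x <- s].
Definition lc_map2 (k : comNzRingType) (T U W : Type) (f : T -> U -> W)
  (s : lcomb k T) (t : lcomb k U) : lcomb k W :=
  [seq (x.1 * y.1, f x.2 y.2) | x <- s, y <- t].
Definition lc_scale (k : comNzRingType) (T : Type) (a : k) (s : lcomb k T) :
  lcomb k T := [seq (a * x.1, x.2) | x <- s].

(** * Linear bicategories, block completion *)

(** The data of a [k]-linear bicategory that enter the block completion and the
    notion of equivalence.  2-cells form a setoid for [eq2]; [vcomp], [comp1]
    and [hcomp] compose from right to left.  Associators and the axioms play no
    role in these notions and are not recorded. *)
Record lbicat (k : comNzRingType) := LBicat {
  cell0 : Type;
  cell1 : cell0 -> cell0 -> Type;
  cell2 : forall G H, cell1 G H -> cell1 G H -> Type;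
  eq2 : forall G H (u v : cell1 G H), cell2 u v -> cell2 u v -> Prop;
  zero2 : forall G H (u v : cell1 G H), cell2 u v;
  add2 : forall G H (u v : cell1 G H), cell2 u v -> cell2 u v -> cell2 u v;
  scale2 : forall G H (u v : cell1 G H), k -> cell2 u v -> cell2 u v;
  id2 : forall G H (u : cell1 G H), cell2 u u;
  vcomp : forall G H (u v w : cell1 G H), cell2 v w -> cell2 u v -> cell2 u w;
  id1 : forall G, cell1 G G;
  comp1 : forall G H L, cell1 H L -> cell1 G H -> cell1 G L;
  hcomp : forall G H L (v v' : cell1 H L) (u u' : cell1 G H),
    cell2 v v' -> cell2 u u' -> cell2 (comp1 v u) (comp1 v' u');
  lunit : forall G H (u : cell1 G H), cell2 (comp1 (id1 H) u) u;
  lunitV : forall G H (u : cell1 G H), cell2 u (comp1 (id1 H) u);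
  runit : forall G H (u : cell1 G H), cell2 (comp1 u (id1 G)) u;
  runitV : forall G H (u : cell1 G H), cell2 u (comp1 u (id1 G)) }.

Arguments cell0 {k} _.
Arguments cell1 {k} _ _ _.
Arguments cell2 {k _ G H} _ _.
Arguments eq2 {k _ G H u v} _ _.
Arguments zero2 {k _ G H} u v.
Arguments add2 {k _ G H u v} _ _.
Arguments scale2 {k _ G H u v} _ _.
Arguments id2 {k _ G H} u.
Arguments vcomp {k _ G H u v w} _ _.
Arguments id1 {k _} G.
Arguments comp1 {k _ G H L} _ _.
Arguments hcomp {k _ G H L v v' u u'} _ _.
Arguments lunit {k _ G H} u.
Arguments lunitV {k _ G H} u.
Arguments runit {k _ G H} u.
Arguments runitV {k _ G H} u.

Notation "x ≈ y" := (eq2 x y) (at level 70).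
Notation "y ⊙ x" := (vcomp y x) (at level 40, left associativity).

(** Action of endomorphisms of identity 1-cells by whiskering. *)
Definition act_src (k : comNzRingType) (B : lbicat k) (G H : cell0 B)
  (e : cell2 (id1 G) (id1 G)) (u : cell1 B G H) : cell2 u u :=
  runit u ⊙ hcomp (id2 u) e ⊙ runitV u.
Definition act_tgt (k : comNzRingType) (B : lbicat k) (G H : cell0 B)
  (f : cell2 (id1 H) (id1 H)) (u : cell1 B G H) : cell2 u u :=
  lunit u ⊙ hcomp f (id2 u) ⊙ lunitV u.

(** Additive idempotent completion of the category [B(G,H)]: an object is a
    finite formal sum of 1-cells with an idempotent matrix of 2-cells.  Here and
    below the defining conditions are predicates on the underlying data. *)
Section HomCompletion.
Variables (k : comNzRingType) (B : lbicat k) (G H : cell0 B).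

Record kobj := KObj {
  kix : finType;
  kfam : kix -> cell1 B G H;
  kidem : forall a b, cell2 (kfam a) (kfam b) }.

Definition kmat (U V : kobj) :=
  forall (a : kix U) (b : kix V), cell2 (kfam a) (kfam b).
Definition keq (U V : kobj) (m n : kmat U V) : Prop := forall a b, m a b ≈ n a b.
Definition kcomp (U V W : kobj) (n : kmat V W) (m : kmat U V) : kmat U W :=
  fun a c => \big[@add2 _ _ _ _ _ _/zero2 (kfam a) (kfam c)]_(b : kix V) (n b c ⊙ m a b).

Definition kvalid (U : kobj) : Prop :=
  keq (kcomp (@kidem U) (@kidem U)) (@kidem U).

Definition kis_hom (U V : kobj) (m : kmat U V) : Prop :=
  keq (kcomp (@kidem V) m) m /\ keq (kcomp m (@kidem U)) m.

Definition kiso (U V : kobj) : Prop :=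
  exists (m : kmat U V) (n : kmat V U),
    [/\ kis_hom m, kis_hom n, keq (kcomp n m) (@kidem U)
      & keq (kcomp m n) (@kidem V)].

(** [e] and [f] act as the identity on [U]. *)
Definition kfixed (e : cell2 (id1 G) (id1 G)) (f : cell2 (id1 H) (id1 H))
    (U : kobj) : Prop :=
  forall a b : kix U,
    act_src e (kfam b) ⊙ kidem a b ≈ kidem a b /\
    act_tgt f (kfam b) ⊙ kidem a b ≈ kidem a b.

Definition kzero : kobj :=
  @KObj void (fun x => of_void _ x) (fun x _ => of_void _ x).
End HomCompletion.

Section BlockCompletion.
Variables (k : comNzRingType) (B : lbicat k).

(** Formal finite direct sums of pairs [(G_i, e_i)]. *)
Record bobj := BObj {
  bix : finType;
  bgr : bix -> cell0 B;
  bid : forall i, cell2 (id1 (bgr i)) (id1 (bgr i)) }.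

Definition bvalid (X : bobj) : Prop := forall i : bix X, bid i ⊙ bid i ≈ bid i.

Definition bsingle (G : cell0 B) (e : cell2 (id1 G) (id1 G)) : bobj :=
  @BObj unit (fun _ => G) (fun _ => e).

Definition bcell (X Y : bobj) :=
  forall (i : bix X) (j : bix Y), kobj (bgr i) (bgr j).

Definition bcell_valid (X Y : bobj) (f : bcell X Y) : Prop :=
  forall i j, kvalid (f i j) /\ kfixed (bid i) (bid j) (f i j).

Definition bcell_iso (X Y : bobj) (f g : bcell X Y) : Prop :=
  forall i j, kiso (f i j) (g i j).

Definition bcell_id (X : bobj) : bcell X X := fun i j =>
  match i =P j with
  | ReflectT e =>
      match e in _ = j' return kobj (bgr i) (bgr j') with
      | erefl => @KObj k B (bgr i) (bgr i) unit (fun _ => id1 _) (fun _ _ => bid i)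
      end
  | ReflectF _ => kzero _ _
  end.

(** Matrix product: the [(i,l)] entry is the direct sum over [j] of the
    composites of [g j l] and [f i j]. *)
Section Comp.
Variables (X Y Z : bobj) (g : bcell Y Z) (f : bcell X Y).
Variables (i : bix X) (l : bix Z).

Definition bc_ix : finType := {j : bix Y & (kix (g j l) * kix (f i j))%type}.
Definition bc_fam (z : bc_ix) : cell1 B (bgr i) (bgr l) :=
  comp1 (kfam (tagged z).1) (kfam (tagged z).2).
Definition bc_idem (z z' : bc_ix) : cell2 (bc_fam z) (bc_fam z') :=
  let: existT j p := z return cell2 (bc_fam z) (bc_fam z') in
  let: existT j' p' := z'
    return cell2 (bc_fam (existT _ j p)) (bc_fam z') in
  match j =P j' with
  | ReflectT e =>
      match e in _ = j1 return forall p' : kix (g j1 l) * kix (f i j1),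
        cell2 (bc_fam (existT _ j p)) (bc_fam (existT _ j1 p')) with
      | erefl => fun p' => hcomp (kidem p.1 p'.1) (kidem p.2 p'.2)
      end p'
  | ReflectF _ => zero2 _ _
  end.
End Comp.

Definition bcell_comp (X Y Z : bobj) (g : bcell Y Z) (f : bcell X Y) : bcell X Z :=
  fun i l => @KObj k B (bgr i) (bgr l) _ _ (@bc_idem X Y Z g f i l).

Definition bis_equiv (X Y : bobj) (f : bcell X Y) : Prop :=
  [/\ bvalid X, bvalid Y, bcell_valid f
    & exists g : bcell Y X, [/\ bcell_valid g,
        bcell_iso (bcell_comp g f) (@bcell_id X)
      & bcell_iso (bcell_comp f g) (@bcell_id Y)]].

Definition bequiv (X Y : bobj) : Prop := exists f : bcell X Y, bis_equiv f.
End BlockCompletion.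

(** The data of a linear pseudo-functor that enter its extension to block
    completions: its values on cells, and the comparison
    [id1 (F G) ≅ F (id1 G)]. *)
Record psfun (k : comNzRingType) (B C : lbicat k) := PsFun {
  ps0 : cell0 B -> cell0 C;
  ps1 : forall G H, cell1 B G H -> cell1 C (ps0 G) (ps0 H);
  ps2 : forall G H (u v : cell1 B G H), cell2 u v -> cell2 (ps1 u) (ps1 v);
  ps_unit : forall G, cell2 (id1 (ps0 G)) (ps1 (id1 G));
  ps_unitV : forall G, cell2 (ps1 (id1 G)) (id1 (ps0 G)) }.

Section BlockExtension.
Variables (k : comNzRingType) (B C : lbicat k) (F : psfun B C).

Definition bps0 (X : bobj B) : bobj C :=
  @BObj k C (bix X) (fun i => ps0 F (bgr i))
    (fun i => ps_unitV F (bgr i) ⊙ ps2 F (bid i) ⊙ ps_unit F (bgr i)).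

Definition bps1 (X Y : bobj B) (f : bcell X Y) : bcell (bps0 X) (bps0 Y) :=
  fun (i : bix X) (j : bix Y) =>
    @KObj k C (ps0 F (bgr i)) (ps0 F (bgr j)) (kix (f i j))
    (fun a => ps1 F (kfam a)) (fun a b => ps2 F (kidem a b)).
End BlockExtension.

(** * The bicategory of spans *)

Definition span_bicat (k : comNzRingType) : lbicat k :=
  @LBicat k gpd span
    (fun G H u v => lcomb k (span2 u v))
    (fun G H u v => lc_eq (@iso2 G H u v) (@sum2 G H u v))
    (fun G H u v => [::])
    (fun G H u v => cat)
    (fun G H u v => @lc_scale k (span2 u v))
    (fun G H u => [:: (1, span2_id u)])
    (fun G H u v w => lc_map2 (@span2_vcomp G H u v w))
    span_id
    span_comp
    (fun G H L v v' u u' => lc_map2 (@span2_hcomp G H L u u' v v'))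
    (fun G H u => [:: (1, span_lunit u)])
    (fun G H u => [:: (1, span2_rev (span_lunit u))])
    (fun G H u => [:: (1, span_runit u)])
    (fun G H u => [:: (1, span2_rev (span_runit u))]).

(** * Right-free bisets and permutation bimodules *)

(** Quotient of a finite type by an equivalence relation, as a type of classes. *)
Section Classes.
Variables (T : finType) (r : rel T).

Definition fquot : finType := {C : {set T} | [exists z, C == [set z' | r z z']]}.

Lemma fcls_subproof z : [exists z0, [set z' | r z z'] == [set z' | r z0 z']].
Proof. by apply/existsP; exists z. Qed.
Definition fcls (z : T) : fquot := exist _ [set z' | r z z'] (fcls_subproof z).
Definition frep (C : fquot) : T := xchoose (existsP (valP C)).

Lemma frepK : cancel frep fcls.
Proof. by move=> C; apply/val_inj/esym/eqP/(xchooseP (existsP (valP C))). Qed.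

Hypothesis r_equiv : equivalence_rel r.

Lemma fclsE z z' : (fcls z == fcls z') = r z z'.
Proof.
apply/eqP/idP => [/(congr1 val)/setP/(_ z') | rzz'].
  by rewrite !inE (r_equiv z' z' z').1.
by apply/val_inj/setP => t; rewrite !inE (r_equiv z z' t).2.
Qed.
Lemma frep_rel z : r (frep (fcls z)) z.
Proof. by rewrite -fclsE frepK. Qed.
End Classes.

(** A finite right-free [(H,G)]-biset; [bcar y x] has a left action of the
    morphisms of [H] starting at [y] and a right action of the morphisms of [G]
    ending at [x]. *)
Record biset (G H : gpd) := Biset {
  bcar : H -> G -> finType;
  lact : forall x y y', hom y y' -> bcar y x -> bcar y' x;
  ract : forall y x x', bcar y x -> hom x' x -> bcar y x';
  lact1 : forall x y (s : bcar y x), lact (gid y) s = s;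
  lactM : forall x y y' y'' (h' : hom y' y'') (h : hom y y') (s : bcar y x),
    lact (h' ∘ h) s = lact h' (lact h s);
  ract1 : forall y x (s : bcar y x), ract s (gid x) = s;
  ractM : forall y x x' x'' (s : bcar y x) (g : hom x' x) (g' : hom x'' x'),
    ract s (g ∘ g') = ract (ract s g) g';
  lractC : forall y y' x x' (h : hom y y') (s : bcar y x) (g : hom x' x),
    lact h (ract s g) = ract (lact h s) g;
  rfree : forall y x (s : bcar y x) (g : hom x x), ract s g = s -> g = gid x }.
Arguments bcar {G H} _ _ _.
Arguments lact {G H _ x y y'} _ _.
Arguments ract {G H _ y x x'} _ _.

Definition biset_id (G : gpd) : biset G G :=
  @Biset G G (fun y x => hom x y) (fun _ _ _ h s => h ∘ s) (fun _ _ _ s g => s ∘ g)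
    (fun _ _ s => gid_l s) (fun _ _ _ _ h' h s => esym (gcompA h' h s))
    (fun _ _ s => gid_r s) (fun _ _ _ _ s g g' => gcompA s g g')
    (fun _ _ _ _ h s g => gcompA h s g)
    (fun _ _ s g e => gcompIl (etrans e (esym (gid_r s)))).

(** [V ×_H U], whose linearization is [kV ⊗_{kH} kU]. *)
Section BisetComp.
Variables (G H L : gpd) (V : biset H L) (U : biset G H).

Definition bcT (z : L) (x : G) : finType := {y : H & (bcar V z y * bcar U y x)%type}.
Definition bc_rel (z : L) (x : G) (t t' : bcT z x) : bool :=
  [exists h : hom (tag t) (tag t'),
    ((tagged t).1 == ract (tagged t').1 h) && ((tagged t').2 == lact h (tagged t).2)].
Definition bcMk (z : L) (y : H) (x : G) (v : bcar V z y) (u : bcar U y x) : bcT z x :=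
  existT (fun y : H => (bcar V z y * bcar U y x)%type) y (v, u).

Lemma bc_relP z x (t t' : bcT z x) :
  reflect (exists h : hom (tag t) (tag t'),
    (tagged t).1 = ract (tagged t').1 h /\ (tagged t').2 = lact h (tagged t).2)
    (bc_rel t t').
Proof.
by apply: (iffP existsP) => [[h /andP[/eqP ? /eqP ?]] | [h [-> ->]]];
   exists h; rewrite ?eqxx.
Qed.

Lemma bc_equiv z x : equivalence_rel (@bc_rel z x).
Proof.
have rr t : bc_rel t t.
  by apply/bc_relP; exists (gid _); rewrite ract1 lact1.
have rs t t' : bc_rel t t' -> bc_rel t' t.
  case/bc_relP => h [e1 e2]; apply/bc_relP; exists (ginv h).
  by rewrite e1 e2 -ractM ginv_r ract1 -lactM ginv_l lact1.
have rt t t' t'' : bc_rel t t' -> bc_rel t' t'' -> bc_rel t t''.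
  case/bc_relP => h [e1 e2] /bc_relP[h' [e1' e2']]; apply/bc_relP; exists (h' ∘ h).
  by rewrite e1 e2' e1' e2 -ractM -lactM.
move=> t t' t''; split=> // tt'; apply/idP/idP; last exact: rt.
by apply: rt; apply: rs.
Qed.

Definition bc_car (z : L) (x : G) : finType := fquot (@bc_rel z x).

Definition bc_actT (z z' : L) (x x' : G) (l : hom z z') (g : hom x' x)
    (t : bcT z x) : bcT z' x' :=
  bcMk (lact l (tagged t).1) (ract (tagged t).2 g).

Lemma bc_actT_rel z z' x x' (l : hom z z') (g : hom x' x) t t' :
  bc_rel t t' -> bc_rel (bc_actT l g t) (bc_actT l g t').
Proof.
case/bc_relP => h [e1 e2]; apply/bc_relP; exists h => /=.
by rewrite e1 e2 !lractC.
Qed.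

Definition bc_act (z z' : L) (x x' : G) (l : hom z z') (g : hom x' x)
    (C : bc_car z x) : bc_car z' x' := fcls _ (bc_actT l g (frep C)).

Lemma bc_actE z z' x x' (l : hom z z') (g : hom x' x) (t : bcT z x) :
  bc_act l g (fcls _ t) = fcls _ (bc_actT l g t).
Proof.
apply/eqP; rewrite fclsE; last exact: bc_equiv.
exact/bc_actT_rel/frep_rel/bc_equiv.
Qed.

Lemma bc_actM z z' z'' x x' x'' (l' : hom z' z'') (l : hom z z')
    (g : hom x' x) (g' : hom x'' x') (C : bc_car z x) :
  bc_act l' g' (bc_act l g C) = bc_act (l' ∘ l) (g ∘ g') C.
Proof.
by rewrite -[C]frepK !bc_actE /bc_actT /= lactM ractM.
Qed.
Lemma bc_act1 z x (C : bc_car z x) : bc_act (gid z) (gid x) C = C.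
Proof.
rewrite -[C]frepK bc_actE /bc_actT /= lact1 ract1.
by congr fcls; case: (frep C) => y [].
Qed.

Program Definition biset_comp : biset G L :=
  @Biset G L bc_car (fun x _ _ l => bc_act l (gid x))
    (fun z _ _ C g => bc_act (gid z) g C) _ _ _ _ _ _.
Next Obligation. by move=> *; exact: bc_act1. Qed.
Next Obligation. by move=> * /=; rewrite bc_actM gid_l. Qed.
Next Obligation. by move=> *; exact: bc_act1. Qed.
Next Obligation. by move=> * /=; rewrite bc_actM gid_l. Qed.
Next Obligation. by move=> * /=; rewrite !bc_actM !gid_l !gid_r. Qed.
Next Obligation.
move=> z x C g; rewrite -[C]frepK bc_actE => /eqP.
rewrite fclsE; last exact: bc_equiv.
case/bc_relP => /= h [e1 e2].
move: e1; rewrite lact1 => /esym/rfree eh; move: e2.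
rewrite eh lact1 => e2; exact: (rfree (esym e2)).
Qed.
End BisetComp.

(** Bimodule homomorphisms [kU -> kV], as matrices in the bases [U] and [V]:
    [s] is sent to [\sum_t ker s t *: t]. *)
Record bihom (k : comNzRingType) (G H : gpd) (U V : biset G H) := Bihom {
  bker :> forall y x, bcar U y x -> bcar V y x -> k;
  bkerE : forall y y' x x' (h : hom y y') (g : hom x' x) s t,
    bker (lact h (ract s g)) (lact h (ract t g)) = @bker y x s t }.

Section Bihoms.
Variables (k : comNzRingType) (G H : gpd).
Implicit Types U V W : biset G H.

Definition bact U (y y' : H) (x x' : G) (h : hom y y') (g : hom x' x)
  (s : bcar U y x) : bcar U y' x' := lact h (ract s g).

Lemma bactK U y y' x x' (h : hom y y') (g : hom x' x) :
  cancel (@bact U y y' x x' h g) (bact (ginv h) (ginv g)).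
Proof.
by move=> s; rewrite /bact -lractC -lactM -ractM ginv_l ginv_r lact1 ract1.
Qed.
Lemma bactVK U y y' x x' (h : hom y y') (g : hom x' x) :
  cancel (bact (ginv h) (ginv g)) (@bact U y y' x x' h g).
Proof.
by move=> s; rewrite /bact -lractC -lactM -ractM ginv_l ginv_r lact1 ract1.
Qed.
Lemma bact_bij U y y' x x' (h : hom y y') (g : hom x' x) :
  bijective (@bact U y y' x x' h g).
Proof. exists (bact (ginv h) (ginv g)); [exact: bactK | exact: bactVK]. Qed.

Definition bihom_eq U V (m n : bihom k U V) : Prop :=
  forall y x s t, @bker _ _ _ _ _ m y x s t = n y x s t.

Program Definition bihom0 U V : bihom k U V :=
  @Bihom k G H U V (fun _ _ _ _ => 0) _.
Next Obligation. by []. Qed.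
Program Definition bihom_add U V (m n : bihom k U V) : bihom k U V :=
  @Bihom k G H U V (fun y x s t => m y x s t + n y x s t) _.
Next Obligation. by move=> * /=; rewrite !bkerE. Qed.
Program Definition bihom_scale U V (a : k) (m : bihom k U V) : bihom k U V :=
  @Bihom k G H U V (fun y x s t => a * m y x s t) _.
Next Obligation. by move=> * /=; rewrite !bkerE. Qed.
Program Definition bihom_vcomp U V W (n : bihom k V W) (m : bihom k U V) :
  bihom k U W :=
  @Bihom k G H U W (fun y x s r => \sum_(t : bcar V y x) m y x s t * n y x t r) _.
Next Obligation.
move=> U V W n m y y' x x' h g s r /=.
rewrite (reindex (@bact V _ _ _ _ h g)) /=; last exact/onW_bij/bact_bij.
by apply: eq_bigr => t _; rewrite /bact !bkerE.
Qed.

(** The homomorphism defined by an equivariant map [f], and its transpose, which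
    is the inverse when [f] is bijective. *)
Section OfMap.
Variables (U V : biset G H) (f : forall y x, bcar U y x -> bcar V y x).
Hypothesis fE : forall y y' x x' (h : hom y y') (g : hom x' x) (s : bcar U y x),
  f (bact h g s) = bact h g (f s).

Program Definition bihom_of : bihom k U V :=
  @Bihom k G H U V (fun y x s t => (f s == t)%:R) _.
Next Obligation.
move=> y y' x x' h g s t /=; have /= -> := fE h g s.
by rewrite -[lact h (ract t g)]/(bact h g t) (inj_eq (bij_inj (@bact_bij V _ _ _ _ h g))).
Qed.
Program Definition bihom_tr : bihom k V U :=
  @Bihom k G H V U (fun y x t s => (f s == t)%:R) _.
Next Obligation. by move=> *; apply: (bkerE bihom_of). Qed.
End OfMap.

Program Definition bihom_id U : bihom k U U := @bihom_of U U (fun _ _ s => s) _.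
Next Obligation. by []. Qed.
End Bihoms.

(** Tensor product of bimodule homomorphisms. *)
Section BihomHComp.
Variables (k : comNzRingType) (G H L : gpd) (V V' : biset H L) (U U' : biset G H).
Variables (n : bihom k V V') (m : bihom k U U').

(** Coefficient of the class [C'] in the image of the class of [t]. *)
Definition bh_ker (z : L) (x : G) (t : bcT V U z x) (C' : bc_car V' U' z x) : k :=
  \sum_(p : bcar V' z (tag t) * bcar U' (tag t) x | fcls _ (bcMk p.1 p.2) == C')
    n _ _ (tagged t).1 p.1 * m _ _ (tagged t).2 p.2.

Lemma bh_ker_rel z x (t t' : bcT V U z x) C' :
  bc_rel t t' -> bh_ker t C' = bh_ker t' C'.
Proof.
case/bc_relP; case: t t' => [y [v u]] [y' [v' u']] /= h [-> ->].
rewrite /bh_ker /=.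
pose F (p : bcar V' z y' * bcar U' y' x) := (ract p.1 h, lact (ginv h) p.2).
pose F' (p : bcar V' z y * bcar U' y x) := (ract p.1 (ginv h), lact h p.2).
have FK : cancel F F'.
  by case=> p q; rewrite /F /F' /= -ractM -lactM !ginv_r ract1 lact1.
have F'K : cancel F' F.
  by case=> p q; rewrite /F /F' /= -ractM -lactM !ginv_l ract1 lact1.
rewrite (reindex F) /=; last by apply: onW_bij; exists F'.
apply: eq_big => [[p q]|[p q] _] /=.
  congr (_ == _); apply/eqP; rewrite fclsE; last exact: bc_equiv.
  by apply/bc_relP; exists h => /=; rewrite -lactM ginv_r lact1.
have e1 := @bkerE _ _ _ _ _ n _ _ _ _ (gid z) h v' p.
have e2 := @bkerE _ _ _ _ _ m _ _ _ _ h (gid x) u (lact (ginv h) q).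
by rewrite !lact1 in e1; rewrite !ract1 -lactM ginv_r lact1 in e2; rewrite e1 e2.
Qed.

Lemma bh_ker_act z z' x x' (l : hom z z') (g : hom x' x) t C' :
  bh_ker (bc_actT l g t) (bc_act l g C') = bh_ker t C'.
Proof.
case: t => [y [v u]]; rewrite /bh_ker /=.
pose F (p : bcar V' z y * bcar U' y x) := (lact l p.1, ract p.2 g).
pose F' (p : bcar V' z' y * bcar U' y x') := (lact (ginv l) p.1, ract p.2 (ginv g)).
have FK : cancel F F'.
  by case=> p q; rewrite /F /F' /= -ractM -lactM ginv_r ginv_l ract1 lact1.
have F'K : cancel F' F.
  by case=> p q; rewrite /F /F' /= -ractM -lactM ginv_r ginv_l ract1 lact1.
rewrite (reindex F) /=; last by apply: onW_bij; exists F'.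
apply: eq_big => [[p q]|[p q] _] /=.
  have -> : fcls (@bc_rel _ _ _ V' U' z' x') (bcMk (lact l p) (ract q g))
          = bc_act l g (fcls _ (bcMk p q)) by rewrite bc_actE.
  apply/eqP/eqP => [/(congr1 (bc_act (ginv l) (ginv g)))| -> //].
  by rewrite !bc_actM !ginv_l !ginv_r !bc_act1.
have e1 := @bkerE _ _ _ _ _ n _ _ _ _ l (gid y) v p.
have e2 := @bkerE _ _ _ _ _ m _ _ _ _ (gid y) g u q.
by rewrite !ract1 in e1; rewrite !lact1 in e2; rewrite e1 e2.
Qed.

Program Definition bihom_hcomp : bihom k (biset_comp V U) (biset_comp V' U') :=
  @Bihom k G L (biset_comp V U) (biset_comp V' U') (fun z x C C' => bh_ker (frep C) C') _.
Next Obligation.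
move=> z z' x x' l g C C' /=; rewrite !bc_actM !gid_r.
rewrite -(bh_ker_act l g (frep C)); apply: bh_ker_rel.
exact/frep_rel/bc_equiv.
Qed.
End BihomHComp.

Section BisetUnitors.
Variables (k : comNzRingType) (G H : gpd) (U : biset G H).

Definition bl_map y x (C : bcar (biset_comp (biset_id H) U) y x) : bcar U y x :=
  lact (tagged (frep C)).1 (tagged (frep C)).2.
Definition br_map y x (C : bcar (biset_comp U (biset_id G)) y x) : bcar U y x :=
  ract (tagged (frep C)).1 (tagged (frep C)).2.

Lemma bl_mapE y x (t : bcT (biset_id H) U y x) :
  bl_map (fcls _ t) = lact (tagged t).1 (tagged t).2.
Proof.
rewrite /bl_map; have := frep_rel (@bc_equiv _ _ _ (biset_id H) U y x) t.
by case/bc_relP => h [-> ->]; rewrite -lactM.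
Qed.
Lemma br_mapE y x (t : bcT U (biset_id G) y x) :
  br_map (fcls _ t) = ract (tagged t).1 (tagged t).2.
Proof.
rewrite /br_map; have := frep_rel (@bc_equiv _ _ _ U (biset_id G) y x) t.
by case/bc_relP => h [-> ->]; rewrite -ractM.
Qed.

Lemma bl_map_equi y y' x x' (h : hom y y') (g : hom x' x) C :
  bl_map (bact h g C) = bact h g (@bl_map y x C).
Proof.
rewrite -[C]frepK /bact /= !bc_actE !bl_mapE /=.
by rewrite gid_l !lactM ract1 !lractC.
Qed.
Lemma br_map_equi y y' x x' (h : hom y y') (g : hom x' x) C :
  br_map (bact h g C) = bact h g (@br_map y x C).
Proof.
rewrite -[C]frepK /bact /= !bc_actE !br_mapE /=.
by rewrite gid_r !ractM lact1 !lractC.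
Qed.
End BisetUnitors.

Definition biperm_bicat (k : comNzRingType) : lbicat k :=
  @LBicat k gpd biset (@bihom k) (@bihom_eq k) (@bihom0 k) (@bihom_add k)
    (@bihom_scale k) (@bihom_id k) (@bihom_vcomp k) biset_id biset_comp
    (@bihom_hcomp k)
    (fun G H U => bihom_of k (@bl_map_equi G H U))
    (fun G H U => bihom_tr k (@bl_map_equi G H U))
    (fun G H U => bihom_of k (@br_map_equi G H U))
    (fun G H U => bihom_tr k (@br_map_equi G H U)).

(** * The pseudo-functor from spans to permutation bimodules *)

(** [kH ⊗_{kP} kG] for a span [(u, P, i)]: classes of triples [(p, h, g)] with
    [h : i p -> y] and [g : x -> u p]. *)
Section SpanBiset.
Variables (G H : gpd) (s : span G H).

Definition spT (y : H) (x : G) : finType :=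
  {p : apex s & (hom (legr s p) y * hom x (legl s p))%type}.
Definition spMk y x (p : apex s) (h : hom (legr s p) y) (g : hom x (legl s p)) :
  spT y x :=
  existT (fun p : apex s => (hom (legr s p) y * hom x (legl s p))%type) p (h, g).
Definition sp_rel y x (t t' : spT y x) : bool :=
  [exists a : hom (tag t) (tag t'), ((tagged t).1 == (tagged t').1 ∘ fmor (legr s) a)
    && ((tagged t').2 == fmor (legl s) a ∘ (tagged t).2)].

Lemma sp_relP y x (t t' : spT y x) :
  reflect (exists a : hom (tag t) (tag t'),
    (tagged t).1 = (tagged t').1 ∘ fmor (legr s) a
    /\ (tagged t').2 = fmor (legl s) a ∘ (tagged t).2)
    (sp_rel t t').
Proof.
by apply: (iffP existsP) => [[h /andP[/eqP ? /eqP ?]] | [h [-> ->]]];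
   exists h; rewrite ?eqxx.
Qed.

Lemma sp_equiv y x : equivalence_rel (@sp_rel y x).
Proof.
have rr t : sp_rel t t.
  by apply/sp_relP; exists (gid _); rewrite !fmor1 gid_l gid_r.
have rs t t' : sp_rel t t' -> sp_rel t' t.
  case/sp_relP => h [e1 e2]; apply/sp_relP; exists (ginv h).
  by rewrite e1 e2 !fmorV gcompKr gcompKl.
have rt t t' t'' : sp_rel t t' -> sp_rel t' t'' -> sp_rel t t''.
  case/sp_relP => h [e1 e2] /sp_relP[h' [e1' e2']]; apply/sp_relP; exists (h' ∘ h).
  by rewrite e1 e2' e1' e2 !fmorM !gcompA.
move=> t t' t''; split=> // tt'; apply/idP/idP; last exact: rt.
by apply: rt; apply: rs.
Qed.

Definition sp_car y x : finType := fquot (@sp_rel y x).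
Definition sp_actT y y' x x' (h : hom y y') (g : hom x' x) (t : spT y x) : spT y' x' :=
  spMk (h ∘ (tagged t).1) ((tagged t).2 ∘ g).

Lemma sp_actT_rel y y' x x' (h : hom y y') (g : hom x' x) t t' :
  sp_rel t t' -> sp_rel (sp_actT h g t) (sp_actT h g t').
Proof.
case/sp_relP => a [e1 e2]; apply/sp_relP; exists a => /=.
by rewrite e1 e2 !gcompA.
Qed.

Definition sp_act y y' x x' (h : hom y y') (g : hom x' x) (C : sp_car y x) :
  sp_car y' x' := fcls _ (sp_actT h g (frep C)).

Lemma sp_actE y y' x x' (h : hom y y') (g : hom x' x) (t : spT y x) :
  sp_act h g (fcls _ t) = fcls _ (sp_actT h g t).
Proof.
apply/eqP; rewrite fclsE; last exact: sp_equiv.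
exact/sp_actT_rel/frep_rel/sp_equiv.
Qed.
Lemma sp_actM y y' y'' x x' x'' (h' : hom y' y'') (h : hom y y')
    (g : hom x' x) (g' : hom x'' x') (C : sp_car y x) :
  sp_act h' g' (sp_act h g C) = sp_act (h' ∘ h) (g ∘ g') C.
Proof. by rewrite -[C]frepK !sp_actE /sp_actT /= !gcompA. Qed.
Lemma sp_act1 y x (C : sp_car y x) : sp_act (gid y) (gid x) C = C.
Proof.
rewrite -[C]frepK sp_actE /sp_actT /= gid_l gid_r.
by congr fcls; case: (frep C) => p [].
Qed.

Program Definition span_biset : biset G H :=
  @Biset G H sp_car (fun x _ _ h => sp_act h (gid x))
    (fun y _ _ C g => sp_act (gid y) g C) _ _ _ _ _ _.
Next Obligation. by move=> *; exact: sp_act1. Qed.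
Next Obligation. by move=> * /=; rewrite sp_actM gid_l. Qed.
Next Obligation. by move=> *; exact: sp_act1. Qed.
Next Obligation. by move=> * /=; rewrite sp_actM gid_l. Qed.
Next Obligation. by move=> * /=; rewrite !sp_actM !gid_l !gid_r. Qed.
Next Obligation.
move=> y x C g; rewrite -[C]frepK sp_actE => /eqP.
rewrite fclsE; last exact: sp_equiv.
case/sp_relP => /= a [e1 e2]; move: e1 e2; rewrite gid_l => e1.
have -> : a = gid _.
  apply: (@legr_faithful _ _ s); rewrite fmor1.
  by apply: (gcompIl (g := (tagged (frep C)).1)); rewrite /= -e1 gid_r.
rewrite fmor1 gid_l => e2.
by apply: (gcompIl (g := (tagged (frep C)).2)); rewrite /= -e2 gid_r.
Qed.
End SpanBiset.

(** The map [i_!u^* -> i_!b_!b^*u^* ≅ j_!c_!c^*v^* -> j_!v^*] of a 2-cell span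
    [P <-b- Q -c-> P'].  The unit of [b^* -| b_!] is
    [m |-> \sum_(q,a) [q, a, a^-1 m]], summed over isomorphism classes of pairs
    [(q, a : b q -> p)], and the counit of [c_! -| c^*] is [[q, a, n] |-> a n]. *)
Section Span2Bihom.
Variables (k : comNzRingType) (G H : gpd) (s t : span G H) (w : span2 s t).

Definition fibT (p : apex s) : finType := {q : apx w & hom (bleg w q) p}.
Definition fib_rel (p : apex s) (f f' : fibT p) : bool :=
  [exists c : hom (tag f) (tag f'), tagged f' ∘ fmor (bleg w) c == tagged f].

Definition sp_img y x (z : spT s y x) (f : fibT (tag z)) : spT t y x :=
  spMk ((tagged z).1 ∘ fmor (legr s) (tagged f) ∘ ginv (rnat w (tag f)))
       (lnat w (tag f) ∘ fmor (legl s) (ginv (tagged f)) ∘ (tagged z).2).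

(** Coefficient of [C'] in the image of the class of [z]. *)
Definition sp_ker y x (z : spT s y x) (C' : sp_car t y x) : k :=
  #|[set fcls (@fib_rel (tag z)) f | f : fibT (tag z) & fcls _ (sp_img f) == C']|%:R.

Lemma fib_relP p (f f' : fibT p) :
  reflect (exists c : hom (tag f) (tag f'), tagged f' ∘ fmor (bleg w) c = tagged f)
    (fib_rel f f').
Proof. by apply: (iffP existsP) => [[c /eqP e] | [c e]]; exists c; rewrite ?e. Qed.

Lemma fib_equiv p : equivalence_rel (@fib_rel p).
Proof.
have rr f : fib_rel f f by apply/fib_relP; exists (gid _); rewrite fmor1 gid_r.
have rs f f' : fib_rel f f' -> fib_rel f' f.
  case/fib_relP => c e; apply/fib_relP; exists (ginv c).
  by rewrite -e fmorV gcompKr.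
have rt f f' f'' : fib_rel f f' -> fib_rel f' f'' -> fib_rel f f''.
  case/fib_relP => c e /fib_relP[c' e']; apply/fib_relP; exists (c' ∘ c).
  by rewrite fmorM gcompA e'.
move=> f f' f''; split=> // ff'; apply/idP/idP; last exact: rt.
by apply: rt; apply: rs.
Qed.

Lemma sp_ker_rel y x (z z' : spT s y x) C' :
  sp_rel z z' -> sp_ker z C' = sp_ker z' C'.
Proof.
case/sp_relP; case: z z' => [p [h g]] [p' [h' g']] /= a [-> ->].
rewrite /sp_ker /=; congr (_%:R).
pose F (f : fibT p) : fibT p' :=
  existT (fun q : apx w => hom (bleg w q) p' : Type) (tag f) (a ∘ tagged f).
pose F' (f : fibT p') : fibT p :=
  existT (fun q : apx w => hom (bleg w q) p : Type) (tag f) (ginv a ∘ tagged f).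
have FK : cancel F F' by case=> q c; rewrite /F /F' /= gcompKl.
have F'K : cancel F' F by case=> q c; rewrite /F /F' /= gcompVKl.
have eF f f' : (fcls (@fib_rel p) f == fcls _ f')
             = (fcls (@fib_rel p') (F f) == fcls _ (F f')).
  rewrite !(fclsE (@fib_equiv _)).
  apply/fib_relP/fib_relP => -[c e]; exists c; first by rewrite /= -e gcompA.
  by apply: (gcompIl (g := a)); rewrite /= gcompA.
have eI f : fcls (@sp_rel _ _ t y x)
    (@sp_img y x (spMk (h' ∘ fmor (legr s) a) g) f) =
  fcls _ (@sp_img y x (spMk h' (fmor (legl s) a ∘ g)) (F f)).
  by rewrite /sp_img /= ginvM !fmorM !fmorV !gcompA gcompVKr.
set S := [set fcls _ f | f : fibT p & _].
set S' := [set fcls _ f | f : fibT p' & _].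
pose K (C : fquot (@fib_rel p)) := fcls (@fib_rel p') (F (frep C)).
have KE f : K (fcls _ f) = fcls _ (F f).
  by apply/eqP; rewrite /K -eF frepK.
have Kinj : injective K.
  by move=> D D' /eqP; rewrite /K -eF !frepK => /eqP.
rewrite -(card_imset (mem S) Kinj); apply: eq_card => C.
apply/imsetP/imsetP => -[]; last first.
  move=> f; rewrite inE -[f]F'K -eI => fC ->.
  exists (fcls _ (F' f)); last by rewrite KE F'K.
  by apply/imsetP; exists (F' f); rewrite // inE.
move=> D /imsetP[f]; rewrite inE eI => fC -> ->; exists (F f); rewrite ?KE //.
by rewrite inE.
Qed.

Lemma sp_ker_act y y' x x' (h : hom y y') (g : hom x' x) (z : spT s y x) C' :
  sp_ker (sp_actT h g z) (sp_act h g C') = sp_ker z C'.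
Proof.
rewrite /sp_ker /=; congr (_%:R); apply: eq_card => D.
suff e f : (fcls (@sp_rel _ _ t y' x') (@sp_img y' x' (sp_actT h g z) f) == sp_act h g C')
         = (fcls (@sp_rel _ _ t y x) (@sp_img y x z f) == C').
  by apply/imsetP/imsetP => -[f]; rewrite inE => fC ->; exists f; rewrite // inE;
     [rewrite -e | rewrite e].
have -> : @sp_img y' x' (sp_actT h g z) f = sp_actT h g (@sp_img y x z f).
  by rewrite /sp_img /sp_actT /= !gcompA.
rewrite -sp_actE; apply/eqP/eqP => [/(congr1 (sp_act (ginv h) (ginv g)))| -> //].
by rewrite !sp_actM !ginv_l !ginv_r !sp_act1.
Qed.

Program Definition span2_bihom : bihom k (span_biset s) (span_biset t) :=
  @Bihom k G H (span_biset s) (span_biset t) (fun y x C C' => sp_ker (frep C) C') _.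
Next Obligation.
move=> y y' x x' h g C C' /=; rewrite !sp_actM !gid_r.
rewrite -(sp_ker_act h g (frep C)); apply: sp_ker_rel.
exact/frep_rel/sp_equiv.
Qed.

End Span2Bihom.

Definition lin_bihom (k : comNzRingType) (G H : gpd) (s t : span G H)
    (c : lcomb k (span2 s t)) : bihom k (span_biset s) (span_biset t) :=
  \big[@bihom_add k G H _ _/@bihom0 k G H _ _]_(x <- c)
    bihom_scale x.1 (span2_bihom k x.2).

(** [kG ⊗_{kG} kG -> kG]. *)
Section UnitComparison.
Variables (G : gpd).

Definition pu_map (y x : G) (C : bcar (span_biset (span_id G)) y x) :
  bcar (biset_id G) y x := (tagged (frep C)).1 ∘ (tagged (frep C)).2.

Lemma pu_mapE y x (t : spT (span_id G) y x) :
  pu_map (fcls _ t) = (tagged t).1 ∘ (tagged t).2.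
Proof.
rewrite /pu_map; have := frep_rel (@sp_equiv _ _ (span_id G) y x) t.
by case/sp_relP => h [-> ->]; rewrite gcompA.
Qed.

Lemma pu_map_equi y y' x x' (h : hom y y') (g : hom x' x) C :
  pu_map (bact h g C) = bact h g (@pu_map y x C).
Proof.
rewrite -[C]frepK /bact /= !sp_actE !pu_mapE /=.
by rewrite gid_l gid_r !gcompA.
Qed.
End UnitComparison.

Definition span_to_biperm (k : comNzRingType) :
    psfun (span_bicat k) (biperm_bicat k) :=
  @PsFun k (span_bicat k) (biperm_bicat k) id (@span_biset) (@lin_bihom k)
    (fun G => bihom_tr k (@pu_map_equi G)) (fun G => bihom_of k (@pu_map_equi G)).

(** * Crossed Burnside ring *)

(** Crossed [G]-sets, for [G] the whole of [gT].  A left [G]-set is encoded as a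
    right action by [x * g := g^-1 x]; the map to [G^c] is then equivariant for
    the right conjugation [a ^ g = g^-1 * a * g]. *)
Record crossed (gT : finGroupType) := Crossed {
  xcar : finType;
  xact : {action gT &-> xcar};
  xmap : xcar -> gT;
  xmapJ : forall x g, xmap (xact x g) = (xmap x ^ g)%g }.

Section CrossedBurnside.
Variable gT : finGroupType.
Implicit Types X Y : crossed gT.

Definition crossed_iso X Y : Prop :=
  exists f : xcar X -> xcar Y,
    [/\ bijective f, forall x g, f (xact X x g) = xact Y (f x) g
      & forall x, xmap (f x) = xmap x].

Definition crossed_sum_act X Y (z : xcar X + xcar Y) (g : gT) : xcar X + xcar Y :=
  match z with inl x => inl (xact X x g) | inr y => inr (xact Y y g) end.
Lemma crossed_sum_act1 X Y (z : xcar X + xcar Y) : crossed_sum_act z 1%g = z.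
Proof. by case: z => x /=; rewrite act1. Qed.
Lemma crossed_sum_actM X Y (z : xcar X + xcar Y) : act_morph (@crossed_sum_act X Y) z.
Proof. by move=> g h; case: z => x /=; rewrite actM. Qed.
Definition crossed_sum_map X Y (z : xcar X + xcar Y) : gT :=
  match z with inl x => xmap x | inr y => xmap y end.

Program Definition crossed_sum X Y : crossed gT :=
  @Crossed gT (xcar X + xcar Y)%type
    (TotalAction (@crossed_sum_act1 X Y) (@crossed_sum_actM X Y))
    (@crossed_sum_map X Y) _.
Next Obligation. by move=> X Y [x|x] g /=; rewrite xmapJ. Qed.

(** [B^c_k(G)]; equality of elements is [lc_eq crossed_iso crossed_sum]. *)
Definition burnside (k : comNzRingType) := lcomb k (crossed gT).

(** The centre of the group algebra: class functions [z], standing for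
    [\sum_x z x *: x]. *)
Definition zgalg (k : comNzRingType) :=
  {z : {ffun gT -> k} | [forall x, forall g, z (x ^ g)%g == z x]}.

Section Maps.
Variable k : comNzRingType.

(** [X |-> \sum_(x in X^H) xmap x], an element of [Z k C_G(H)] viewed as a
    function on [gT]. On [[D,s]_G], the crossed set [G/D] with [gD |-> gsg^-1],
    this is the usual formula for the mark homomorphism at [H]. *)
Definition bphi (H : {set gT}) (b : burnside k) : {ffun gT -> k} :=
  [ffun z => \sum_(X <- b)
    X.1 * #|[set x in 'Fix_(xact X.2)(H)%g | xmap x == z]|%:R].

Definition brho_fun (b : burnside k) : {ffun gT -> k} :=
  [ffun z => \sum_(X <- b) X.1 * #|[set x : xcar X.2 | xmap x == z]|%:R].

Lemma brho_central b : [forall x, forall g, brho_fun b (x ^ g)%g == brho_fun b x].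
Proof.
apply/forallP => z; apply/forallP => g; rewrite !ffunE; apply/eqP.
apply: eq_bigr => X _; congr (_ * _%:R).
rewrite -[RHS](card_imset _ (@act_inj _ _ _ (xact X.2) g)).
apply: eq_card => x; rewrite inE; apply/idP/imsetP => [/eqP e|[y]].
  exists (xact X.2 x g^-1%g); last by rewrite actKV.
  by rewrite inE xmapJ e conjgK.
by rewrite inE => /eqP <- ->; rewrite xmapJ.
Qed.

(** [rho_G : B^c_k(G) -> Z(kG)], [X |-> \sum_(x in X) xmap x]. *)
Definition brho (b : burnside k) : zgalg k := exist _ (brho_fun b) (brho_central b).
End Maps.

(** ** [B^c_k(G)] as endomorphisms of [Id_G] *)

(** The 2-cell span of a crossed set [X] has as apex the translation groupoid
    of [X], whose morphisms [x -> x'] are the [g] with [g x = x'].  For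
    [X = [H,a]_G] this groupoid is equivalent to [H], and the two natural
    isomorphisms become the one given by [a] and the identity. *)
Section Translation.
Variable X : crossed gT.

Definition tr_hom (x x' : xcar X) : finType := {g : gT | xact X x' g == x}.
Lemma tr_id_subproof x : xact X x 1%g == x.
Proof. by rewrite act1. Qed.
Lemma tr_comp_subproof x y z (h : tr_hom y z) (g : tr_hom x y) :
  xact X z (val h * val g)%g == x.
Proof. by case: h g => h /= /eqP e [g /= /eqP e']; rewrite actM e e'. Qed.
Lemma tr_inv_subproof x y (g : tr_hom x y) : xact X x (val g)^-1%g == y.
Proof. by case: g => g /= /eqP <-; rewrite actK. Qed.

Program Definition tr_gpd : gpd := @Gpd (xcar X) tr_hom
  (fun x => exist _ 1%g (tr_id_subproof x))
  (fun x y z h g => exist _ (val h * val g)%g (tr_comp_subproof h g))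
  (fun x y g => exist _ (val g)^-1%g (tr_inv_subproof g)) _ _ _ _ _.
Next Obligation. by move=> *; apply: val_inj; rewrite /= mulgA. Qed.
Next Obligation. by move=> *; apply: val_inj; rewrite /= mul1g. Qed.
Next Obligation. by move=> *; apply: val_inj; rewrite /= mulg1. Qed.
Next Obligation. by move=> *; apply: val_inj; rewrite /= mulVg. Qed.
Next Obligation. by move=> *; apply: val_inj; rewrite /= mulgV. Qed.

Definition tr_leg : gfun tr_gpd (grp gT) :=
  @GFun tr_gpd (grp gT) (fun _ => tt) (fun _ _ g => val g)
    (fun _ => erefl) (fun _ _ _ _ _ => erefl).

Lemma tr_leg_faithful : faithful tr_leg.
Proof. by move=> x y g h /val_inj. Qed.

Program Definition tr_nat :
    nat_iso (gfun_comp (gfun_id (grp gT)) tr_leg)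
            (gfun_comp (gfun_id (grp gT)) tr_leg) :=
  @NatIso tr_gpd (grp gT) _ _ (fun x => xmap x) _.
Next Obligation.
by move=> x y [g /= /eqP <-]; rewrite /= xmapJ -conjgC.
Qed.

Definition tr_span2 : span2 (span_id (grp gT)) (span_id (grp gT)) :=
  @Span2 _ _ (span_id (grp gT)) (span_id (grp gT)) tr_gpd tr_leg tr_leg
    tr_leg_faithful tr_leg_faithful tr_nat (nat_id _).
End Translation.

Definition burnside_cell (k : comNzRingType) (b : burnside k) :
  @cell2 k (span_bicat k) (grp gT) (grp gT) (id1 _) (id1 _) := lc_map tr_span2 b.

(** Multiplication by a central element, as an endomorphism of the
    [(kG,kG)]-bimodule [kG]. *)
Program Definition zcell (k : comNzRingType) (z : zgalg k) :
    @cell2 k (biperm_bicat k) (grp gT) (grp gT) (id1 _) (id1 _) :=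
  @Bihom k (grp gT) (grp gT) (biset_id (grp gT)) (biset_id (grp gT))
    (fun _ _ (g g' : gT) => val z (g' * g^-1)%g) _.
Next Obligation.
move=> k [z /= zC] _ _ _ _ h g s t /=.
rewrite -[RHS](eqP (forallP (forallP zC _) h^-1%g)); congr (z _).
by rewrite conjgE invgK !invMg !mulgA mulgK.
Qed.
End CrossedBurnside.

(** The basis element [[H,a]_G], for [a] in [C_G(H)]: the crossed set [G/H] with
    [gH |-> gag^-1].  Its 2-cell is isomorphic to the span [G <- H -> G] of
    inclusions, with natural isomorphisms [a] and the identity. *)
Section BasisElements.
Variables (gT : finGroupType) (H : {group gT}) (a : gT).
Hypothesis aC : a \in 'C(H)%g.
Local Open Scope group_scope.

Definition coset_sort : finType := {A : {set gT} | A \in lcosets H [set: gT]}.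
Implicit Types A : coset_sort.

Lemma coset_subproof A g : g^-1 *: val A \in lcosets H [set: gT].
Proof.
case: A => A /= /lcosetsP[x _ ->]; apply/lcosetsP; exists (g^-1 * x) => //.
by rewrite lcosetM.
Qed.
Definition coset_act A g : coset_sort :=
  exist (fun A : {set gT} => A \in lcosets H [set: gT]) _ (coset_subproof A g).
Lemma coset_act1 A : coset_act A 1 = A.
Proof. by apply: val_inj; rewrite /= invg1 lcoset1. Qed.
Lemma coset_actM A : act_morph coset_act A.
Proof. by move=> g h; apply: val_inj; rewrite /= invMg lcosetM. Qed.

Lemma mem_coset A : repr (val A) \in val A.
Proof. by case: A => A /= /lcosetsP[x _ ->]; apply: (mem_repr x); apply: lcoset_refl. Qed.
Lemma coset_mem A x : (x \in val A) = ((repr (val A))^-1 * x \in H).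
Proof.
move: (mem_coset A); case: A => A /= /lcosetsP[y _ ->] /lcoset_eqP e.
by rewrite -mem_lcoset e.
Qed.
Lemma conj_coset A x : x \in val A -> a ^ x^-1 = a ^ (repr (val A))^-1.
Proof.
rewrite coset_mem => xH; have := centP aC _ xH => /commgP/conjg_fixP e.
by rewrite -{1}e -conjgM mulgK.
Qed.

Program Definition coset_crossed : crossed gT :=
  @Crossed gT coset_sort (TotalAction coset_act1 coset_actM)
    (fun A => a ^ (repr (val A))^-1) _.
Next Obligation.
move=> A g; rewrite -conjgM -[in RHS](invgK g) -invMg; apply/esym/conj_coset.
by rewrite /= mem_lcoset mulKg mem_coset.
Qed.

Definition incl_leg : gfun (grp (subg_of H)) (grp gT) :=
  @GFun (grp (subg_of H)) (grp gT) (fun _ => tt) (fun _ _ g => sgval g)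
    (fun _ => erefl) (fun _ _ _ _ _ => erefl).
Lemma incl_leg_faithful : faithful incl_leg.
Proof. by move=> x y; apply: val_inj. Qed.
Program Definition incl_nat :
    nat_iso (gfun_comp (gfun_id (grp gT)) incl_leg)
            (gfun_comp (gfun_id (grp gT)) incl_leg) :=
  @NatIso (grp (subg_of H)) (grp gT) _ _ (fun _ => a) _.
Next Obligation. by move=> x y h; rewrite /= (centP aC) ?subgP. Qed.

Definition incl_span2 : span2 (span_id (grp gT)) (span_id (grp gT)) :=
  @Span2 _ _ (span_id (grp gT)) (span_id (grp gT)) (grp (subg_of H))
    incl_leg incl_leg incl_leg_faithful incl_leg_faithful incl_nat (nat_id _).

Lemma tr_coset_sub A A' (g : @hom (tr_gpd coset_crossed) A A') :
  (repr (val A'))^-1 * val g * repr (val A) \in H.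
Proof.
rewrite -mulgA -coset_mem; case: g => g /= /eqP/(congr1 val) /= e.
by rewrite -[g]invgK -mem_lcoset e; exact: mem_coset.
Qed.
Lemma tr_coset_hom A A' (h : subg_of H) :
  coset_act A' (repr (val A') * sgval h * (repr (val A))^-1) == A.
Proof.
apply/eqP/val_inj => /=; apply/setP => x.
rewrite mem_lcoset invgK coset_mem [in RHS]coset_mem -!mulgA mulKg.
by rewrite groupMl ?subgP.
Qed.
Definition coset_lift A A' (h : subg_of H) : @hom (tr_gpd coset_crossed) A A' :=
  exist (fun g => coset_act A' g == A) _ (tr_coset_hom A A' h).

Program Definition coset_fwd : gfun (tr_gpd coset_crossed) (grp (subg_of H)) :=
  @GFun (tr_gpd coset_crossed) (grp (subg_of H)) (fun _ => tt)
    (fun A A' g => subg H ((repr (val A'))^-1 * val g * repr (val A))) _ _.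
Next Obligation.
by move=> A; apply: val_inj; rewrite /= mulg1 mulVg subgK.
Qed.
Next Obligation.
move=> A A' A'' g f; apply: val_inj.
rewrite /= !subgK ?tr_coset_sub //.
  by rewrite !mulgA mulgK.
exact: (tr_coset_sub (gcomp g f)).
Qed.

Definition coset_base : coset_sort :=
  exist (fun A : {set gT} => A \in lcosets H [set: gT]) (1 *: H)
    (introT lcosetsP (ex_intro2 _ _ 1 (in_setT 1) erefl)).

Program Definition coset_bwd : gfun (grp (subg_of H)) (tr_gpd coset_crossed) :=
  @GFun (grp (subg_of H)) (tr_gpd coset_crossed) (fun _ => coset_base)
    (fun _ _ h => coset_lift coset_base coset_base h) _ _.
Next Obligation. by move=> ?; apply: val_inj; rewrite /= mulg1 mulgV. Qed.
Next Obligation.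
by move=> ? ? ? h g; apply: val_inj; rewrite /= !mulgA mulgKV.
Qed.

Lemma coset_equiv : is_equiv coset_fwd.
Proof.
exists coset_bwd; split; apply: inhabits.
  apply: (@NatIso _ _ (gfun_comp coset_bwd coset_fwd) (gfun_id _)
    (fun A => coset_lift coset_base A 1)).
  move=> A A' g; apply: val_inj => /=.
  by rewrite subgK ?tr_coset_sub // !mulg1 !mulgA mulgKV mulgV mul1g.
apply: (@NatIso _ _ (gfun_comp coset_fwd coset_bwd) (gfun_id _)
  (fun _ => 1)) => x y h; apply: val_inj => /=.
by rewrite mul1g mulg1 subgK !mulgA ?mulVg ?mul1g mulgKV ?subgP.
Qed.

Lemma coset_cell : iso2 (tr_span2 coset_crossed) incl_span2.
Proof.
have nat A A' (g : @hom (tr_gpd coset_crossed) A A') :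
    (repr (val A'))^-1 * val g
      = sgval (fmor coset_fwd g) * (repr (val A))^-1.
  by rewrite /= subgK ?tr_coset_sub // mulgK.
exists coset_fwd.
exists (@NatIso (tr_gpd coset_crossed) (grp gT) (tr_leg coset_crossed)
  (gfun_comp incl_leg coset_fwd) (fun A => (repr (val A))^-1) nat).
exists (@NatIso (tr_gpd coset_crossed) (grp gT) (tr_leg coset_crossed)
  (gfun_comp incl_leg coset_fwd) (fun A => (repr (val A))^-1) nat).
split; first exact: coset_equiv.
  by move=> A /=; rewrite conjgE invgK !mulgA mulVg mul1g.
by move=> A /=; rewrite mulg1 mul1g.
Qed.
End BasisElements.

(** * Irreducible characters and the idempotents [e_(H,theta)] *)

Section Idempotents.
Variables (K : fieldType) (gT : finGroupType).
Implicit Types (L H : {group gT}) (t : {ffun gT -> K}).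

(** Characters of [L] are extended by zero outside [L]. *)
Definition is_irr_char L t : Prop :=
  exists (n : nat) (rL : mx_representation K L n),
    mx_irreducible rL /\ forall x, t x = if x \in L then \tr (rL x) else 0.

Definition irr_chars L : seq {ffun gT -> K} :=
  epsilon (inhabits [::])
    (fun s => uniq s /\ forall t, t \in s <-> is_irr_char L t).

(** [e_theta = theta(1)/|L| \sum_x theta(x^-1) x]. *)
Definition e_char L t : {ffun gT -> K} :=
  [ffun x => t 1%g / #|L|%:R * t x^-1%g].

Program Definition zgalg0 : zgalg gT K := exist _ [ffun=> 0] _.
Next Obligation. by apply/forallP => x; apply/forallP => g; rewrite !ffunE. Qed.

(** [e_theta] in [Z(KG)]; the default value of [insubd] is never used when
    [t] is a character of [G]. *)
Definition e_char_center t : zgalg gT K :=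
  insubd zgalg0 (e_char [set: gT]%G t).

Definition pair_conj (p q : {group gT} * {ffun gT -> K}) : bool :=
  [exists g : gT, (gval q.1 == p.1 :^ g)%g && [forall x : gT, q.2 (x ^ g)%g == p.2 x]].

Definition eps_tilde (p : {group gT} * {ffun gT -> K}) (L : {group gT}) :
  {ffun gT -> K} :=
  \sum_(t <- irr_chars 'C(L)%G | pair_conj p (L, t)) e_char 'C(L)%G t.

(** [e_(H,theta)], the preimage of [eps_tilde] under [(bphi H)_H]. *)
Definition e_burnside (p : {group gT} * {ffun gT -> K}) : burnside gT K :=
  epsilon (inhabits [::]) (fun b => forall L : {group gT}, bphi L b = eps_tilde p L).

Definition conj_class_reps (S : {set {group gT}}) : Prop :=
  (forall H, exists2 H', H' \in S & gval H' \in (H :^: [set: gT])%g) /\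
  {in S &, forall H H', gval H' \in (H :^: [set: gT])%g -> H = H'}.

(** Representatives of [Irr(K C_G(H))] modulo the action of [N_G(H)]. *)
Definition irr_reps H (s : seq {ffun gT -> K}) : Prop :=
  [/\ uniq s, {subset s <= irr_chars 'C(H)%G},
      forall t, t \in irr_chars 'C(H)%G -> exists2 t', t' \in s & pair_conj (H, t) (H, t')
    & {in s &, forall t t', pair_conj (H, t) (H, t') -> t = t'}].
End Idempotents.

(** [(G, 1)], and the formal direct sum of the [(G, e i)] for [i] in a
    duplicate-free sequence. *)
Definition bone (k : comNzRingType) (B : lbicat k) (G : cell0 B) : bobj B :=
  bsingle (id2 (id1 G)).
Definition bsum (k : comNzRingType) (B : lbicat k) (G : cell0 B) (T : choiceType)
    (s : seq T) (e : T -> cell2 (id1 G) (id1 G)) : bobj B :=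
  @BObj k B (seq_sub s) (fun _ => G) (fun i => e (ssval i)).
Arguments bps0 {k B C} F X.
Arguments bps1 {k B C} F {X Y} f.
Arguments bone {k} B G.
Arguments bsum {k} B G {T} s e.

(* Main.v *)
(* Two finite complete families of orthogonal idempotents e_i and d_j of a commutative ring
   End(Id_G) define equivalent objects of the block completion, the equivalence being the matrix
   of 1-cells (Id_G, e_i d_j). It therefore suffices to show that the families of the
   statement are complete and orthogonal.
   In characteristic 0 the ghost map phi of the crossed Burnside ring is injective, and it is onto
   the G-fixed families of class functions, both by triangularity of the table of marks. Hence the
   e_{H,theta} inherit completeness and orthogonality from the central idempotents e_theta of the
   K C_G(H), which are the Wedderburn idempotents of the group algebra. Finally rho_G is the
   component of phi at the trivial subgroup, so rho_G(e_{H,theta}) is e_theta if H = 1 and 0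
   otherwise. *)

Require Import Defs.
From mathcomp Require Import all_boot all_order all_algebra all_fingroup.
From mathcomp Require Import pgroup mxrepresentation.
From Stdlib Require Import Setoid Morphisms Classical ClassicalEpsilon.
From Stdlib Require Import FunctionalExtensionality ProofIrrelevance.

Set Implicit Arguments.
Unset Strict Implicit.
Unset Printing Implicit Defensive.

Import Defs GRing.Theory.

Local Open Scope ring_scope.
Local Open Scope gpd_scope.
Local Obligation Tactic := idtac.

(** * Orthogonal idempotents in a linear bicategory *)

(** The records [lbicat] and [psfun] carry data without axioms, so whatever coherence the matrix
    argument consumes has to be established for both bicategories. It amounts to two packages: each
    Hom category is enriched in commutative monoids up to [≈] ([is_lcat]), and a horizontal
    composite of an endomorphism of [id1] with an endomorphism of a 1-cell isomorphic to [id1] is a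
    vertical composite conjugated by unitors ([unit_like]). The bulk of the work with groupoids and
    bisets serves these two. The image of the first equivalence under P is handled by applying the
    same lemma in the target. There the matrix sits on [span_biset (span_id G)], i.e. on kG ⊗ kG
    over kG, which is isomorphic but not equal to the identity bimodule; the lemma is therefore
    stated for such a 1-cell. The entries e_i d_j treat zero and nonzero idempotents alike, so the
    sums indexed by pairs (H, theta) and by Irr(KG) are compared without matching summands. Equality
    in B^c(G) is tested by all additive invariants of crossed sets ([lc_eq]), so injectivity of the
    ghost map takes the form: every additive invariant is a linear function of marks. *)

Section SetoidBig.
Variables (T : Type) (R : T -> T -> Prop) (add : T -> T -> T) (zero : T).
Hypothesis R_equiv : Equivalence R.
Hypothesis add_proper : Proper (R ==> R ==> R) add.
Hypothesis addA : forall x y z, R (add x (add y z)) (add (add x y) z).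
Hypothesis addC : forall x y, R (add x y) (add y x).
Hypothesis add0 : forall x, R (add zero x) x.

(** Sums of 2-cells iterate [add2], whose monoid laws hold only up to [≈]; these are the laws of big
    sums relative to such a relation. *)
Lemma sbig_eq (I : Type) (r : seq I) (F F' : I -> T) :
  (forall i, R (F i) (F' i)) ->
  R (\big[add/zero]_(i <- r) F i) (\big[add/zero]_(i <- r) F' i).
Proof.
move=> FF'; elim: r => [|i r IHr]; first by rewrite !big_nil; reflexivity.
by rewrite !big_cons; apply: add_proper.
Qed.

Lemma sbig_cat (I : Type) (r s : seq I) (F : I -> T) :
  R (\big[add/zero]_(i <- r ++ s) F i)
    (add (\big[add/zero]_(i <- r) F i) (\big[add/zero]_(i <- s) F i)).
Proof.
elim: r => [|i r IHr] /=; first by rewrite big_nil add0; reflexivity.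
by rewrite !big_cons IHr addA; reflexivity.
Qed.

Lemma sbig_perm (I : eqType) (r s : seq I) (F : I -> T) :
  perm_eq r s -> R (\big[add/zero]_(i <- r) F i) (\big[add/zero]_(i <- s) F i).
Proof.
elim: r s => [|i r IHr] s prs.
  by move: prs; rewrite perm_sym => /perm_nilP->; reflexivity.
have /splitPr si: i \in s by rewrite -(perm_mem prs) mem_head.
case: si prs => s1 s2; rewrite perm_sym perm_catC /= perm_cons perm_sym => prs.
rewrite (sbig_cat s1) !big_cons (IHr _ prs) (sbig_cat s2).
by rewrite addA [X in R X _]addC; reflexivity.
Qed.

Lemma sbig_unit (F : unit -> T) : R (\big[add/zero]_(i : unit) F i) (F tt).
Proof.
have -> : index_enum unit = [:: tt].
  by apply/perm_small_eq => //; apply: uniq_perm (index_enum_uniq _) _ _ => // -[];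
     rewrite mem_index_enum.
by rewrite big_cons big_nil addC; apply: add0.
Qed.
End SetoidBig.

Section LinearBicategory.
Variables (k : comNzRingType) (B : lbicat k).

(** What matrix computations inside a Hom category use: a category whose composition is biadditive
    over commutative monoids, everything up to [≈]. *)
Record is_lcat : Prop := {
  eq2_equiv : forall (G H : cell0 B) (u v : cell1 B G H), Equivalence (@eq2 k B G H u v);
  vcomp_eq2 : forall (G H : cell0 B) (u v w : cell1 B G H) (y y' : cell2 v w)
    (x x' : cell2 u v), y ≈ y' -> x ≈ x' -> y ⊙ x ≈ y' ⊙ x';
  vcompA : forall (G H : cell0 B) (u v w t : cell1 B G H) (z : cell2 w t) (y : cell2 v w)
    (x : cell2 u v), z ⊙ (y ⊙ x) ≈ z ⊙ y ⊙ x;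
  vcomp1l : forall (G H : cell0 B) (u v : cell1 B G H) (x : cell2 u v), id2 v ⊙ x ≈ x;
  vcomp1r : forall (G H : cell0 B) (u v : cell1 B G H) (x : cell2 u v), x ⊙ id2 u ≈ x;
  add2_eq2 : forall (G H : cell0 B) (u v : cell1 B G H) (x x' y y' : cell2 u v),
    x ≈ x' -> y ≈ y' -> add2 x y ≈ add2 x' y';
  add2A : forall (G H : cell0 B) (u v : cell1 B G H) (x y z : cell2 u v),
    add2 x (add2 y z) ≈ add2 (add2 x y) z;
  add2C : forall (G H : cell0 B) (u v : cell1 B G H) (x y : cell2 u v),
    add2 x y ≈ add2 y x;
  add20 : forall (G H : cell0 B) (u v : cell1 B G H) (x : cell2 u v),
    add2 (zero2 u v) x ≈ x;
  vcompDl : forall (G H : cell0 B) (u v w : cell1 B G H) (y y' : cell2 v w)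
    (x : cell2 u v), add2 y y' ⊙ x ≈ add2 (y ⊙ x) (y' ⊙ x);
  vcompDr : forall (G H : cell0 B) (u v w : cell1 B G H) (y : cell2 v w)
    (x x' : cell2 u v), y ⊙ add2 x x' ≈ add2 (y ⊙ x) (y ⊙ x');
  vcomp0l : forall (G H : cell0 B) (u v w : cell1 B G H) (x : cell2 u v),
    zero2 v w ⊙ x ≈ zero2 u w;
  vcomp0r : forall (G H : cell0 B) (u v w : cell1 B G H) (y : cell2 v w),
    y ⊙ zero2 u v ≈ zero2 u w }.

(* The pseudo-functor sends [id1] only to a 1-cell isomorphic to [id1], so the whiskering
   formulas are required for an arbitrary 1-cell [u] with an isomorphism [al] to [id1]. *)
Record unit_like (G : cell0 B) (u : cell1 B G G) (al : cell2 u (id1 G))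
    (be : cell2 (id1 G) u) : Prop := {
  unit_albe : al ⊙ be ≈ id2 (id1 G);
  unit_beal : be ⊙ al ≈ id2 u;
  lunitK : lunit u ⊙ lunitV u ≈ id2 u;
  runitK : runit u ⊙ runitV u ≈ id2 u;
  hcomp_endl : forall (x : cell2 (id1 G) (id1 G)) (m : cell2 u u),
    hcomp x m ≈ lunitV u ⊙ (be ⊙ x ⊙ al ⊙ m) ⊙ lunit u;
  hcomp_endr : forall (m : cell2 u u) (x : cell2 (id1 G) (id1 G)),
    hcomp m x ≈ runitV u ⊙ (m ⊙ (be ⊙ x ⊙ al)) ⊙ runit u }.

Hypothesis BP : is_lcat.

#[local] Instance eq2_Equivalence G H u v : Equivalence (@eq2 k B G H u v).
Proof. exact: eq2_equiv. Qed.
#[local] Instance vcomp_Proper G H u v w :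
  Proper (@eq2 k B G H v w ==> @eq2 k B G H u v ==> @eq2 k B G H u w) (@vcomp k B G H u v w).
Proof. by move=> y y' yy' x x' xx'; apply: vcomp_eq2. Qed.
#[local] Instance add2_Proper G H u v :
  Proper (@eq2 k B G H u v ==> @eq2 k B G H u v ==> @eq2 k B G H u v) (@add2 k B G H u v).
Proof. by move=> y y' yy' x x' xx'; apply: add2_eq2. Qed.

Lemma vcomp_suml G H (u v w : cell1 B G H) (I : Type) (r : seq I) (y : I -> cell2 v w)
    (x : cell2 u v) :
  \big[add2/zero2 v w]_(i <- r) y i ⊙ x ≈ \big[add2/zero2 u w]_(i <- r) (y i ⊙ x).
Proof.
elim: r => [|i r IHr]; first by rewrite !big_nil; exact: vcomp0l.
by rewrite !big_cons vcompDl // IHr; reflexivity.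
Qed.

Lemma vcomp_sumr G H (u v w : cell1 B G H) (I : Type) (r : seq I) (y : cell2 v w)
    (x : I -> cell2 u v) :
  y ⊙ \big[add2/zero2 u v]_(i <- r) x i ≈ \big[add2/zero2 u w]_(i <- r) (y ⊙ x i).
Proof.
elim: r => [|i r IHr]; first by rewrite !big_nil; exact: vcomp0r.
by rewrite !big_cons vcompDr // IHr; reflexivity.
Qed.

Lemma sum2_eq G H (u v : cell1 B G H) (I : Type) (r : seq I) (x x' : I -> cell2 u v) :
  (forall i, x i ≈ x' i) ->
  \big[add2/zero2 u v]_(i <- r) x i ≈ \big[add2/zero2 u v]_(i <- r) x' i.
Proof. by move=> xx'; apply: sbig_eq. Qed.

Lemma sum2_unit G H (u v : cell1 B G H) (x : unit -> cell2 u v) :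
  \big[add2/zero2 u v]_(i : unit) x i ≈ x tt.
Proof. by apply: sbig_unit; [exact: add2C | exact: add20]. Qed.

Lemma sum2_perm G H (u v : cell1 B G H) (I : eqType) (r s : seq I) (x : I -> cell2 u v) :
  perm_eq r s ->
  \big[add2/zero2 u v]_(i <- r) x i ≈ \big[add2/zero2 u v]_(i <- s) x i.
Proof. by apply: sbig_perm; [exact: add2A | exact: add2C | exact: add20]. Qed.

Lemma sum2_void G H (u v : cell1 B G H) (x : void -> cell2 u v) :
  \big[add2/zero2 u v]_(i : void) x i = zero2 u v.
Proof. by rewrite (_ : index_enum void = [::]) ?big_nil //; case: index_enum => // -[]. Qed.

Section Orthogonal.
Variable G : cell0 B.
Let E := cell2 (id1 G) (id1 G).

Definition complete_orth (I : finType) (e : I -> E) : Prop :=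
  [/\ forall i, e i ⊙ e i ≈ e i, forall i j, i != j -> e i ⊙ e j ≈ zero2 _ _
    & \big[add2/zero2 _ _]_(i : I) e i ≈ id2 (id1 G)].

(** An idempotent matrix that factors as q p with p q = [ep] is split by [ep]: the column p and the
    row q are the mutually inverse maps. *)
Lemma kiso_single (H : cell0 B) (U : kobj G H) (v : cell1 B G H) (ep : cell2 v v)
    (p : forall a : kix U, cell2 (kfam a) v) (q : forall a : kix U, cell2 v (kfam a)) :
  (forall a b, kidem a b ≈ q b ⊙ p a) ->
  \big[add2/zero2 v v]_(a : kix U) (p a ⊙ q a) ≈ ep ->
  (forall a, ep ⊙ p a ≈ p a) -> (forall a, q a ⊙ ep ≈ q a) ->
  kiso U (@KObj k B G H unit (fun _ => v) (fun _ _ => ep)).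
Proof.
move=> Uqp sumpq epp qep.
exists (fun a _ => p a), (fun _ a => q a); split.
- split=> [a [] | a []] /=; first by rewrite /kcomp sum2_unit; exact: epp.
  transitivity (ep ⊙ p a); last exact: epp.
  rewrite /kcomp /= -sumpq vcomp_suml.
  by apply: sum2_eq => b; rewrite Uqp vcompA //; reflexivity.
- split=> [[] a | [] a] /=; last by rewrite /kcomp sum2_unit; exact: qep.
  transitivity (q a ⊙ ep); last exact: qep.
  rewrite /kcomp /= -sumpq vcomp_sumr.
  by apply: sum2_eq => b; rewrite Uqp vcompA //; reflexivity.
- by move=> a b; rewrite /kcomp sum2_unit Uqp; reflexivity.
- by move=> [] []; exact: sumpq.
Qed.

Lemma kiso_kzero (H : cell0 B) (U : kobj G H) :
  (forall a b : kix U, kidem a b ≈ zero2 _ _) -> kiso U (kzero G H).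
Proof.
move=> U0; exists (fun _ b => of_void _ b), (fun b _ => of_void _ b).
split; try by case.
- by split=> a [].
- by split=> [] [].
- by move=> a b; rewrite /kcomp sum2_void U0; reflexivity.
Qed.

Section Pair.
Variables (I J : finType) (e : I -> E) (d : J -> E).
Hypothesis eP : complete_orth e.
Hypothesis dP : complete_orth d.
Hypothesis edC : forall i j, e i ⊙ d j ≈ d j ⊙ e i.

Lemma orth_mul i j i' j' :
  e i ⊙ d j ⊙ (e i' ⊙ d j') ≈ e i ⊙ e i' ⊙ (d j ⊙ d j').
Proof.
rewrite vcompA // -(vcompA BP (e i)) -edC !vcompA //; reflexivity.
Qed.

Lemma orth_idem i j : e i ⊙ d j ⊙ (e i ⊙ d j) ≈ e i ⊙ d j.
Proof.
by rewrite orth_mul (let: And3 h _ _ := eP in h i) (let: And3 h _ _ := dP in h j); reflexivity.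
Qed.

Lemma orth_absl i j : e i ⊙ (e i ⊙ d j) ≈ e i ⊙ d j.
Proof. by rewrite vcompA // (let: And3 h _ _ := eP in h i); reflexivity. Qed.

Lemma orth_absr i j : (e i ⊙ d j) ⊙ e i ≈ e i ⊙ d j.
Proof. by rewrite -vcompA // -edC orth_absl; reflexivity. Qed.

Lemma orth_sum i : \big[add2/zero2 _ _]_(j : J) (e i ⊙ d j) ≈ e i.
Proof.
by rewrite -vcomp_sumr (let: And3 _ _ h := dP in h) vcomp1r //; reflexivity.
Qed.

Variables (w : cell1 B G G) (La : cell2 w (id1 G)) (La' : cell2 (id1 G) w).
Hypothesis LaK : La ⊙ La' ≈ id2 (id1 G).

(** A product of two matrices of single 1-cells is indexed by an intermediate index together with
    two points of [unit]; this discards the points. *)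
Let index_tag (F : {j : J & (unit * unit)%type} -> E) (F' : J -> E) :
  (forall j, F (existT _ j (tt, tt)) ≈ F' j) ->
  \big[add2/zero2 _ _]_(z : {j : J & (unit * unit)%type}) F z
    ≈ \big[add2/zero2 _ _]_(j : J) F' j.
Proof.
move=> FF'; transitivity (\big[add2/zero2 _ _]_(z <- [seq existT
    (fun _ : J => (unit * unit)%type) j (tt, tt) | j <- index_enum J]) F z).
  apply: sum2_perm; apply: uniq_perm; first exact: index_enum_uniq.
    by rewrite map_inj_uniq ?index_enum_uniq // => j j' [].
  case=> j [[] []]; rewrite mem_index_enum; apply/esym/mapP.
  by exists j; rewrite // mem_index_enum.
by rewrite big_map; apply: sum2_eq.
Qed.

(** The (i, i') entry of the product of the two matrices. On the diagonal the summands e_i d_j add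
    up to e_i by completeness of d, and the maps e_i d_j [La] and [La'] e_i d_j split the
    idempotent. Off the diagonal e_i' e_i = 0 makes the idempotent zero. The isomorphism [La] brings
    the composite 1-cell [w] back to [id1]. *)
Lemma kiso_bcell_id (i i' : I)
    (idem : forall z z' : {j : J & (unit * unit)%type}, cell2 w w) :
  (forall z z', tag z = tag z' ->
     idem z z' ≈ La' ⊙ (e i' ⊙ d (tag z) ⊙ (e i ⊙ d (tag z))) ⊙ La) ->
  (forall z z', tag z != tag z' -> idem z z' ≈ zero2 _ _) ->
  kiso (@KObj k B G G {j : J & (unit * unit)%type} (fun _ => w) idem)
       (@bcell_id k B (@BObj k B I (fun _ => G) e) i i').
Proof.
move=> idemE idem0; have [e2 e0 e1] := eP; have [d2 d0 d1] := dP.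
rewrite /bcell_id /=; case: (i =P i') => [ii'|/eqP ni].
  case: _ / ii' idemE => idemE.
  apply: (@kiso_single G (@KObj k B G G _ (fun _ => w) idem) (id1 G) (e i)
    (fun z => e i ⊙ d (tag z) ⊙ La) (fun z => La' ⊙ (e i ⊙ d (tag z)))).
  - move=> z z' /=; have [zz'|nz] := eqVneq (tag z) (tag z').
      by rewrite idemE // -zz' !vcompA //; reflexivity.
    rewrite idem0 // -(vcompA BP La') (vcompA BP _ _ La) orth_mul e2 d0 1?eq_sym //.
    by rewrite !(vcomp0r BP, vcomp0l BP); reflexivity.
  - rewrite -[X in _ ≈ X]orth_sum /=; apply: index_tag => j /=.
    rewrite -(vcompA BP _ La) (vcompA BP La) LaK vcomp1l // orth_idem.
    reflexivity.
  - by move=> z; rewrite vcompA // orth_absl; reflexivity.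
  - by move=> z; rewrite -vcompA // orth_absr; reflexivity.
apply: kiso_kzero => z z' /=; have [zz'|nz] := eqVneq (tag z) (tag z').
  rewrite idemE // orth_mul e0 1?eq_sym //.
  by rewrite !(vcomp0r BP, vcomp0l BP); reflexivity.
by rewrite idem0 //; reflexivity.
Qed.
End Pair.

(** Since [al ⊙ be] is the identity, transporting [m] to an endomorphism y of [id1] turns the
    horizontal composite into a product in End([id1]), conjugated by [al ⊙ lunit u]. *)
Lemma hcomp_unitl (u : cell1 B G G) al be (uP : @unit_like G u al be)
    (x y : E) (m : cell2 u u) :
  m ≈ be ⊙ y ⊙ al -> 
  hcomp x m ≈ lunitV u ⊙ be ⊙ (x ⊙ y) ⊙ (al ⊙ lunit u).
Proof.
move=> mE; rewrite (hcomp_endl uP) mE !vcompA // -(vcompA BP _ al be) (unit_albe uP).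
by rewrite vcomp1r //; reflexivity.
Qed.

Lemma hcomp_unitr (u : cell1 B G G) al be (uP : @unit_like G u al be)
    (x y : E) (m : cell2 u u) :
  m ≈ be ⊙ y ⊙ al -> 
  hcomp m x ≈ runitV u ⊙ be ⊙ (y ⊙ x) ⊙ (al ⊙ runit u).
Proof.
move=> mE; rewrite (hcomp_endr uP) mE !vcompA // -(vcompA BP _ al be) (unit_albe uP).
by rewrite vcomp1r //; reflexivity.
Qed.

(** The unitors cancel, so whiskering only transports x along the isomorphism of [u] with [id1]. *)
Lemma act_tgt_unit (u : cell1 B G G) al be (uP : @unit_like G u al be) (x : E) :
  act_tgt x u ≈ be ⊙ x ⊙ al.
Proof.
rewrite /act_tgt (hcomp_endl uP) vcomp1r // -(vcompA BP) -(vcompA BP _ (lunit u)).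
by rewrite (lunitK uP) vcomp1r // vcompA // (lunitK uP) vcomp1l //; reflexivity.
Qed.

Lemma act_src_unit (u : cell1 B G G) al be (uP : @unit_like G u al be) (x : E) :
  act_src x u ≈ be ⊙ x ⊙ al.
Proof.
rewrite /act_src (hcomp_endr uP) vcomp1l // -(vcompA BP) -(vcompA BP _ (runit u)).
by rewrite (runitK uP) vcomp1r // vcompA // (runitK uP) vcomp1l //; reflexivity.
Qed.

Lemma beyal_comp (u : cell1 B G G) al be (uP : @unit_like G u al be) (x y : E) :
  be ⊙ x ⊙ al ⊙ (be ⊙ y ⊙ al) ≈ be ⊙ (x ⊙ y) ⊙ al.
Proof.
rewrite !vcompA // -(vcompA BP _ al be) (unit_albe uP) vcomp1r //; reflexivity.
Qed.
End Orthogonal.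

(* Both families refine to the products [e i ⊙ d j], so the matrix with entries
   [(u, e i ⊙ d j)] and its transpose are mutually inverse. *)
Lemma bis_equiv_orth (G : cell0 B) (u : cell1 B G G) al be
    (idP : unit_like (id2 (id1 G)) (id2 (id1 G))) (uP : @unit_like G u al be)
    (I J : finType) (e : I -> cell2 (id1 G) (id1 G)) (d : J -> cell2 (id1 G) (id1 G))
    (phi : I -> J -> cell2 u u) :
  complete_orth e -> complete_orth d -> (forall i j, e i ⊙ d j ≈ d j ⊙ e i) ->
  (forall i j, phi i j ≈ be ⊙ (e i ⊙ d j) ⊙ al) ->
  @bis_equiv k B (@BObj k B I (fun _ => G) e) (@BObj k B J (fun _ => G) d)
    (fun i j => @KObj k B G G unit (fun _ => u) (fun _ _ => phi i j)).
Proof.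
move=> eP dP edC phiE.
have deC j i : d j ⊙ e i ≈ e i ⊙ d j by symmetry; apply: edC.
have idE (x : cell2 (id1 G) (id1 G)) : x ≈ id2 (id1 G) ⊙ x ⊙ id2 (id1 G).
  by rewrite vcomp1l // vcomp1r //; reflexivity.
split; [by case: eP | by case: dP | | ].
  move=> i j; split=> /= [[] []|[] []].
    rewrite /kcomp sum2_unit /= phiE (beyal_comp uP) orth_idem //; reflexivity.
  rewrite /= (act_src_unit uP) (act_tgt_unit uP) phiE !(beyal_comp uP); split.
    by rewrite orth_absl //; reflexivity.
  by rewrite edC orth_absl //; reflexivity.
(* The inverse can be chosen on [id1] itself; only the given matrix is tied to [u]. The composites
   then live on [comp1 (id1 G) u] and [comp1 u (id1 G)], identified with [id1] through a unitor
   followed by [al]. *)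
exists (fun j i => @KObj k B G G unit (fun _ => id1 G) (fun _ _ => e i ⊙ d j)).
split.
- move=> j i; split=> /= [[] []|[] []].
    by rewrite /kcomp sum2_unit /= orth_idem //; reflexivity.
  rewrite /= (act_src_unit idP) (act_tgt_unit idP) -!idE; split.
    by rewrite edC orth_absl //; reflexivity.
  by rewrite orth_absl //; reflexivity.
- move=> i i'.
  apply: (kiso_bcell_id eP dP edC (w := comp1 (id1 G) u) (La := al ⊙ lunit u)
            (La' := lunitV u ⊙ be)).
  + rewrite -vcompA // (vcompA BP _ _ be) (lunitK uP) vcomp1l //.
    exact: unit_albe uP.
  + move=> [j [[] []]] [j' [[] []]] /= ejj'; rewrite /bc_idem /=.
    case: (j =P j') => [e'|] //; case: _ / e'.
    by rewrite (hcomp_unitl uP _ (phiE i j)); reflexivity.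
  + move=> [j [[] []]] [j' [[] []]] /= njj'; rewrite /bc_idem /=.
    case: (j =P j') => [e'|_]; last by reflexivity.
    by case/eqP: njj'.
- move=> j j'.
  apply: (kiso_bcell_id dP eP deC (w := comp1 u (id1 G)) (La := al ⊙ runit u)
            (La' := runitV u ⊙ be)).
  + rewrite -vcompA // (vcompA BP _ _ be) (runitK uP) vcomp1l //.
    exact: unit_albe uP.
  + move=> [i [[] []]] [i' [[] []]] /= eii'; rewrite /bc_idem /=.
    case: (i =P i') => [e'|] //; case: _ / e'.
    by rewrite (hcomp_unitr uP _ (phiE i j')) !edC; reflexivity.
  + move=> [i [[] []]] [i' [[] []]] /= nii'; rewrite /bc_idem /=.
    case: (i =P i') => [e'|_]; last by reflexivity.
    by case/eqP: nii'.
Qed.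
End LinearBicategory.

(** * Vertical composition of 2-cells of spans *)

Definition full (G H : gpd) (F : gfun G H) :=
  forall (x y : G) (h : hom (F x) (F y)), exists f : hom x y, fmor F f = h.

Definition ess_surj (G H : gpd) (F : gfun G H) :=
  forall y : H, exists x : G, inhabited (hom (F x) y).

Section Equivalences.
Variables (G H : gpd) (F : gfun G H).

Section Inverse.
Hypotheses (fF : faithful F) (uF : full F) (sF : ess_surj F).

(** A quasi-inverse is an actual functor, so preimages of objects and of morphisms are chosen
    classically. *)
Lemma ess_surj_sig (y : H) : {x : G & hom (F x) y}.
Proof.
have [x hx] := constructive_indefinite_description _ (sF y); exists x.
by apply: (epsilon hx (fun _ => True)).
Qed.

Lemma full_sig (x y : G) (h : hom (F x) (F y)) : {f : hom x y | fmor F f = h}.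
Proof. exact: constructive_indefinite_description (uF h). Qed.

Let pre y := tag (ess_surj_sig y).
Let cnt y : hom (F (pre y)) y := tagged (ess_surj_sig y).

Definition einv_mor (y y' : H) (h : hom y y') : hom (pre y) (pre y') :=
  sval (full_sig (ginv (cnt y') ∘ h ∘ cnt y)).

Lemma einv_morE (y y' : H) (h : hom y y') :
  fmor F (einv_mor h) = ginv (cnt y') ∘ h ∘ cnt y.
Proof. exact: (svalP (full_sig _)). Qed.

Program Definition einv : gfun H G := @GFun H G pre einv_mor _ _.
Next Obligation. by move=> y; apply: fF; rewrite einv_morE fmor1 gid_r ginv_l. Qed.
Next Obligation.
by move=> x y z g f; apply: fF; rewrite fmorM !einv_morE !gcompA gcompKr.
Qed.

Lemma is_equivI : is_equiv F.
Proof.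
exists einv; split; apply: inhabits.
  apply: (@NatIso _ _ (gfun_comp einv F) (gfun_id _) (fun x => sval (full_sig (cnt (F x))))).
  move=> x y f /=; apply: fF; rewrite !fmorM einv_morE !(svalP (full_sig _)).
  by rewrite !gcompA ginv_r gid_l.
apply: (@NatIso _ _ (gfun_comp F einv) (gfun_id _) (fun y => cnt y)).
by move=> x y f /=; rewrite einv_morE !gcompA ginv_r gid_l.
Qed.
End Inverse.

(** Conjugating F' h by the isomorphism from F' F to the identity gives a candidate preimage of h.
    It is compared with h after applying F', which is faithful because F F' is isomorphic to the
    identity. *)
Lemma is_equiv_full : is_equiv F -> full F.
Proof.
case=> F' [[a] [b]].
have fF (G1 G2 G3 : gpd) (A : gfun G1 G2) (A' : gfun G2 G3) (A'' : gfun G1 G3)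
    (n : nat_iso (gfun_comp A' A) A'') : faithful A'' -> faithful A.
  move=> fA x y f g /(congr1 (fmor A')) fg; apply: fA.
  apply: (gcompIr (f := n x)); rewrite /= -!(natural n) /=.
  by rewrite fg.
have fF' : faithful F' by apply: (fF _ _ _ _ _ _ b); exact: id_faithful.
move=> x y h; exists (a y ∘ fmor F' h ∘ ginv (a x)); apply: fF'.
apply: (gcompIl (g := a y)); rewrite /= (natural a) /=.
by rewrite gcompVKr.
Qed.

Lemma is_equiv_ess_surj : is_equiv F -> ess_surj F.
Proof. by case=> F' [_ [b]] y; exists (F' y); apply: inhabits; exact: (b y). Qed.
End Equivalences.

(** Faithfulness of F comes from the legs: [bleg x] is faithful and isomorphic to [bleg y] after
    F. *)
Lemma iso2I (G H : gpd) (s t : span G H) (x y : span2 s t)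
    (F : gfun (apx x) (apx y)) (p : nat_iso (bleg x) (gfun_comp (bleg y) F))
    (q : nat_iso (cleg x) (gfun_comp (cleg y) F)) :
  full F -> ess_surj F ->
  (forall a, fmor (legl t) (q a) ∘ lnat x a = lnat y (F a) ∘ fmor (legl s) (p a)) ->
  (forall a, fmor (legr t) (q a) ∘ rnat x a = rnat y (F a) ∘ fmor (legr s) (p a)) ->
  iso2 x y.
Proof.
move=> uF sF el er; exists F, p, q; split=> //; apply: is_equivI => // a b f g fg.
apply: (@bleg_faithful _ _ _ _ x); apply: (gcompIl (g := p b)); rewrite /=.
by rewrite (natural p f) (natural p g) /= fg.
Qed.

Section IcMk.
Variables (A B C : gpd) (F : gfun A C) (F' : gfun B C).

Definition icMk (a : A) (b : B) (g : hom (F a) (F' b)) : isocomma F F' :=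
  existT (fun ab : A * B => hom (F ab.1) (F' ab.2) : Type) (a, b) g.

Lemma icHom_subproof (z z' : isocomma F F') (a : hom (tag z).1 (tag z').1)
    (b : hom (tag z).2 (tag z').2) :
  fmor F' b ∘ tagged z = tagged z' ∘ fmor F a -> fmor F' b ∘ tagged z == tagged z' ∘ fmor F a.
Proof. by move=> e; apply/eqP. Qed.

Definition icHom (z z' : isocomma F F') (a : hom (tag z).1 (tag z').1)
    (b : hom (tag z).2 (tag z').2) (e : fmor F' b ∘ tagged z = tagged z' ∘ fmor F a) :
  hom z z' := exist _ (a, b) (icHom_subproof e).

Lemma icHomE (z z' : isocomma F F') (m : hom z z') :
  fmor F' (val m).2 ∘ tagged z = tagged z' ∘ fmor F (val m).1.
Proof. exact: (eqP (valP m)). Qed.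

Lemma icHom_inj (z z' : isocomma F F') (m m' : hom z z') :
  (val m).1 = (val m').1 -> (val m).2 = (val m').2 -> m = m'.
Proof. by case: m m' => [[a b] e] [[a' b'] e'] /= aa' bb'; apply: val_inj; rewrite /= aa' bb'. Qed.
End IcMk.

Section Inl.
Variables A B : gpd.
Definition ginl : gfun A (gsum A B) := @GFun A (gsum A B) inl (fun _ _ f => f)
  (fun _ => erefl) (fun _ _ _ _ _ => erefl).
Definition ginr : gfun B (gsum A B) := @GFun B (gsum A B) inr (fun _ _ f => f)
  (fun _ => erefl) (fun _ _ _ _ _ => erefl).
End Inl.

Lemma gid_natural (A : gpd) (a b : A) (f : hom a b) : gid b ∘ f = f ∘ gid a.
Proof. by rewrite gid_l gid_r. Qed.

Section IcPairEquiv.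
Variables (A B C W : gpd) (F : gfun A C) (F' : gfun B C).

Definition ic_nat : nat_iso (gfun_comp F (ic_l F F')) (gfun_comp F' (ic_r F F')) :=
  @NatIso _ _ (gfun_comp F (ic_l F F')) (gfun_comp F' (ic_r F F'))
    (fun w : isocomma F F' => tagged w) (fun w w' m => esym (icHomE m)).

Variables (a : gfun W A) (b : gfun W B) (n : nat_iso (gfun_comp F a) (gfun_comp F' b)).

Lemma ic_pair_full :
  (forall w w' (h1 : hom (a w) (a w')) (h2 : hom (b w) (b w')),
     fmor F' h2 ∘ n w = n w' ∘ fmor F h1 ->
     exists2 m : hom w w', fmor a m = h1 & fmor b m = h2) ->
  full (ic_pair n).
Proof.
move=> abP w w' h; have [m e1 e2] := abP _ _ _ _ (icHomE h).
by exists m; apply: icHom_inj.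
Qed.

Lemma ic_pair_ess_surj :
  (forall x y (g : hom (F x) (F' y)), exists w (h1 : hom (a w) x) (h2 : hom (b w) y),
     fmor F' h2 ∘ n w = g ∘ fmor F h1) ->
  ess_surj (ic_pair n).
Proof.
move=> abP [[x y] g]; have [w [h1 [h2 e]]] := abP _ _ g.
by exists w; apply: inhabits; apply: (@icHom _ _ _ F F' (ic_pair n w) (icMk g) h1 h2).
Qed.
End IcPairEquiv.

Section VCompLaws.
Variables G H : gpd.
Implicit Types s t r : span G H.

(** F induces a functor between the iso-commas. The legs [cleg x] and [cleg x'] after F agree only
    up to q, so connecting morphisms are corrected by the inverse of q. *)
Lemma iso2_vcompr s t r (y : span2 t r) (x x' : span2 s t) :
  iso2 x x' -> iso2 (span2_vcomp y x) (span2_vcomp y x').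
Proof.
case=> F [p [q [eF el er]]].
have uF := is_equiv_full eF; have sF := is_equiv_ess_surj eF.
pose W := isocomma (cleg x) (bleg y).
have nP (w w' : W) (m : hom w w') :
    tagged w' ∘ ginv (q (tag w').1) ∘ fmor (cleg x') (fmor F (val m).1)
    = fmor (bleg y) (val m).2 ∘ (tagged w ∘ ginv (q (tag w).1)).
  have /eqP em := valP m; have := natural (nat_inv q) (val m).1 => /= en.
  by rewrite -gcompA en gcompA -em -gcompA.
pose n := @NatIso W (apex t) (gfun_comp (cleg x') (gfun_comp F (ic_l _ _)))
  (gfun_comp (bleg y) (ic_r _ _)) (fun w : W => tagged w ∘ ginv (q (tag w).1)) nP.
pose p' := @NatIso W (apex s) (bleg (span2_vcomp y x))
  (gfun_comp (bleg (span2_vcomp y x')) (ic_pair n)) (fun w : W => p (tag w).1)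
  (fun _ _ m => natural p (val m).1).
pose q' := @NatIso W (apex r) (cleg (span2_vcomp y x))
  (gfun_comp (cleg (span2_vcomp y x')) (ic_pair n)) (fun w : W => gid _)
  (fun _ _ m => etrans (gid_l _) (esym (gid_r _))).
apply: (@iso2I _ _ _ _ (span2_vcomp y x) (span2_vcomp y x') (ic_pair n) p' q').
- move=> [[a b] g] [[a' b'] g'] [[h1 h2] em]; have /= /eqP eh := em.
  have [f fE] := uF _ _ h1; subst h1.
  have e : fmor (bleg y) h2 ∘ g = g' ∘ fmor (cleg x) f.
    apply: (gcompIr (f := ginv (q a))); rewrite /= -!gcompA eh.
    by rewrite -!gcompA; congr (_ ∘ _); have := natural (nat_inv q) f => /= ->.
  exists (exist _ (f, h2) (introT eqP e)).
  by apply: val_inj.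
- move=> [[a b] g] /=; have [a' [h]] := sF a.
  (* The object a is replaced by an a' with F a' isomorphic to it, and the connecting morphism
     absorbs both this isomorphism and q. *)
  exists (existT (fun ab : apx x * apx y => hom (cleg x ab.1) (bleg y ab.2) : Type)
    (a', b) (g ∘ fmor (cleg x') h ∘ q a')); apply: inhabits.
  apply: (exist _ (h, gid b)); rewrite /= fmor1 gid_l.
  by rewrite gcompKr.
- move=> [[a b] g] /=; rewrite fmor1 gid_l; have /= ea := el a.
  by rewrite -!gcompA -ea fmorM fmorV !gcompA gcompVKr.
- move=> [[a b] g] /=; rewrite fmor1 gid_l; have /= ea := er a.
  by rewrite -!gcompA -ea fmorM fmorV !gcompA gcompVKr.
Qed.

Lemma iso2_vcompl s t r (y y' : span2 t r) (x : span2 s t) :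
  iso2 y y' -> iso2 (span2_vcomp y x) (span2_vcomp y' x).
Proof.
case=> F [p [q [eF el er]]].
have uF := is_equiv_full eF; have sF := is_equiv_ess_surj eF.
pose W := isocomma (cleg x) (bleg y).
have nP (w w' : W) (m : hom w w') :
    p (tag w').2 ∘ tagged w' ∘ fmor (cleg x) (val m).1
    = fmor (bleg y') (fmor F (val m).2) ∘ (p (tag w).2 ∘ tagged w).
  by rewrite -gcompA -icHomE gcompA (natural p (val m).2) gcompA.
pose n := @NatIso W (apex t) (gfun_comp (cleg x) (ic_l _ _))
  (gfun_comp (bleg y') (gfun_comp F (ic_r _ _))) (fun w : W => p (tag w).2 ∘ tagged w) nP.
pose p' := @NatIso W (apex s) (bleg (span2_vcomp y x))
  (gfun_comp (bleg (span2_vcomp y' x)) (ic_pair n)) (fun w : W => gid _)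
  (fun _ _ m => etrans (gid_l _) (esym (gid_r _))).
pose q' := @NatIso W (apex r) (cleg (span2_vcomp y x))
  (gfun_comp (cleg (span2_vcomp y' x)) (ic_pair n)) (fun w : W => q (tag w).2)
  (fun _ _ m => natural q (val m).2).
apply: (@iso2I _ _ _ _ (span2_vcomp y x) (span2_vcomp y' x) (ic_pair n) p' q').
- move=> [[a b] g] [[a' b'] g'] [[h1 h2] em]; have /= /eqP eh := em.
  have [f fE] := uF _ _ h2; subst h2.
  have e : fmor (bleg y) f ∘ g = g' ∘ fmor (cleg x) h1.
    apply: (gcompIl (g := p b')); rewrite /= [RHS]gcompA -eh.
    by rewrite !gcompA; congr (_ ∘ _); have /= := natural p f => ->.
  exists (@icHom _ _ _ (cleg x) (bleg y) (icMk g) (icMk g') h1 f e).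
  by apply: val_inj.
- move=> [[a b] g] /=; have [b' [h]] := sF b.
  exists (@icMk _ _ _ (cleg x) (bleg y) a b' (ginv (p b') ∘ fmor (bleg y') (ginv h) ∘ g)).
  apply: inhabits; apply: (@icHom _ _ _ (cleg x) (bleg y') (ic_pair n (icMk _))
    (@icMk _ _ _ (cleg x) (bleg y') a b g) (gid a) h).
  by rewrite /= fmor1 gid_r !gcompA gcompKr -fmorM ginv_r fmor1 gid_l.
- move=> [[a b] g] /=; have /= ea := el b.
  by rewrite !fmor1 gid_r fmorM !gcompA -ea.
- move=> [[a b] g] /=; have /= ea := er b.
  by rewrite !fmor1 gid_r fmorM !gcompA -ea.
Qed.

End VCompLaws.

Section Assoc.
Variables (A B C Q R : gpd).
Variables (c : gfun A Q) (b : gfun B Q) (c' : gfun B R) (b' : gfun C R).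
Let l1 := ic_l c b.
Let r1 := ic_r c b.
Let l2 := ic_l (gfun_comp c' r1) b'.
Let r2 := ic_r (gfun_comp c' r1) b'.
Let W := isocomma (gfun_comp c' r1) b'.

(** Functors composed with different bracketings act identically but carry different proof fields;
    rebuilding a transformation from its components and its naturality changes its type accordingly.
    The same device recurs below. *)
Definition assoc_nat_r : nat_iso (gfun_comp c' (gfun_comp r1 l2)) (gfun_comp b' r2) :=
  @NatIso _ _ (gfun_comp c' (gfun_comp r1 l2)) (gfun_comp b' r2)
    (ic_nat (gfun_comp c' r1) b') (natural (ic_nat (gfun_comp c' r1) b')).
Let K := ic_pair assoc_nat_r.
Definition assoc_nat :
    nat_iso (gfun_comp c (gfun_comp l1 l2)) (gfun_comp (gfun_comp b (ic_l c' b')) K) :=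
  @NatIso _ _ (gfun_comp c (gfun_comp l1 l2)) (gfun_comp (gfun_comp b (ic_l c' b')) K)
    (fun w => ic_nat c b (l2 w)) (fun w w' m => natural (ic_nat c b) (fmor l2 m)).
(** The rebracketing ((x, y), z) to (x, (y, z)) of iterated iso-commas. *)
Definition assoc_fun := ic_pair assoc_nat.

Lemma assoc_full : full assoc_fun.
Proof.
apply: ic_pair_full => w w' h1 h2 e1.
have e2 := icHomE h2.
exists (@icHom _ _ _ (gfun_comp c' r1) b' w w'
  (@icHom _ _ _ c b (l2 w) (l2 w') h1 (fmor (ic_l c' b') h2) e1) (fmor (ic_r c' b') h2) e2).
  by [].
by apply: icHom_inj.
Qed.

Lemma assoc_ess_surj : ess_surj assoc_fun.
Proof.
apply: ic_pair_ess_surj => x [[yb yc] gy] g.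
exists (@icMk _ _ _ (gfun_comp c' r1) b' (@icMk _ _ _ c b x yb g) yc gy).
exists (gid x), (@gid (isocomma c' b') (@icMk _ _ _ c' b' yb yc gy)).
by rewrite /= !fmor1 gid_l gid_r.
Qed.

Definition assoc_p (P : gpd) (a : gfun A P) :
  nat_iso (gfun_comp (gfun_comp a l1) l2) (gfun_comp (gfun_comp a (ic_l c _)) assoc_fun) :=
  @NatIso _ _ (gfun_comp (gfun_comp a l1) l2) (gfun_comp (gfun_comp a (ic_l c _)) assoc_fun)
    (fun w => gid (a (l1 (l2 w)))) (fun w w' m => gid_natural (fmor a (fmor l1 (fmor l2 m)))).
Definition assoc_q (P : gpd) (d : gfun C P) :
  nat_iso (gfun_comp d r2) (gfun_comp (gfun_comp (gfun_comp d (ic_r c' b')) (ic_r c _)) assoc_fun) :=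
  @NatIso _ _ (gfun_comp d r2) (gfun_comp (gfun_comp (gfun_comp d (ic_r c' b')) (ic_r c _)) assoc_fun)
    (fun w => gid (d (r2 w))) (fun w w' m => gid_natural (fmor d (fmor r2 m))).
End Assoc.

Section VCompLaws.
Variables G H : gpd.
Implicit Types s t r : span G H.

Lemma iso2_vcompA s t r o (z : span2 r o) (y : span2 t r) (x : span2 s t) :
  iso2 (span2_vcomp z (span2_vcomp y x)) (span2_vcomp (span2_vcomp z y) x).
Proof.
apply: (@iso2I _ _ _ _ (span2_vcomp z (span2_vcomp y x)) (span2_vcomp (span2_vcomp z y) x)
  (assoc_fun (cleg x) (bleg y) (cleg y) (bleg z))
  (assoc_p (cleg x) (bleg y) (cleg y) (bleg z) (bleg x))
  (assoc_q (cleg x) (bleg y) (cleg y) (bleg z) (cleg z))).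
- exact: assoc_full.
- exact: assoc_ess_surj.
- by move=> w; rewrite /= !fmor1 gid_l gid_r !gcompA.
- by move=> w; rewrite /= !fmor1 gid_l gid_r !gcompA.
Qed.
(** In an iso-comma against an identity functor, the connecting morphism identifies the second
    object with the image of the first, so the projection is an equivalence. *)
Lemma iso2_vcomp1l s t (x : span2 s t) : iso2 (span2_vcomp (span2_id t) x) x.
Proof.
pose W := apx (span2_vcomp (span2_id t) x).
pose p := @NatIso W (apex s) (bleg (span2_vcomp (span2_id t) x))
  (gfun_comp (bleg x) (ic_l _ _)) (fun w : W => gid (bleg x (tag w).1))
  (fun _ _ m => gid_natural (fmor (bleg x) (val m).1)).
pose q := @NatIso W (apex t) (cleg (span2_vcomp (span2_id t) x))
  (gfun_comp (cleg x) (ic_l _ _)) (fun w : W => ginv (tagged w))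
  (natural (nat_inv (ic_nat (cleg x) (gfun_id _)))).
apply: (@iso2I _ _ _ _ (span2_vcomp (span2_id t) x) x (ic_l _ _) p q).
- move=> [[a b] g] [[a' b'] g'] h /=.
  have e : g' ∘ fmor (cleg x) h ∘ ginv g ∘ g = g' ∘ fmor (cleg x) h by rewrite gcompVKr.
  by exists (@icHom _ _ _ (cleg x) (gfun_id (apex t)) (icMk (g : hom (cleg x a) (gfun_id _ b)))
    (icMk (g' : hom (cleg x a') (gfun_id _ b'))) h _ e).
- move=> a.
  exists (@icMk _ _ _ (cleg x) (gfun_id (apex t)) a (cleg x a) (gid _)).
  by apply: inhabits; exact: gid.
- move=> [[a b] g] /=; rewrite !fmor1 gid_r gid_l fmorV.
  by rewrite gcompKl.
- move=> [[a b] g] /=; rewrite !fmor1 gid_r gid_l fmorV.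
  by rewrite gcompKl.
Qed.

Lemma iso2_vcomp1r s t (x : span2 s t) : iso2 (span2_vcomp x (span2_id s)) x.
Proof.
pose W := apx (span2_vcomp x (span2_id s)).
pose p := @NatIso W (apex s) (bleg (span2_vcomp x (span2_id s)))
  (gfun_comp (bleg x) (ic_r _ _)) (fun w : W => tagged w)
  (natural (ic_nat (gfun_id _) (bleg x))).
pose q := @NatIso W (apex t) (cleg (span2_vcomp x (span2_id s)))
  (gfun_comp (cleg x) (ic_r _ _)) (fun w : W => gid (cleg x (tag w).2))
  (fun _ _ m => gid_natural (fmor (cleg x) (val m).2)).
apply: (@iso2I _ _ _ _ (span2_vcomp x (span2_id s)) x (ic_r _ _) p q).
- move=> [[a b] g] [[a' b'] g'] h /=.
  have e : fmor (bleg x) h ∘ g = g' ∘ (ginv g' ∘ fmor (bleg x) h ∘ g).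
    by rewrite -!gcompA gcompVKl.
  by exists (@icHom _ _ _ (gfun_id (apex s)) (bleg x) (icMk (g : hom (gfun_id _ a) (bleg x b)))
    (icMk (g' : hom (gfun_id _ a') (bleg x b'))) _ h e).
- move=> b.
  exists (@icMk _ _ _ (gfun_id (apex s)) (bleg x) (bleg x b) b (gid _)).
  by apply: inhabits; exact: gid.
- by move=> [[a b] g] /=; rewrite !fmor1 gid_l gid_r.
- by move=> [[a b] g] /=; rewrite !fmor1 gid_l gid_r.
Qed.

End VCompLaws.

Section NatGsum.
Variables (A B C : gpd) (K K' : gfun (gsum A B) C).
Variable n1 : nat_iso (gfun_comp K (ginl A B)) (gfun_comp K' (ginl A B)).
Variable n2 : nat_iso (gfun_comp K (ginr A B)) (gfun_comp K' (ginr A B)).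

Definition nat_gsum_comp (w : gsum A B) : hom (K w) (K' w) :=
  match w return hom (K w) (K' w) with inl a => n1 a | inr b => n2 b end.

Lemma nat_gsum_natural (w w' : gsum A B) (m : hom w w') :
  nat_gsum_comp w' ∘ fmor K m = fmor K' m ∘ nat_gsum_comp w.
Proof.
case: w w' m => [w|w] [w'|w'] m; last exact: (natural n2).
- exact: (natural n1).
- by case: m.
- by case: m.
Qed.

Definition nat_gsum : nat_iso K K' := NatIso nat_gsum_natural.
End NatGsum.

Section Distrib.
Variables (A A' B Q : gpd).

Section Right.
Variables (c : gfun A Q) (c' : gfun A' Q) (b : gfun B Q).
Let W := isocomma c b.
Let W' := isocomma c' b.
Definition distr_nat : nat_iso (gfun_comp (copair c c') (gfun_comp (ginl A A') (ic_l c b)))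
    (gfun_comp b (ic_r c b)) :=
  @NatIso W Q (gfun_comp (copair c c') (gfun_comp (ginl A A') (ic_l c b)))
    (gfun_comp b (ic_r c b)) (ic_nat c b) (natural (ic_nat c b)).
Definition distr_nat' : nat_iso (gfun_comp (copair c c') (gfun_comp (ginr A A') (ic_l c' b)))
    (gfun_comp b (ic_r c' b)) :=
  @NatIso W' Q (gfun_comp (copair c c') (gfun_comp (ginr A A') (ic_l c' b)))
    (gfun_comp b (ic_r c' b)) (ic_nat c' b) (natural (ic_nat c' b)).
(** Iso-commas distribute over coproducts: an object over [copair c c'] lies over exactly one
    summand, and there are no morphisms between the two kinds. *)
Definition distr_fun := copair (ic_pair distr_nat) (ic_pair distr_nat').

Lemma distr_full : full distr_fun.
Proof.
move=> [w|w] [w'|w'] h.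
- by exists (@icHom _ _ _ c b w w' (val h).1 (val h).2 (icHomE h)); apply: icHom_inj.
- by case: h => [[[]]].
- by case: h => [[[]]].
- by exists (@icHom _ _ _ c' b w w' (val h).1 (val h).2 (icHomE h)); apply: icHom_inj.
Qed.

Lemma distr_ess_surj : ess_surj distr_fun.
Proof.
move=> [[[a|a] y] g].
  by exists (inl (@icMk _ _ _ c b a y g)); apply: inhabits; exact: gid.
by exists (inr (@icMk _ _ _ c' b a y g)); apply: inhabits; exact: gid.
Qed.

Definition distr_p (P : gpd) (a : gfun A P) (a' : gfun A' P) :
    nat_iso (copair (gfun_comp a (ic_l c b)) (gfun_comp a' (ic_l c' b)))
      (gfun_comp (gfun_comp (copair a a') (ic_l (copair c c') b)) distr_fun) :=
  @nat_gsum W W' P (copair (gfun_comp a (ic_l c b)) (gfun_comp a' (ic_l c' b)))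
    (gfun_comp (gfun_comp (copair a a') (ic_l (copair c c') b)) distr_fun)
    (@NatIso W P
      (gfun_comp (copair (gfun_comp a (ic_l c b)) (gfun_comp a' (ic_l c' b))) (ginl _ _))
      (gfun_comp (gfun_comp (gfun_comp (copair a a') (ic_l (copair c c') b)) distr_fun) (ginl _ _))
      (fun w => gid (a (ic_l c b w))) (fun w w' m => gid_natural (fmor a (fmor (ic_l c b) m))))
    (@NatIso W' P
      (gfun_comp (copair (gfun_comp a (ic_l c b)) (gfun_comp a' (ic_l c' b))) (ginr _ _))
      (gfun_comp (gfun_comp (gfun_comp (copair a a') (ic_l (copair c c') b)) distr_fun) (ginr _ _))
      (fun w => gid (a' (ic_l c' b w))) (fun w w' m => gid_natural (fmor a' (fmor (ic_l c' b) m)))).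

Definition distr_q (P : gpd) (d : gfun B P) :
    nat_iso (copair (gfun_comp d (ic_r c b)) (gfun_comp d (ic_r c' b)))
      (gfun_comp (gfun_comp d (ic_r (copair c c') b)) distr_fun) :=
  @nat_gsum W W' P (copair (gfun_comp d (ic_r c b)) (gfun_comp d (ic_r c' b)))
    (gfun_comp (gfun_comp d (ic_r (copair c c') b)) distr_fun)
    (@NatIso W P
      (gfun_comp (copair (gfun_comp d (ic_r c b)) (gfun_comp d (ic_r c' b))) (ginl _ _))
      (gfun_comp (gfun_comp (gfun_comp d (ic_r (copair c c') b)) distr_fun) (ginl _ _))
      (fun w => gid (d (ic_r c b w))) (fun w w' m => gid_natural (fmor d (fmor (ic_r c b) m))))
    (@NatIso W' P
      (gfun_comp (copair (gfun_comp d (ic_r c b)) (gfun_comp d (ic_r c' b))) (ginr _ _))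
      (gfun_comp (gfun_comp (gfun_comp d (ic_r (copair c c') b)) distr_fun) (ginr _ _))
      (fun w => gid (d (ic_r c' b w))) (fun w w' m => gid_natural (fmor d (fmor (ic_r c' b) m)))).
End Right.

Section Left.
Variables (b : gfun B Q) (c : gfun A Q) (c' : gfun A' Q).
Let W := isocomma b c.
Let W' := isocomma b c'.
Definition distl_nat : nat_iso (gfun_comp b (ic_l b c))
    (gfun_comp (copair c c') (gfun_comp (ginl A A') (ic_r b c))) :=
  @NatIso W Q (gfun_comp b (ic_l b c))
    (gfun_comp (copair c c') (gfun_comp (ginl A A') (ic_r b c))) (ic_nat b c) (natural (ic_nat b c)).
Definition distl_nat' : nat_iso (gfun_comp b (ic_l b c'))
    (gfun_comp (copair c c') (gfun_comp (ginr A A') (ic_r b c'))) :=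
  @NatIso W' Q (gfun_comp b (ic_l b c'))
    (gfun_comp (copair c c') (gfun_comp (ginr A A') (ic_r b c'))) (ic_nat b c') (natural (ic_nat b c')).
Definition distl_fun := copair (ic_pair distl_nat) (ic_pair distl_nat').

Lemma distl_full : full distl_fun.
Proof.
move=> [w|w] [w'|w'] h.
- by exists (@icHom _ _ _ b c w w' (val h).1 (val h).2 (icHomE h)); apply: icHom_inj.
- by case: h => [[? []]].
- by case: h => [[? []]].
- by exists (@icHom _ _ _ b c' w w' (val h).1 (val h).2 (icHomE h)); apply: icHom_inj.
Qed.

Lemma distl_ess_surj : ess_surj distl_fun.
Proof.
move=> [[y [a|a]] g].
  by exists (inl (@icMk _ _ _ b c y a g)); apply: inhabits; exact: gid.
by exists (inr (@icMk _ _ _ b c' y a g)); apply: inhabits; exact: gid.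
Qed.

Definition distl_p (P : gpd) (d : gfun B P) :
    nat_iso (copair (gfun_comp d (ic_l b c)) (gfun_comp d (ic_l b c')))
      (gfun_comp (gfun_comp d (ic_l b (copair c c'))) distl_fun) :=
  @nat_gsum W W' P (copair (gfun_comp d (ic_l b c)) (gfun_comp d (ic_l b c')))
    (gfun_comp (gfun_comp d (ic_l b (copair c c'))) distl_fun)
    (@NatIso W P
      (gfun_comp (copair (gfun_comp d (ic_l b c)) (gfun_comp d (ic_l b c'))) (ginl _ _))
      (gfun_comp (gfun_comp (gfun_comp d (ic_l b (copair c c'))) distl_fun) (ginl _ _))
      (fun w => gid (d (ic_l b c w))) (fun w w' m => gid_natural (fmor d (fmor (ic_l b c) m))))
    (@NatIso W' P
      (gfun_comp (copair (gfun_comp d (ic_l b c)) (gfun_comp d (ic_l b c'))) (ginr _ _))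
      (gfun_comp (gfun_comp (gfun_comp d (ic_l b (copair c c'))) distl_fun) (ginr _ _))
      (fun w => gid (d (ic_l b c' w))) (fun w w' m => gid_natural (fmor d (fmor (ic_l b c') m)))).

Definition distl_q (P : gpd) (a : gfun A P) (a' : gfun A' P) :
    nat_iso (copair (gfun_comp a (ic_r b c)) (gfun_comp a' (ic_r b c')))
      (gfun_comp (gfun_comp (copair a a') (ic_r b (copair c c'))) distl_fun) :=
  @nat_gsum W W' P (copair (gfun_comp a (ic_r b c)) (gfun_comp a' (ic_r b c')))
    (gfun_comp (gfun_comp (copair a a') (ic_r b (copair c c'))) distl_fun)
    (@NatIso W P
      (gfun_comp (copair (gfun_comp a (ic_r b c)) (gfun_comp a' (ic_r b c'))) (ginl _ _))
      (gfun_comp (gfun_comp (gfun_comp (copair a a') (ic_r b (copair c c'))) distl_fun) (ginl _ _))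
      (fun w => gid (a (ic_r b c w))) (fun w w' m => gid_natural (fmor a (fmor (ic_r b c) m))))
    (@NatIso W' P
      (gfun_comp (copair (gfun_comp a (ic_r b c)) (gfun_comp a' (ic_r b c'))) (ginr _ _))
      (gfun_comp (gfun_comp (gfun_comp (copair a a') (ic_r b (copair c c'))) distl_fun) (ginr _ _))
      (fun w => gid (a' (ic_r b c' w))) (fun w w' m => gid_natural (fmor a' (fmor (ic_r b c') m)))).
End Left.
End Distrib.

Section VCompDistr.
Variables G H : gpd.
Implicit Types s t r : span G H.

Lemma iso2_vcompDr s t r (y : span2 t r) (x x' : span2 s t) :
  iso2 (sum2 (span2_vcomp y x) (span2_vcomp y x')) (span2_vcomp y (sum2 x x')).
Proof.
apply: (@iso2I _ _ _ _ (sum2 (span2_vcomp y x) (span2_vcomp y x')) (span2_vcomp y (sum2 x x'))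
  (distr_fun (cleg x) (cleg x') (bleg y))
  (distr_p (cleg x) (cleg x') (bleg y) (bleg x) (bleg x'))
  (distr_q (cleg x) (cleg x') (bleg y) (cleg y))).
- exact: distr_full.
- exact: distr_ess_surj.
- by move=> [w|w]; rewrite /= !fmor1 gid_l gid_r.
- by move=> [w|w]; rewrite /= !fmor1 gid_l gid_r.
Qed.

Lemma iso2_vcompDl s t r (y y' : span2 t r) (x : span2 s t) :
  iso2 (sum2 (span2_vcomp y x) (span2_vcomp y' x)) (span2_vcomp (sum2 y y') x).
Proof.
apply: (@iso2I _ _ _ _ (sum2 (span2_vcomp y x) (span2_vcomp y' x)) (span2_vcomp (sum2 y y') x)
  (distl_fun (cleg x) (bleg y) (bleg y'))
  (distl_p (cleg x) (bleg y) (bleg y') (bleg x))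
  (distl_q (cleg x) (bleg y) (bleg y') (cleg y) (cleg y'))).
- exact: distl_full.
- exact: distl_ess_surj.
- by move=> [w|w]; rewrite /= !fmor1 gid_l gid_r.
- by move=> [w|w]; rewrite /= !fmor1 gid_l gid_r.
Qed.
End VCompDistr.

(** * Whiskering of endomorphisms of the identity span *)

Section IcPairLift.
Variables (A B C W : gpd) (F : gfun A C) (F' : gfun B C).
Variables (a : gfun W A) (b : gfun W B) (n : nat_iso (gfun_comp F a) (gfun_comp F' b)).

(** The square F' h2 n = n F h1 determines F h1 from h2. Faithfulness of F thus leaves one choice of
    h1, and fullness provides one; hence a functor lifted to an iso-comma inherits its properties
    from a single projection when the opposite leg is fully faithful. *)
Lemma ic_pair_full_r : faithful F -> full b -> full (ic_pair n).
Proof.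
move=> fF ub; apply: ic_pair_full => w w' h1 h2 e; have [m em] := ub _ _ h2.
exists m => //; apply: fF; apply: (gcompIl (g := n w')); rewrite /= -e -em.
exact: (natural n m).
Qed.

Lemma ic_pair_ess_surj_r : full F -> ess_surj b -> ess_surj (ic_pair n).
Proof.
move=> uF sb; apply: ic_pair_ess_surj => x y g; have [w [h2]] := sb y.
have [h1 e] := uF _ _ (ginv g ∘ fmor F' h2 ∘ n w).
by exists w, h1, h2; rewrite e !gcompA ginv_r gid_l.
Qed.

Lemma ic_pair_full_l : faithful F' -> full a -> full (ic_pair n).
Proof.
move=> fF ua; apply: ic_pair_full => w w' h1 h2 e; have [m em] := ua _ _ h1.
exists m => //; apply: fF; apply: (gcompIr (f := n w)); rewrite /= e -em.
exact: (esym (natural n m)).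
Qed.

Lemma ic_pair_ess_surj_l : full F' -> ess_surj a -> ess_surj (ic_pair n).
Proof.
move=> uF sa; apply: ic_pair_ess_surj => x y g; have [w [h1]] := sa x.
have [h2 e] := uF _ _ (g ∘ fmor F h1 ∘ ginv (n w)).
by exists w, h1, h2; rewrite e gcompVKr.
Qed.
End IcPairLift.

Section FullLegs.
Variables (A B C : gpd) (F : gfun A C) (F' : gfun B C).

Lemma ic_l_full : full F' -> full (ic_l F F').
Proof.
move=> uF' w w' h.
have [h' e] := uF' _ _ (ic_nat F F' w' ∘ fmor F h ∘ ginv (ic_nat F F' w)).
have e' : fmor F' h' ∘ tagged w = tagged w' ∘ fmor F h by rewrite e gcompVKr.
by exists (@icHom _ _ _ F F' w w' h h' e').
Qed.

Lemma ic_l_ess_surj : ess_surj F' -> ess_surj (ic_l F F').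
Proof.
move=> sF' a; have [b [h]] := sF' (F a).
by exists (@icMk _ _ _ F F' a b (ginv h)); apply: inhabits; exact: gid.
Qed.
End FullLegs.

Lemma full_id (A : gpd) : full (gfun_id A).
Proof. by move=> a b h; exists h. Qed.

Lemma ess_surj_id (A : gpd) : ess_surj (gfun_id A).
Proof. by move=> a; exists a; apply: inhabits; exact: gid. Qed.

Lemma full_comp (A B C : gpd) (F : gfun A B) (F' : gfun B C) :
  full F' -> full F -> full (gfun_comp F' F).
Proof.
by move=> uF' uF a b h; have [h' <-] := uF' _ _ h; have [h'' <-] := uF _ _ h'; exists h''.
Qed.

Lemma ess_surj_comp (A B C : gpd) (F : gfun A B) (F' : gfun B C) :
  ess_surj F' -> ess_surj F -> ess_surj (gfun_comp F' F).
Proof.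
move=> sF' sF c; have [b [h]] := sF' c; have [a [h']] := sF b.
by exists a; apply: inhabits; exact: (h ∘ fmor F' h').
Qed.

Definition ic_nat_id (A : gpd) :
    nat_iso (ic_l (gfun_id A) (gfun_id A)) (ic_r (gfun_id A) (gfun_id A)) :=
  @NatIso _ _ (ic_l (gfun_id A) (gfun_id A)) (ic_r (gfun_id A) (gfun_id A))
    (ic_nat (gfun_id A) (gfun_id A)) (natural (ic_nat (gfun_id A) (gfun_id A))).

Section UnitCancel.
Variables (W P H : gpd) (F : gfun W P) (R : gfun P H) (F' : gfun W H).
Variable k : nat_iso (gfun_comp F' (gfun_id W)) (gfun_comp R F).
Let l := ic_l (gfun_id W) (gfun_id W).
Let r := ic_r (gfun_id W) (gfun_id W).
Let N := ic_nat_id W.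

Definition unitK_p : nat_iso (gfun_comp F l) (gfun_comp (gfun_id P) (gfun_comp F l)) :=
  @NatIso _ _ (gfun_comp F l) (gfun_comp (gfun_id P) (gfun_comp F l))
    (fun w => gid (F (l w))) (fun w w' m => gid_natural (fmor F (fmor l m))).

Lemma unitK_q_natural (w w' : isocomma (gfun_id W) (gfun_id W)) (m : hom w w') :
  fmor F (ginv (N w')) ∘ fmor F (fmor r m) = fmor F (fmor l m) ∘ fmor F (ginv (N w)).
Proof. by rewrite -!fmorM; congr (fmor F _); exact: (natural (nat_inv N) m). Qed.

Definition unitK_q : nat_iso (gfun_comp F r) (gfun_comp (gfun_id P) (gfun_comp F l)) :=
  @NatIso _ _ (gfun_comp F r) (gfun_comp (gfun_id P) (gfun_comp F l))
    (fun w => fmor F (ginv (N w))) unitK_q_natural.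

(** Naturality of k along [N w] rewrites the conjugate k F' (N w) k^-1 as R F (N w), which [unitK_q]
    cancels. With R and F' arbitrary, this covers the left and the right legs of [iso2_lunitK] at
    once. *)
Lemma unitK_eq (w : isocomma (gfun_id W) (gfun_id W)) :
  fmor R (unitK_q w) ∘ (k (r w) ∘ fmor F' (N w) ∘ ginv (k (l w)))
  = gid (R (F (l w))) ∘ fmor R (unitK_p w).
Proof.
have e := natural k (N w).
rewrite [X in _ ∘ (X ∘ _)]e -!gcompA ginv_r gid_r.
by rewrite /= -!fmorM ginv_l !fmor1 gid_l.
Qed.
End UnitCancel.

Lemma iso2_lunitK (G H : gpd) (u : span G H) :
  iso2 (span2_vcomp (span_lunit u) (span2_rev (span_lunit u))) (span2_id u).
Proof.
apply: (@iso2I _ _ _ _ (span2_vcomp (span_lunit u) (span2_rev (span_lunit u)))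
  (span2_id u) _ (unitK_p (ic_l (legr u) (gfun_id H))) (unitK_q (ic_l (legr u) (gfun_id H)))).
- exact (full_comp (@ic_l_full _ _ _ (legr u) (gfun_id H) (@full_id H))
    (@ic_l_full _ _ _ (gfun_id _) (gfun_id _) (@full_id _))).
- exact (ess_surj_comp (@ic_l_ess_surj _ _ _ (legr u) (gfun_id H) (@ess_surj_id H))
    (@ic_l_ess_surj _ _ _ (gfun_id _) (gfun_id _) (@ess_surj_id _))).
- exact (@unitK_eq (isocomma (legr u) (gfun_id H)) (apex u) G (ic_l (legr u) (gfun_id H)) (legl u)
    (legl (span_comp (span_id H) u)) (lu_lnat u)).
- exact (@unitK_eq (isocomma (legr u) (gfun_id H)) (apex u) H (ic_l (legr u) (gfun_id H)) (legr u)
    (legr (span_comp (span_id H) u)) (lu_rnat u)).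
Qed.

Lemma ginv_square (G : gpd) (a b a' b' : G) (h : hom a b) (h' : hom a' b') (f : hom a a')
    (g : hom b b') : h' ∘ f = g ∘ h -> ginv h' ∘ g = f ∘ ginv h.
Proof.
move=> e; apply: (gcompIl (g := h')).
by rewrite /= gcompVKl gcompA e gcompKr.
Qed.

Lemma square_comp (G : gpd) (a b c a' b' c' : G) (h : hom a b) (h' : hom a' b') (f : hom a a')
    (g : hom b b') (k : hom b c) (k' : hom b' c') (l : hom c c') :
  k' ∘ g = l ∘ k -> h' ∘ f = g ∘ h -> k' ∘ h' ∘ f = l ∘ (k ∘ h).
Proof. by move=> ek eh; rewrite -gcompA eh !gcompA ek. Qed.

Section UnitsId.
Variable G : gpd.
Local Notation I := (gfun_id G).
Local Notation U := (isocomma I I).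

Definition lr_nat : nat_iso (ic_l I I) (gfun_comp (ic_r I I) (gfun_id U)) :=
  @NatIso U G (ic_l I I) (gfun_comp (ic_r I I) (gfun_id U)) (ic_nat_id G) (natural (ic_nat_id G)).

Definition id_nat (A B : gpd) (F : gfun A B) : nat_iso F (gfun_comp F (gfun_id A)) :=
  @NatIso A B F (gfun_comp F (gfun_id A)) (fun a => gid (F a)) (fun a b f => gid_natural (fmor F f)).

Lemma ginv_r_id (a b : G) (h : hom a b) : h ∘ ginv h = gid b ∘ gid b.
Proof. by rewrite ginv_r gid_l. Qed.

Lemma ginv_l_id (a b : G) (h : hom a b) : gid a ∘ ginv (gid a) = ginv h ∘ h.
Proof. by rewrite ginv_l ginv_r. Qed.

Lemma ginvVK_id (a b : G) (h : hom a b) : gid b ∘ ginv (ginv h) = ginv (gid b) ∘ h.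
Proof. by rewrite ginv1 ginvK. Qed.

(** Both unitors of the identity are projections of one iso-comma, and its tautological
    transformation identifies the two projections. This lets formulas for the left unitor serve for
    the right one. *)
Lemma iso2_lunit_runit : iso2 (span_lunit (span_id G)) (span_runit (span_id G)).
Proof.
apply: (@iso2I _ _ _ _ (span_lunit (span_id G)) (span_runit (span_id G)) (gfun_id U)
  (id_nat (gfun_id U)) lr_nat).
- exact (@full_id U).
- exact (@ess_surj_id U).
- exact (fun w => erefl).
- exact (fun w => @ginv_r_id _ _ (ic_nat_id G w)).
Qed.

Lemma iso2_lunitV_runitV :
  iso2 (span2_rev (span_lunit (span_id G))) (span2_rev (span_runit (span_id G))).
Proof.
apply: (@iso2I _ _ _ _ (span2_rev (span_lunit (span_id G))) (span2_rev (span_runit (span_id G)))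
  (gfun_id U) lr_nat (id_nat (gfun_id U))).
- exact (@full_id U).
- exact (@ess_surj_id U).
- exact (fun w => @ginv_l_id _ _ (ic_nat_id G w)).
- exact (fun w => @ginvVK_id _ _ (ic_nat_id G w)).
Qed.

End UnitsId.

Section HCompUnit.
Variables (G X Y : gpd) (b c : gfun X G) (b' : gfun Y G).
Variable rx : nat_iso (gfun_comp (gfun_id G) b) (gfun_comp (gfun_id G) c).
Local Notation Ib := (gfun_comp (gfun_id G) b).
Local Notation Ib' := (gfun_comp (gfun_id G) b').
Let wl := ic_l Ib Ib'.
Let wr := ic_r Ib Ib'.
Let N := ic_nat Ib Ib'.

Lemma hc_nat1_natural (w w' : isocomma Ib Ib') (m : hom w w') :
  N w' ∘ ginv (rx (wl w')) ∘ fmor c (fmor wl m)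
  = fmor b' (fmor wr m) ∘ (N w ∘ ginv (rx (wl w))).
Proof. exact: (square_comp (natural N m) (natural (nat_inv rx) (fmor wl m))). Qed.

(** Compares the apex of the horizontal composite, glued along right leg against left leg, with the
    apex of the vertical composite, glued along [cleg x] against [bleg y]: connecting morphisms
    differ by [rnat x]. *)
Definition hc_nat1 : nat_iso (gfun_comp c wl) (gfun_comp b' wr) :=
  @NatIso _ G (gfun_comp c wl) (gfun_comp b' wr)
    (fun w => N w ∘ ginv (rx (wl w))) hc_nat1_natural.

Lemma hc_full1 : full (ic_pair hc_nat1).
Proof.
apply: ic_pair_full => w w' h1 h2 e.
have e2 : fmor b' h2 ∘ N w = N w' ∘ fmor b h1.
  apply: (gcompIr (f := ginv (rx (wl w)))).
  rewrite /= -[LHS]gcompA [LHS]e -[LHS]gcompA -[RHS]gcompA; congr (_ ∘ _).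
  exact: (natural (nat_inv rx) h1).
by exists (@icHom _ _ _ Ib Ib' w w' _ _ e2).
Qed.

Lemma hc_ess_surj1 : ess_surj (ic_pair hc_nat1).
Proof.
apply: ic_pair_ess_surj => x y g.
exists (@icMk _ _ _ Ib Ib' x y (g ∘ rx x)), (gid x), (gid y).
by rewrite /= !fmor1 gid_l gid_r gcompKr.
Qed.
End HCompUnit.

(** This lemma and the next are the compatibilities with [lnat] and [rnat] after both composites are
    unfolded, isolated as identities between morphisms of one groupoid to which the goals are
    convertible. *)
Lemma hcomp_eql (G : gpd) (a b c d : G) (lx : hom a b) (n : hom b c) (ly : hom c d) :
  gid b ∘ lx
  = ginv (gid b) ∘ ginv (ly ∘ n) ∘ (ly ∘ n ∘ lx) ∘ gid a ∘ gid a ∘ gid a.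
Proof. by rewrite !gid_r ginv1 !gid_l gcompA ginv_l gid_l. Qed.

Lemma hcomp_eqr (G : gpd) (a a' c d : G) (rx : hom a c) (n : hom a a') (ly ry : hom a' d) :
  gid d ∘ ry
  = ginv (ginv (ly ∘ n ∘ ginv rx)) ∘ ginv (ly ∘ (n ∘ ginv rx))
    ∘ (ry ∘ (n ∘ ginv rx) ∘ rx) ∘ gid a ∘ ginv n ∘ gid a'.
Proof. by rewrite !gid_r gid_l ginvK (gcompA ly) ginv_r gid_l gcompA gcompVKr gcompKr. Qed.

(* By naturality, horizontal composition of 2-cells of [Id] is the vertical one conjugated by the
   unitor; concretely the two composites of spans differ only by iso-commas over full legs. *)
Section HCompId.
Variable G : gpd.
Variables x y : span2 (span_id G) (span_id G).
Local Notation I := (gfun_id G).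
Local Notation lU := (ic_l I I).
Local Notation W := (isocomma (gfun_comp I (bleg x)) (gfun_comp I (bleg y))).
Local Notation wl := (ic_l (gfun_comp I (bleg x)) (gfun_comp I (bleg y))).
Local Notation wr := (ic_r (gfun_comp I (bleg x)) (gfun_comp I (bleg y))).
Local Notation zl := (ic_l (cleg x) (bleg y)).
Local Notation dZ := (gfun_comp (cleg y) (ic_r (cleg x) (bleg y))).
Local Notation B := (bleg (span2_hcomp y x)).
Local Notation D := (cleg (span2_hcomp y x)).
Local Notation n1 := (hc_nat1 (bleg y) (rnat x)).

Lemma hc_nat2_natural (w w' : W) (m : hom w w') :
  ginv (lnat y (wr w') ∘ n1 w') ∘ fmor (cleg y) (fmor wr m)
  = fmor (cleg x) (fmor wl m) ∘ ginv (lnat y (wr w) ∘ n1 w).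
Proof.
exact: (ginv_square (square_comp (natural (lnat y) (fmor wr m)) (natural n1 m))).
Qed.
(** The right-hand side [R] is a threefold iso-comma. [hc_nat1] lifts W to the apex of the vertical
    composite, [hc_nat2] past the reversed unitor, and [hc_nat3] past the unitor. The last two lifts
    are taken along [lU], a fully faithful leg, so they preserve fullness and essential
    surjectivity. *)
Definition hc_nat2 : nat_iso (gfun_comp dZ (ic_pair n1)) (gfun_comp lU D) :=
  @NatIso W G (gfun_comp dZ (ic_pair n1)) (gfun_comp lU D)
    (fun w => ginv (lnat y (wr w) ∘ n1 w)) hc_nat2_natural.
Local Notation vl := (ic_l dZ lU).

Definition hc_nat3 :
    nat_iso (gfun_comp lU B) (gfun_comp (gfun_comp (gfun_comp (bleg x) zl) vl) (ic_pair hc_nat2)) :=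
  @NatIso W G (gfun_comp lU B) (gfun_comp (gfun_comp (gfun_comp (bleg x) zl) vl) (ic_pair hc_nat2))
    (fun w => gid (bleg x (wl w))) (fun w w' m => gid_natural (fmor (bleg x) (fmor wl m))).

Let lU_faithful : faithful lU := ic_l_faithful (F := I) (@id_faithful G).
Let lU_full : full lU := @ic_l_full G G G I I (@full_id G).

Lemma hc_full : full (ic_pair hc_nat3).
Proof.
apply (@ic_pair_full_r _ _ _ _ _ _ _ _ hc_nat3 lU_faithful).
apply (@ic_pair_full_l _ _ _ _ _ _ _ _ hc_nat2 lU_faithful).
exact: hc_full1.
Qed.

Lemma hc_ess_surj : ess_surj (ic_pair hc_nat3).
Proof.
apply (@ic_pair_ess_surj_r _ _ _ _ _ _ _ _ hc_nat3 lU_full).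
apply (@ic_pair_ess_surj_l _ _ _ _ _ _ _ _ hc_nat2 lU_full).
exact: hc_ess_surj1.
Qed.

Local Notation LV := (span2_rev (span_lunit (span_id G))).
Local Notation LL := (span_lunit (span_id G)).
Local Notation R := (span2_vcomp (span2_vcomp LV (span2_vcomp y x)) LL).

Definition hc_p : nat_iso B (gfun_comp (bleg R) (ic_pair hc_nat3)) :=
  @NatIso W (isocomma I I) B (gfun_comp (bleg R) (ic_pair hc_nat3))
    (fun w => gid (B w)) (fun w w' m => gid_natural (fmor B m)).
Definition hc_q : nat_iso D (gfun_comp (cleg R) (ic_pair hc_nat3)) :=
  @NatIso W (isocomma I I) D (gfun_comp (cleg R) (ic_pair hc_nat3))
    (fun w => gid (D w)) (fun w w' m => gid_natural (fmor D m)).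

Lemma iso2_hcomp : iso2 (span2_hcomp y x) R.
Proof.
apply (@iso2I G G _ _ (span2_hcomp y x) R (ic_pair hc_nat3) hc_p hc_q).
- exact hc_full.
- exact hc_ess_surj.
- exact (fun w => @hcomp_eql G _ _ _ _ (lnat x (wl w)) (n1 w) (lnat y (wr w))).
- exact (fun w => @hcomp_eqr G _ _ _ _ (rnat x (wl w))
    (ic_nat (gfun_comp I (bleg x)) (gfun_comp I (bleg y)) w) (lnat y (wr w)) (rnat y (wr w))).
Qed.
End HCompId.

(** * Linear combinations of spans and the Hom categories they form *)

Section LcEval.
Variables (k : comNzRingType) (V : lmodType k).

Lemma lc_eval_cat (T : Type) (f : T -> V) (s t : lcomb k T) :
  lc_eval f (s ++ t) = lc_eval f s + lc_eval f t.
Proof. by rewrite /lc_eval big_cat. Qed.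

Lemma lc_eval_nil (T : Type) (f : T -> V) : lc_eval f [::] = 0.
Proof. by rewrite /lc_eval big_nil. Qed.

Lemma lc_eval_cons (T : Type) (f : T -> V) (x : k * T) (s : lcomb k T) :
  lc_eval f (x :: s) = x.1 *: f x.2 + lc_eval f s.
Proof. by rewrite /lc_eval big_cons. Qed.

Lemma lc_eval_map2 (T U W : Type) (f : W -> V) (g : T -> U -> W) (s : lcomb k T) (t : lcomb k U) :
  lc_eval f (lc_map2 g s t) = lc_eval (fun x => lc_eval (fun y => f (g x y)) t) s.
Proof.
rewrite /lc_eval /lc_map2 big_allpairs_dep; apply: eq_bigr => x _.
by rewrite scaler_sumr; apply: eq_bigr => y _; rewrite scalerA.
Qed.

Lemma lc_eval_swap (T U : Type) (f : T -> U -> V) (s : lcomb k T) (t : lcomb k U) :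
  lc_eval (fun x => lc_eval (f x) t) s = lc_eval (fun y => lc_eval (f^~ y) s) t.
Proof.
elim: s => [|x s IHs].
  by rewrite lc_eval_nil /lc_eval big1 // => y _; rewrite big_nil scaler0.
rewrite lc_eval_cons IHs /lc_eval scaler_sumr -big_split.
by apply: eq_bigr => y _; rewrite /= big_cons scalerDr !scalerA mulrC.
Qed.

Lemma lc_eval_eq (T : Type) (f g : T -> V) (s : lcomb k T) : f =1 g -> lc_eval f s = lc_eval g s.
Proof. by move=> fg; apply: eq_bigr => x _; rewrite fg. Qed.

Lemma lc_eval_map (T U : Type) (f : U -> V) (g : T -> U) (s : lcomb k T) :
  lc_eval f (lc_map g s) = lc_eval (fun x => f (g x)) s.
Proof. by rewrite /lc_eval /lc_map big_map. Qed.

Lemma lc_eval1 (T : Type) (f : T -> V) (x : T) : lc_eval f [:: (1, x)] = f x.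
Proof. by rewrite /lc_eval big_seq1 scale1r. Qed.
End LcEval.

Lemma lc_eq_equiv (k : comNzRingType) (T : Type) iso add : Equivalence (@lc_eq k T iso add).
Proof.
split=> [s | s t st | s t r st tr] V f fi fa //; first by rewrite st.
by rewrite st // tr.
Qed.

Section SpanLcat.
Variable k : comNzRingType.

(** Equality is tested on additive [iso2]-invariant functions f, so each law reduces to one about
    single spans. Compatibility of composition with [≈] requires that composing f with [span2_vcomp]
    in one variable be again such a test function; this is where distributivity over coproducts
    enters. *)
Lemma span_lcat : is_lcat (span_bicat k).
Proof.
split=> /=.
- by move=> G H u v; exact: lc_eq_equiv.
- move=> G H u v w y y' x x' yy' xx' V f fi fa; rewrite !lc_eval_map2.
  transitivity (lc_eval (fun y => lc_eval (fun x => f (span2_vcomp y x)) x') y).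
    apply: lc_eval_eq => z; apply: xx' => [a b ab | a b].
      exact/fi/iso2_vcompr.
    by rewrite -fa; apply/esym/fi/iso2_vcompDr.
  rewrite !(lc_eval_swap (fun (y : span2 v w) (x : span2 u v) => f (span2_vcomp y x))).
  apply: lc_eval_eq => z.
  apply: yy' => [a b ab | a b]; first exact/fi/iso2_vcompl.
  by rewrite -fa; apply/esym/fi/iso2_vcompDl.
- move=> G H u v w t z y x V f fi fa; rewrite !lc_eval_map2.
  apply: lc_eval_eq => c; rewrite lc_eval_map2; apply: lc_eval_eq => b.
  by apply: lc_eval_eq => a; apply/fi/iso2_vcompA.
- move=> G H u v x V f fi fa; rewrite lc_eval_map2 lc_eval1.
  by apply: lc_eval_eq => a; apply/fi/iso2_vcomp1l.
- move=> G H u v x V f fi fa; rewrite lc_eval_map2.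
  by apply: lc_eval_eq => a; rewrite lc_eval1; apply/fi/iso2_vcomp1r.
- by move=> G H u v x x' y y' xx' yy' V f fi fa; rewrite !lc_eval_cat xx' ?yy'.
- by move=> G H u v x y z V f fi fa; rewrite !lc_eval_cat addrA.
- by move=> G H u v x y V f fi fa; rewrite !lc_eval_cat addrC.
- by move=> G H u v x V f fi fa.
- by move=> G H u v w y y' x V f fi fa; rewrite !lc_eval_cat !lc_eval_map2 lc_eval_cat.
- move=> G H u v w y x x' V f fi fa; rewrite !lc_eval_cat !lc_eval_map2.
  rewrite -big_split; apply: eq_bigr => z _.
  by rewrite lc_eval_cat scalerDr.
- by move=> G H u v w x V f fi fa; rewrite lc_eval_map2.
- move=> G H u v w y V f fi fa; rewrite lc_eval_map2 lc_eval_nil.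
  by apply: big1 => z _; rewrite lc_eval_nil scaler0.
Qed.

Let B := span_bicat k.
#[local] Instance span_Equivalence G H u v : Equivalence (@eq2 k B G H u v) :=
  eq2_equiv span_lcat u v.
#[local] Instance span_Proper G H u v w :
  Proper (@eq2 k B G H v w ==> @eq2 k B G H u v ==> @eq2 k B G H u w) (@vcomp k B G H u v w).
Proof. by move=> y y' yy' x x' xx'; apply: (vcomp_eq2 span_lcat). Qed.

Lemma span_hcomp (G : cell0 B) (y x : @cell2 k B G G (id1 G) (id1 G)) :
  hcomp y x ≈ lunitV (id1 G) ⊙ (y ⊙ x) ⊙ lunit (id1 G).
Proof.
move=> V f fi fa; rewrite /= !lc_eval_map2 lc_eval1 lc_eval_map2.
apply: lc_eval_eq => b; apply: lc_eval_eq => a; rewrite lc_eval1.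
exact/fi/iso2_hcomp.
Qed.

Lemma span_lunit_runit (G : cell0 B) : @lunit k B G G (id1 G) ≈ runit (id1 G).
Proof. by move=> V f fi fa; rewrite /= !lc_eval1; apply/fi/iso2_lunit_runit. Qed.

Lemma span_lunitV_runitV (G : cell0 B) : @lunitV k B G G (id1 G) ≈ runitV (id1 G).
Proof. by move=> V f fi fa; rewrite /= !lc_eval1; apply/fi/iso2_lunitV_runitV. Qed.

Lemma span_lunitK (G : cell0 B) : @lunit k B G G (id1 G) ⊙ lunitV (id1 G) ≈ id2 (id1 G).
Proof.
move=> V f fi fa; rewrite /= lc_eval_map2 !lc_eval1.
exact/fi/iso2_lunitK.
Qed.

Lemma span_unit_like (G : cell0 B) : unit_like (id2 (id1 G)) (id2 (id1 G)).
Proof.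
split.
- exact: (vcomp1l span_lcat).
- exact: (vcomp1l span_lcat).
- exact: span_lunitK.
- by rewrite -span_lunit_runit -span_lunitV_runitV; exact: span_lunitK.
- by move=> x m; rewrite span_hcomp !(vcomp1l span_lcat) (vcomp1r span_lcat); reflexivity.
- move=> m x; rewrite span_hcomp !(vcomp1l span_lcat) (vcomp1r span_lcat).
  by rewrite -span_lunit_runit -span_lunitV_runitV; reflexivity.
Qed.
End SpanLcat.

(** * Crossed sets as endomorphisms of the identity span *)

Section CrossedSpans.
Variable gT : finGroupType.
Implicit Types X Y : crossed gT.
Local Notation GG := (grp gT).

Section TrFun.
Variables (X Y : crossed gT) (f : xcar X -> xcar Y).
Hypothesis fJ : forall x g, f (xact X x g) = xact Y (f x) g.

Lemma tr_fun_subproof (x x' : xcar X) (g : tr_hom x x') : xact Y (f x') (val g) == f x.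
Proof. by case: g => g /= /eqP <-; rewrite fJ. Qed.

Program Definition tr_fun : gfun (tr_gpd X) (tr_gpd Y) :=
  @GFun (tr_gpd X) (tr_gpd Y) f (fun x x' g => exist _ (val g) (tr_fun_subproof g)) _ _.
Next Obligation. by move=> x; apply: val_inj. Qed.
Next Obligation. by move=> x y z g h; apply: val_inj. Qed.

Definition tr_fun_nat : nat_iso (tr_leg X) (gfun_comp (tr_leg Y) tr_fun) :=
  @NatIso (tr_gpd X) GG (tr_leg X) (gfun_comp (tr_leg Y) tr_fun)
    (fun _ => 1%g) (fun x y g => gid_natural (fmor (tr_leg X) g)).
End TrFun.

Lemma iso2_tr_iso X Y : crossed_iso X Y -> iso2 (tr_span2 X) (tr_span2 Y).
Proof.
case=> f [[f' fK f'K] fJ fm].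
apply: (@iso2I _ _ _ _ (tr_span2 X) (tr_span2 Y) (tr_fun fJ) (tr_fun_nat fJ) (tr_fun_nat fJ)).
- move=> x y [h /= eh].
  have eh' : xact X y h == x by apply/eqP/(can_inj fK); rewrite fJ; apply/eqP.
  by exists (exist _ h eh'); apply: val_inj.
- by move=> y; exists (f' y); rewrite /= f'K; apply: inhabits; exact: (@gid (tr_gpd Y)).
- by move=> x; rewrite /= fm mul1g mulg1.
- by move=> x; rewrite /= mul1g.
Qed.

Lemma iso2_tr_sum X Y : iso2 (sum2 (tr_span2 X) (tr_span2 Y)) (tr_span2 (crossed_sum X Y)).
Proof.
pose Z := crossed_sum X Y.
have lJ x g : inl (xact X x g) = xact Z (inl x) g by [].
have rJ x g : inr (xact Y x g) = xact Z (inr x) g by [].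
pose F := copair (@tr_fun X Z inl lJ) (@tr_fun Y Z inr rJ).
pose n := @nat_gsum (tr_gpd X) (tr_gpd Y) GG (copair (tr_leg X) (tr_leg Y))
  (gfun_comp (tr_leg Z) F)
  (@NatIso _ _ (gfun_comp (copair (tr_leg X) (tr_leg Y)) (ginl _ _))
    (gfun_comp (gfun_comp (tr_leg Z) F) (ginl _ _)) (fun _ => 1%g)
    (fun x y g => gid_natural (fmor (tr_leg X) g)))
  (@NatIso _ _ (gfun_comp (copair (tr_leg X) (tr_leg Y)) (ginr _ _))
    (gfun_comp (gfun_comp (tr_leg Z) F) (ginr _ _)) (fun _ => 1%g)
    (fun x y g => gid_natural (fmor (tr_leg Y) g))).
apply: (@iso2I _ _ _ _ (sum2 (tr_span2 X) (tr_span2 Y)) (tr_span2 Z) F n n).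
- move=> [x|x] [y|y] [h /= eh] //.
  + by exists (exist _ h (introT eqP (inl_inj (eqP eh)))); apply: val_inj.
  + by exists (exist _ h (introT eqP (inr_inj (eqP eh)))); apply: val_inj.
- by move=> [x|x]; [exists (inl x) | exists (inr x)]; apply: inhabits; exact: (@gid (tr_gpd Z)).
- by move=> [x|x]; rewrite /= mul1g mulg1.
- by move=> [x|x]; rewrite /= mul1g.
Qed.

(** The unit [G,1]_G of the crossed Burnside ring. *)
Program Definition crossed_pt : crossed gT :=
  @Crossed gT unit (TotalAction (to := fun _ _ => tt) _ _) (fun _ => 1%g) _.
Next Obligation. by case. Qed.
Next Obligation. by case. Qed.
Next Obligation. by move=> x g /=; rewrite conj1g. Qed.

Lemma iso2_tr_pt : iso2 (tr_span2 crossed_pt) (span2_id (span_id GG)).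
Proof.
pose n := @NatIso (tr_gpd crossed_pt) GG (tr_leg crossed_pt)
  (gfun_comp (gfun_id GG) (tr_leg crossed_pt)) (fun _ => 1%g)
  (fun x y g => gid_natural (fmor (tr_leg crossed_pt) g)).
apply: (@iso2I _ _ _ _ (tr_span2 crossed_pt) (span2_id (span_id GG)) (tr_leg crossed_pt) n n).
- by move=> x y h; exists (exist (fun g => xact crossed_pt y g == x) h (eqxx tt : _ == x)).
- by move=> []; exists tt; apply: inhabits; exact: 1%g.
- by move=> x; rewrite /= mulg1.
- by move=> x; rewrite /= mulg1.
Qed.

Section Product.
Variables X Y : crossed gT.

Definition crossed_prod_act (z : xcar X * xcar Y) (g : gT) := (xact X z.1 g, xact Y z.2 g).
Lemma crossed_prod_act1 z : crossed_prod_act z 1%g = z.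
Proof. by case: z => x y; rewrite /crossed_prod_act !act1. Qed.
Lemma crossed_prod_actM z : act_morph crossed_prod_act z.
Proof. by move=> g h; rewrite /crossed_prod_act !actM. Qed.

Program Definition crossed_prod : crossed gT :=
  @Crossed gT (xcar X * xcar Y)%type (TotalAction crossed_prod_act1 crossed_prod_actM)
    (fun z => xmap z.1 * xmap z.2)%g _.
Next Obligation. by move=> z g /=; rewrite !xmapJ conjMg. Qed.

Let fst_J (z : xcar crossed_prod) g : (xact crossed_prod z g).1 = xact X z.1 g.
Proof. by []. Qed.
Let snd_J (z : xcar crossed_prod) g : (xact crossed_prod z g).2 = xact Y z.2 g.
Proof. by []. Qed.

(** An object of the iso-comma is a triple of y, x and a group element g; translating x by g makes g
    trivial and leaves the product with diagonal action. [tr_span2 Y] is composed first, which gives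
    the label [xmap x * xmap y] in this order. *)
Lemma iso2_tr_prod :
  iso2 (tr_span2 crossed_prod) (span2_vcomp (tr_span2 X) (tr_span2 Y)).
Proof.
pose Z := crossed_prod; pose F1 := tr_fun fst_J; pose F2 := tr_fun snd_J.
pose n := @NatIso (tr_gpd Z) GG (gfun_comp (tr_leg Y) F2) (gfun_comp (tr_leg X) F1)
  (fun _ => 1%g) (fun x y g => gid_natural (fmor (tr_leg Z) g)).
pose p := @NatIso (tr_gpd Z) GG (tr_leg Z)
  (gfun_comp (gfun_comp (tr_leg Y) (ic_l (tr_leg Y) (tr_leg X))) (ic_pair n)) (fun _ => 1%g)
  (fun x y g => gid_natural (fmor (tr_leg Z) g)).
pose q := @NatIso (tr_gpd Z) GG (tr_leg Z)
  (gfun_comp (gfun_comp (tr_leg X) (ic_r (tr_leg Y) (tr_leg X))) (ic_pair n)) (fun _ => 1%g)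
  (fun x y g => gid_natural (fmor (tr_leg Z) g)).
apply: (@iso2I _ _ _ _ (tr_span2 Z) (span2_vcomp (tr_span2 X) (tr_span2 Y)) (ic_pair n) p q).
- apply: ic_pair_full => [[x y] [x' y']] [h1 /= e1] [h2 /= e2] /=.
  rewrite mul1g mulg1 => e; subst h2.
  have e : xact Z (x', y') h1 == (x, y).
    by rewrite -[xact Z _ _]/(xact X x' h1, xact Y y' h1) (eqP e1) (eqP e2).
  by exists (exist _ h1 e); apply: val_inj.
- apply: ic_pair_ess_surj => y x g.
  exists (xact X x g, y), (@gid (tr_gpd Y) y), (exist _ g (eqxx (xact X x g))).
  by rewrite /= !mulg1.
- by move=> w; rewrite /= !mulg1 mul1g.
- by move=> w; rewrite /= !mulg1.
Qed.
End Product.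
End CrossedSpans.

Section BurnsideCells.
Variables (k : comNzRingType) (gT : finGroupType).
Local Notation B := (span_bicat k).
Local Notation lcX := (lc_eq (@crossed_iso gT) (@crossed_sum gT)).
Implicit Types b : burnside gT k.

Lemma burnside_cell_eq b b' : lcX b b' -> burnside_cell b ≈ burnside_cell b'.
Proof.
move=> bb' V f fi fa; rewrite !lc_eval_map; apply: bb' => [X Y XY|X Y].
  exact/fi/iso2_tr_iso.
by rewrite -fa; apply/esym/fi/iso2_tr_sum.
Qed.

Lemma burnside_cell_mul b b' :
  burnside_cell b ⊙ burnside_cell b' ≈ burnside_cell (lc_map2 (@crossed_prod gT) b b').
Proof.
move=> V f fi fa; rewrite /= lc_eval_map lc_eval_map2 lc_eval_map lc_eval_map2.
apply: lc_eval_eq => X; rewrite lc_eval_map; apply: lc_eval_eq => Y.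
exact/esym/fi/iso2_tr_prod.
Qed.

Lemma burnside_cell1 : burnside_cell [:: (1, crossed_pt gT)] ≈ id2 (@id1 k B (grp gT)).
Proof. by move=> V f fi fa; rewrite /= !lc_eval1; apply/fi/iso2_tr_pt. Qed.

Lemma burnside_cell_sum (I : Type) (r : seq I) (b : I -> burnside gT k) :
  \big[@add2 k B _ _ _ _/zero2 _ _]_(i <- r) burnside_cell (b i)
  = burnside_cell (flatten [seq b i | i <- r]).
Proof.
elim: r => [|i r IHr]; first by rewrite big_nil.
by rewrite big_cons IHr /= /burnside_cell /lc_map map_cat.
Qed.
End BurnsideCells.

(** * The bicategory of permutation bimodules *)

Section Biperm.
Variable k : comNzRingType.
Local Notation B := (biperm_bicat k).

Lemma sum_indicator (I : finType) (i0 : I) (F : I -> k) :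
  \sum_i (i0 == i)%:R * F i = F i0.
Proof.
rewrite (bigD1 i0) //= eqxx mul1r big1 ?addr0 // => i.
by rewrite eq_sym => /negPf->; rewrite mul0r.
Qed.

Lemma sum_indicatorr (I : finType) (i0 : I) (F : I -> k) :
  \sum_i F i * (i == i0)%:R = F i0.
Proof.
by under eq_bigr do rewrite eq_sym mulrC; exact: sum_indicator.
Qed.

Lemma biperm_lcat : is_lcat B.
Proof.
split=> /=.
- by move=> G H u v; split=> [m y x s t|m n e y x s t|m n p e e' y x s t] //; rewrite e.
- move=> G H u v w n n' m m' nn' mm' y x s t /=.
  by apply: eq_bigr => r _; rewrite nn' mm'.
- move=> G H u v w t p n m y x s r /=.
  under eq_bigr do rewrite mulr_suml.
  rewrite exchange_big; apply: eq_bigr => a _; rewrite mulr_sumr.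
  by apply: eq_bigr => b _; rewrite mulrA.
- by move=> G H u v m y x s t /=; rewrite sum_indicatorr.
- by move=> G H u v m y x s t /=; rewrite sum_indicator.
- by move=> G H u v m m' n n' mm' nn' y x s t /=; rewrite mm' nn'.
- by move=> G H u v m n p y x s t /=; rewrite addrA.
- by move=> G H u v m n y x s t /=; rewrite addrC.
- by move=> G H u v m y x s t /=; rewrite add0r.
- move=> G H u v w n n' m y x s t /=; rewrite -big_split.
  by apply: eq_bigr => r _; rewrite mulrDr.
- move=> G H u v w n m m' y x s t /=; rewrite -big_split.
  by apply: eq_bigr => r _; rewrite mulrDl.
- by move=> G H u v w m y x s t /=; rewrite big1 // => r _; rewrite mulr0.
- by move=> G H u v w m y x s t /=; rewrite big1 // => r _; rewrite mul0r.
Qed.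

#[local] Instance biperm_Equivalence G H u v : Equivalence (@eq2 k B G H u v) :=
  eq2_equiv biperm_lcat u v.
#[local] Instance biperm_Proper G H u v w :
  Proper (@eq2 k B G H v w ==> @eq2 k B G H u v ==> @eq2 k B G H u w) (@vcomp k B G H u v w).
Proof. by move=> y y' yy' x x' xx'; apply: (vcomp_eq2 biperm_lcat). Qed.

Section OfMap.
Variables (G H : gpd) (U V : biset G H) (f : forall y x, bcar U y x -> bcar V y x).
Hypothesis fE : forall y y' x x' (h : hom y y') (g : hom x' x) (s : bcar U y x),
  f (bact h g s) = bact h g (f s).
Hypothesis f_bij : forall y x, bijective (@f y x).
Local Notation al := (@bihom_of k _ _ _ _ f fE : @cell2 k B _ _ U V).
Local Notation be := (@bihom_tr k _ _ _ _ f fE : @cell2 k B _ _ V U).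

Lemma bihom_ofK : be ⊙ al ≈ id2 (U : cell1 B G H).
Proof.
move=> y x s t /=; rewrite sum_indicator eq_sym.
by rewrite (inj_eq (bij_inj (f_bij y x))) eq_sym.
Qed.

Lemma bihom_trK : al ⊙ be ≈ id2 (V : cell1 B G H).
Proof.
move=> y x s t /=; have [g fK gK] := f_bij y x.
rewrite (reindex g) /=; last by apply: onW_bij; exists (@f y x).
by under eq_bigr do rewrite gK eq_sym; rewrite sum_indicator.
Qed.

Lemma bihom_conj (n : @cell2 k B G H V V) y x (s t : bcar U y x) :
  (be ⊙ n ⊙ al : @cell2 k B _ _ U U) y x s t = n y x (f s) (f t).
Proof.
rewrite /= sum_indicator.
rewrite (eq_bigr (fun r => (f t == r)%:R * n y x (f s) r)); last by move=> r _; rewrite mulrC.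
by rewrite sum_indicator.
Qed.
End OfMap.

Lemma bl_map_bij (G H : gpd) (U : biset G H) y x : bijective (@bl_map G H U y x).
Proof.
exists (fun s => fcls _ (bcMk (gid y : bcar (biset_id H) y y) s)) => [C|s].
  rewrite -[C in RHS]frepK; apply/eqP; rewrite fclsE; last exact: bc_equiv.
  rewrite /bl_map; case: (frep C) => z [h s] /=.
  apply/bc_relP; exists (ginv h) => /=; rewrite ginv_r; split=> //.
  by rewrite -lactM ginv_l lact1.
by rewrite bl_mapE /= lact1.
Qed.

Lemma br_map_bij (G H : gpd) (U : biset G H) y x : bijective (@br_map G H U y x).
Proof.
exists (fun s => fcls _ (bcMk s (gid x : bcar (biset_id G) x x))) => [C|s].
  rewrite -[C in RHS]frepK; apply/eqP; rewrite fclsE; last exact: bc_equiv.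
  rewrite /br_map; case: (frep C) => z [s g] /=.
  apply/bc_relP; exists g => /=; split=> //.
  by rewrite gid_r.
by rewrite br_mapE /= ract1.
Qed.

Lemma pu_map_bij (G : gpd) (y x : G) : bijective (@pu_map G y x).
Proof.
exists (fun s => fcls _ (@spMk _ _ (span_id G) y x y (gid y) s)) => [C|s].
  rewrite -[C in RHS]frepK; apply/eqP; rewrite fclsE; last exact: sp_equiv.
  rewrite /pu_map; case: (frep C) => p [h g] /=.
  apply/sp_relP; exists (ginv h) => /=; rewrite ginv_r; split=> //.
  by rewrite gcompKl.
by rewrite pu_mapE /= gid_l.
Qed.

(** The groupoid form of commutativity of Z(kG): the substitution of s r^-1 t for r swaps the
    factors, since left and right equivariance turn the kernels at (s, s r^-1 t) and (s r^-1 t, t)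
    into those at (r, t) and (s, r). *)
Lemma biperm_id_comm (G : cell0 B) (m n : @cell2 k B G G (id1 G) (id1 G)) :
  m ⊙ n ≈ n ⊙ m.
Proof.
move=> y x s t /=.
rewrite (reindex (fun r : hom x y => s ∘ ginv r ∘ t)) /=; last first.
  apply: onW_bij; exists (fun r : hom x y => t ∘ ginv r ∘ s) => r /=.
    by rewrite !ginvM ginvK !gcompA ginv_r gid_l gcompVKr.
  by rewrite !ginvM ginvK !gcompA ginv_r gid_l gcompVKr.
apply: eq_bigr => r _; rewrite mulrC; congr (_ * _).
  rewrite -(@bkerE _ _ _ _ _ m _ _ _ _ (gid y) (ginv r ∘ t) s r) /=.
  by rewrite !gid_l !gcompA ginv_r gid_l.
rewrite -(@bkerE _ _ _ _ _ n _ _ _ _ (s ∘ ginv r) (gid x) r t) /=.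
by rewrite !gid_r gcompVKr.
Qed.

Section UnitLike.
Variables (G : gpd) (U : biset G G) (f : forall y x, bcar U y x -> bcar (biset_id G) y x).
Hypothesis fE : forall y y' x x' (h : hom y y') (g : hom x' x) (s : bcar U y x),
  f (bact h g s) = bact h g (f s).
Hypothesis f_bij : forall y x, bijective (@f y x).
Local Notation al := (@bihom_of k _ _ _ _ f fE : @cell2 k B _ _ U (id1 (G : cell0 B))).
Local Notation be := (@bihom_tr k _ _ _ _ f fE : @cell2 k B _ _ (id1 (G : cell0 B)) U).

Let f_lact y y' x (h : hom y y') (s : bcar U y x) : f (lact h s) = h ∘ f s.
Proof. by have := fE h (gid x) s; rewrite /bact ract1 /= gid_r. Qed.
Let f_ract y x x' (g : hom x' x) (s : bcar U y x) : f (ract s g) = f s ∘ g.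
Proof. by have := fE (gid y) g s; rewrite /bact lact1 /= gid_l. Qed.

Lemma biperm_hcompl (n : @cell2 k B G G (id1 _) (id1 _)) (m : @cell2 k B G G U U) :
  hcomp n m ≈ lunitV (U : cell1 B G G) ⊙ (be ⊙ n ⊙ al ⊙ m) ⊙ lunit (U : cell1 B G G).
Proof.
move=> y x C C'.
rewrite [RHS](@bihom_conj G G _ _ _ (@bl_map_equi G G U) (be ⊙ n ⊙ al ⊙ m)) /=.
set s := bl_map C; set t := bl_map C'.
have eC : C = fcls _ (bcMk (gid y : bcar (biset_id G) y y) s).
  by apply: (bij_inj (@bl_map_bij _ _ U y x)); rewrite bl_mapE /= lact1.
transitivity (bh_ker n m (bcMk (gid y : bcar (biset_id G) y y) s) C').
  by rewrite {1}eC; apply/bh_ker_rel/frep_rel/bc_equiv.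
rewrite /bh_ker /=.
under eq_bigl => p.
  rewrite -(inj_eq (bij_inj (@bl_map_bij _ _ U y x))) bl_mapE /= -/t.
  rewrite -(inj_eq (bij_inj (f_bij y x))) f_lact.
  rewrite -(inj_eq (gcompIr (f := ginv (f p.2)))) /= gcompKr.
over.
(* Within the class C' the second component r is free and forces the first to be f t (f r)^-1. *)
rewrite (reindex_onto (fun r => (f t ∘ ginv (f r), r)) snd) /=; last first.
  by move=> [p r] /= /eqP->.
apply: eq_big => r; first by rewrite !eqxx.
rewrite mulrC => _; congr (_ * _).
rewrite -[RHS]/((be ⊙ n ⊙ al : @cell2 k B _ _ U U) y x r t) bihom_conj.
have /= <- := @bkerE _ _ _ _ _ n _ _ _ _ (gid y) (ginv (f r)) (f r) (f t).
by rewrite !gid_l ginv_r.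
Qed.

Lemma biperm_hcompr (m : @cell2 k B G G U U) (n : @cell2 k B G G (id1 _) (id1 _)) :
  hcomp m n ≈ runitV (U : cell1 B G G) ⊙ (be ⊙ n ⊙ al ⊙ m) ⊙ runit (U : cell1 B G G).
Proof.
move=> y x C C'.
rewrite [RHS](@bihom_conj G G _ _ _ (@br_map_equi G G U) (be ⊙ n ⊙ al ⊙ m)) /=.
set s := br_map C; set t := br_map C'.
have eC : C = fcls _ (bcMk s (gid x : bcar (biset_id G) x x)).
  by apply: (bij_inj (@br_map_bij _ _ U y x)); rewrite br_mapE /= ract1.
transitivity (bh_ker m n (bcMk s (gid x : bcar (biset_id G) x x)) C').
  by rewrite {1}eC; apply/bh_ker_rel/frep_rel/bc_equiv.
rewrite /bh_ker /=.
under eq_bigl => p.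
  rewrite -(inj_eq (bij_inj (@br_map_bij _ _ U y x))) br_mapE /= -/t.
  rewrite -(inj_eq (bij_inj (f_bij y x))) f_ract.
  rewrite -(inj_eq (gcompIl (g := ginv (f p.1)))) /= gcompKl.
over.
rewrite (reindex_onto (fun r => (r, ginv (f r) ∘ f t)) fst) /=; last first.
  by move=> [r p] /= /eqP->.
apply: eq_big => r; first by rewrite !eqxx.
move=> _; congr (_ * _).
rewrite -[RHS]/((be ⊙ n ⊙ al : @cell2 k B _ _ U U) y x r t) bihom_conj.
have /= <- := @bkerE _ _ _ _ _ n _ _ _ _ (ginv (f r)) (gid x) (f r) (f t).
by rewrite !gid_r ginv_l.
Qed.

Lemma biperm_unit_like : unit_like al be.
Proof.
have lc := biperm_lcat.
have aK := bihom_trK fE f_bij; have bK := bihom_ofK fE f_bij.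
split=> //.
- exact: (bihom_trK (@bl_map_equi G G U) (@bl_map_bij G G U)).
- exact: (bihom_trK (@br_map_equi G G U) (@br_map_bij G G U)).
- exact: biperm_hcompl.
(* [biperm_hcompr] produces the two factors in the order opposite to [hcomp_endr]; commutativity of
   End([id1]), transported to U, exchanges them. *)
- move=> m n; rewrite biperm_hcompr.
  have mE : m ≈ be ⊙ (al ⊙ m ⊙ be) ⊙ al.
    by rewrite !(vcompA lc) bK (vcomp1l lc) -(vcompA lc) bK (vcomp1r lc); reflexivity.
  have cmp (p q : @cell2 k B G G (id1 _) (id1 _)) :
      be ⊙ p ⊙ al ⊙ (be ⊙ q ⊙ al) ≈ be ⊙ (p ⊙ q) ⊙ al.
    by rewrite !(vcompA lc) -(vcompA lc _ al be) aK (vcomp1r lc); reflexivity.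
  have mC : be ⊙ n ⊙ al ⊙ m ≈ m ⊙ (be ⊙ n ⊙ al).
    by rewrite mE !cmp biperm_id_comm; reflexivity.
  by rewrite mC; reflexivity.
Qed.
End UnitLike.
End Biperm.

(** * The pseudo-functor on endomorphisms of the identity *)

Definition fibMk (G H : gpd) (s t : span G H) (w : span2 s t) (p : apex s) (q : apx w)
    (a : hom (bleg w q) p) : fibT w p :=
  existT (fun q : apx w => hom (bleg w q) p : Type) q a.

Section GroupAlgebra.
Variables (k : comNzRingType) (gT : finGroupType).

Definition conv (f g : {ffun gT -> k}) : {ffun gT -> k} := [ffun z => \sum_u f u * g (u^-1 * z)%g].
Definition cdelta : {ffun gT -> k} := [ffun z => (z == 1%g)%:R].

Local Notation B := (biperm_bicat k).

Lemma zcell_comp (z z' : zgalg gT k) (s t : gT) :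
  (zcell z ⊙ zcell z' : @cell2 k B _ _ _ _) tt tt s t = conv (val z) (val z') (t * s^-1)%g.
Proof.
rewrite ffunE /= (reindex (fun u : gT => (u^-1 * t)%g)) /=; last first.
  apply: onW_bij; exists (fun r => (t * r^-1)%g) => u; first by rewrite invMg invgK mulKVg.
  by rewrite invMg invgK mulgKV.
by apply: eq_bigr => u _; rewrite mulrC invMg invgK mulKVg mulgA.
Qed.

Lemma zcell_sum (I : Type) (r : seq I) (z : I -> zgalg gT k) (s t : gT) :
  (\big[@add2 k B _ _ _ _/zero2 _ _]_(i <- r) zcell (z i) : @cell2 k B _ _ _ _) tt tt s t
  = \sum_(i <- r) val (z i) (t * s^-1)%g.
Proof. by elim: r => [|i r IHr]; rewrite ?big_nil // !big_cons /= IHr. Qed.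

Lemma zcell_complete_orth (I : finType) (z : I -> zgalg gT k) :
  (forall i, conv (val (z i)) (val (z i)) = val (z i)) ->
  (forall i j, i != j -> conv (val (z i)) (val (z j)) = 0) ->
  \sum_i val (z i) = cdelta ->
  complete_orth (B := B) (fun i => zcell (z i)).
Proof.
move=> z2 z0 z1; split.
- by move=> i [] [] s t; rewrite [LHS]zcell_comp z2.
- by move=> i j ij [] [] s t; rewrite [LHS]zcell_comp z0 // ffunE.
- move=> [] [] s t; rewrite [LHS]zcell_sum.
  have /ffunP/(_ (t * s^-1)%g) := z1; rewrite sum_ffunE => ->.
  by rewrite ffunE /= -eq_mulgV1 eq_sym.
Qed.

(** The images of the objects under [bps0] are compared by Leibniz equality, so bimodule maps with
    equal kernels must be equal as records. *)
Lemma bihom_ext (G H : gpd) (U V : biset G H) (m n : bihom k U V) :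
  (forall y x s t, m y x s t = n y x s t) -> m = n.
Proof.
case: m n => [m mE] [n nE] /= mn.
have e : m = n.
  do 4 (apply: functional_extensionality_dep => ?); exact: mn.
by case: _ / e nE mn => nE _; congr Bihom; apply: proof_irrelevance.
Qed.

Local Notation P := (span_to_biperm k).
Local Notation GG := (grp gT).

Definition pu_inv (s : gT) : bcar (span_biset (span_id GG)) tt tt :=
  fcls _ (@spMk GG GG (span_id GG) tt tt tt 1%g s).

Lemma pu_mapP (C : bcar (span_biset (span_id GG)) tt tt) (s : gT) :
  (pu_map C == s) = (C == pu_inv s).
Proof.
rewrite -(inj_eq (bij_inj (@pu_map_bij GG tt tt)) C); congr (_ == _).
by rewrite pu_mapE /= mul1g.
Qed.

Lemma unit_conjE (c : @cell2 k (span_bicat k) GG GG (id1 _) (id1 _)) (s t : gT) :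
  (ps_unitV P GG ⊙ ps2 P c ⊙ ps_unit P GG : @cell2 k B _ _ _ _) tt tt s t
  = \sum_(x <- c) x.1 * sp_ker k x.2 (@spMk GG GG (span_id GG) tt tt tt 1%g s) (pu_inv t).
Proof.
rewrite /=.
under eq_bigr do rewrite pu_mapP eq_sym.
rewrite sum_indicator.
under eq_bigr do rewrite pu_mapP.
rewrite sum_indicatorr /lin_bihom.
elim: c => [|x c IHc]; rewrite ?big_nil // !big_cons /= IHc; congr (_ * _ + _).
apply/sp_ker_rel/frep_rel/sp_equiv.
Qed.

Lemma sp_ker_id (s t : gT) :
  sp_ker k (span2_id (span_id GG)) (@spMk GG GG (span_id GG) tt tt tt 1%g s) (pu_inv t)
  = (s == t)%:R.
Proof.
pose f0 : fibT (span2_id (span_id GG)) tt := @fibMk GG GG _ _ (span2_id (span_id GG)) tt tt 1%g.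
have fE (f : fibT (span2_id (span_id GG)) tt) : fcls (@fib_rel GG GG (span_id GG) (span_id GG) (span2_id (span_id GG)) tt) f = fcls _ f0.
  apply/eqP; rewrite fclsE; last exact: fib_equiv.
  by apply/fib_relP; case: f => [[] a]; exists a; rewrite /= mul1g.
have iE (f : fibT (span2_id (span_id GG)) tt) :
    (fcls (@sp_rel GG GG (span_id GG) tt tt) (@sp_img GG GG (span_id GG) (span_id GG) (span2_id (span_id GG)) tt tt
       (@spMk GG GG (span_id GG) tt tt tt 1%g s) f) == pu_inv t) = (s == t).
  rewrite -pu_mapP pu_mapE; case: f => [[] a] /=.
  by rewrite invg1 mulg1 !mul1g mulKVg.
rewrite /sp_ker; have [e|ne] := boolP (s == t).
  congr (_%:R); apply/eqP/cards1P; exists (fcls _ f0); apply/setP => C; rewrite inE.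
  apply/imsetP/eqP => [[f _ ->]|->]; first exact: fE.
  by exists f0; rewrite // inE iE.
rewrite (_ : [set _ | _ : _ & _] = set0) ?cards0 //.
apply/setP => C; rewrite inE; apply/imsetP => -[f]; rewrite inE iE => e.
by rewrite e in ne.
Qed.

(** Isomorphism classes in the fibre over the base point are the points of X: the pair of q and a
    represents the point a q, written [pt], and [sec] picks the representative with trivial a. The
    summand at a point multiplies s by the label of that point, so the coefficient of t counts the
    points labelled t s^-1. *)
Lemma sp_ker_tr (X : crossed gT) (s t : gT) :
  sp_ker k (tr_span2 X) (@spMk GG GG (span_id GG) tt tt tt 1%g s) (pu_inv t)
  = #|[set x : xcar X | xmap x == (t * s^-1)%g]|%:R.
Proof.
pose pt (f : fibT (tr_span2 X) tt) : xcar X := xact X (tag f) (tagged f : gT)^-1%g.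
pose sec (x : xcar X) : fibT (tr_span2 X) tt := @fibMk GG GG _ _ (tr_span2 X) tt x 1%g.
have fE f f' : (fcls (@fib_rel GG GG (span_id GG) (span_id GG) (tr_span2 X) tt) f == fcls _ f') = (pt f == pt f').
  rewrite fclsE; last exact: fib_equiv.
  case: f f' => [q a] [q' a']; rewrite /pt /=.
  apply/fib_relP/eqP => /= [[[c /= /eqP <-] <-]|e].
    by rewrite invMg actM actK.
  have e' : xact X q' (a'^-1 * a)%g == q by rewrite actM -e actKV.
  by exists (exist _ (a'^-1 * a)%g e'); rewrite /= mulKVg.
have iE f :
    (fcls (@sp_rel GG GG (span_id GG) tt tt) (@sp_img GG GG (span_id GG) (span_id GG) (tr_span2 X) tt tt
       (@spMk GG GG (span_id GG) tt tt tt 1%g s) f) == pu_inv t) = (xmap (pt f) == (t * s^-1)%g).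
  rewrite -pu_mapP pu_mapE /pt xmapJ; case: f => [q a] /=.
  rewrite invg1 mulg1 !mul1g conjgE invgK !mulgA.
  by rewrite -(inj_eq (mulIg s) _ (t * s^-1)%g) mulgKV.
rewrite /sp_ker; congr (_%:R).
have sI : injective (fun x => fcls (@fib_rel GG GG (span_id GG) (span_id GG) (tr_span2 X) tt) (sec x)).
  by move=> x y /eqP; rewrite fE /pt /= invg1 !act1 => /eqP.
rewrite -(card_imset _ sI); apply: eq_card => C.
apply/imsetP/imsetP => -[].
  move=> f; rewrite inE iE => fC ->; exists (pt f); first by rewrite inE.
  by apply/eqP; rewrite fE /pt /= invg1 act1.
move=> x; rewrite inE => xC ->; exists (sec x) => //.
by rewrite inE iE /pt /= invg1 act1.
Qed.

Lemma span_to_biperm_id : ps_unitV P GG ⊙ ps2 P (id2 (@id1 k (span_bicat k) GG)) ⊙ ps_unit P GG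
  = id2 (@id1 k B GG).
Proof.
apply: bihom_ext => -[] [] s t; rewrite [LHS]unit_conjE big_seq1 /= sp_ker_id mul1r.
by [].
Qed.

Lemma span_to_biperm_burnside (b : burnside gT k) :
  ps_unitV P GG ⊙ ps2 P (burnside_cell b) ⊙ ps_unit P GG = zcell (brho b).
Proof.
apply: bihom_ext => -[] [] s t; rewrite [LHS]unit_conjE /= ffunE big_map.
by apply: eq_bigr => X _; rewrite sp_ker_tr.
Qed.
End GroupAlgebra.

(** * Crossed sets and marks *)

Section CrossedSets.
Variable gT : finGroupType.
Implicit Types (X Y : crossed gT) (L : {group gT}).

Definition cstab X (x : xcar X) : {group gT} := 'C[x | xact X]%G.

Lemma mem_cstab X (x : xcar X) g : (g \in cstab x) = (xact X x g == x).
Proof. by apply/astab1P/eqP. Qed.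

Lemma mem_fix X (x : xcar X) L : (x \in 'Fix_(xact X)(L)%g) = (L \subset cstab x).
Proof. by rewrite sub_astab1 ?subsetT. Qed.

Lemma cstab_act X (x : xcar X) g : cstab (xact X x g) = (cstab x :^ g)%G.
Proof. by apply/val_inj; rewrite /= -astab1_act // inE. Qed.

Lemma cstab_inj X Y (f : xcar X -> xcar Y) (x : xcar X) : injective f ->
  (forall x g, f (xact X x g) = xact Y (f x) g) -> cstab (f x) = cstab x.
Proof.
move=> fI fJ; apply/val_inj/setP => g.
by rewrite [LHS]mem_cstab [RHS]mem_cstab -fJ (inj_eq fI).
Qed.

Lemma xmap_cent X (x : xcar X) L : L \subset cstab x -> xmap x \in 'C(L)%g.
Proof.
move=> /subsetP sL; apply/centP => g /sL; rewrite mem_cstab => /eqP e.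
by apply/commgP/conjg_fixP; rewrite -xmapJ e.
Qed.

Section Sub.
Variables (X : crossed gT) (S : {set xcar X}).
Hypothesis SJ : forall x g, (xact X x g \in S) = (x \in S).

Definition csub_car : finType := {x : xcar X | x \in S}.
Definition csub_act (x : csub_car) g : csub_car :=
  exist (fun x => x \in S) (xact X (val x) g) (etrans (SJ _ _) (valP x)).
Lemma csub_act1 x : csub_act x 1%g = x.
Proof. by apply: val_inj; rewrite /= act1. Qed.
Lemma csub_actM x : act_morph csub_act x.
Proof. by move=> g h; apply: val_inj; rewrite /= actM. Qed.
Program Definition csub : crossed gT :=
  @Crossed gT csub_car (TotalAction csub_act1 csub_actM) (fun x => xmap (val x)) _.
Next Obligation. by move=> x g /=; rewrite xmapJ. Qed.

Lemma cstab_csub (x : xcar csub) : cstab x = cstab (val x).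
Proof. by rewrite -(@cstab_inj csub X val) //; exact: val_inj. Qed.
End Sub.

Lemma csub_split X (S : {set xcar X}) (SJ : forall x g, (xact X x g \in S) = (x \in S))
    (SJ' : forall x g, (xact X x g \in ~: S) = (x \in ~: S)) :
  crossed_iso (crossed_sum (csub SJ) (csub SJ')) X.
Proof.
pose f (z : xcar (csub SJ) + xcar (csub SJ')) : xcar X :=
  match z with inl x => val x | inr x => val x end.
exists f; split; [|by case|by case].
pose g x : xcar (csub SJ) + xcar (csub SJ') :=
  match boolP (x \in S) with
  | AltTrue p => inl (exist _ x p)
  | AltFalse p => inr (exist (fun x => x \in ~: S) x (etrans (in_setC _ _) p))
  end.
have gK : cancel g f by move=> x; rewrite /g; case: {-}_ / boolP.
have fI : injective f.
  case=> [[x xS]|[x xS]] [[y yS]|[y yS]] /= e.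
  - by congr inl; apply: val_inj.
  - by exfalso; move: (yS); rewrite inE -e xS.
  - by exfalso; move: (xS); rewrite inE e yS.
  - by congr inr; apply: val_inj.
by exists g => // z; apply: fI; rewrite gK.
Qed.

Lemma inj_surj_bij (T U : choiceType) (f : T -> U) :
  injective f -> (forall y, exists x, f x == y) -> bijective f.
Proof.
move=> fI fS; exists (fun y => xchoose (fS y)) => [x|y]; last exact/eqP/(xchooseP (fS y)).
exact/fI/eqP/(xchooseP (fS (f x))).
Qed.

(** Orbit-stabilizer: the coset gH goes to g x. The left action of g is [xact] by g^-1, whence the
    inverse in f. *)
Lemma crossed_transitive_iso X (x : xcar X) (aC : xmap x \in 'C(cstab x)%g) :
  (forall y, exists g, y = xact X x g) ->
  crossed_iso (coset_crossed aC) X.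
Proof.
move=> trX; pose f (A : coset_sort (cstab x)) := xact X x (repr (val A))^-1%g.
have fE (A : coset_sort (cstab x)) h : h \in val A -> xact X x h^-1%g = f A.
  rewrite coset_mem mem_cstab => /eqP e.
  by rewrite -{1}e -actM /f; congr (xact X x _); rewrite mulgK.
have fI : injective f.
  move=> A A' e; apply/val_inj/setP => h; rewrite !coset_mem !mem_cstab !actM.
  by rewrite -!/(f _) e.
exists f; split.
- apply: inj_surj_bij fI _ => y; have [g ->] := trX y.
  exists (@coset_act _ (cstab x) (coset_base (cstab x)) g); apply/eqP.
  rewrite -(fE _ g^-1%g) ?invgK //=.
  by rewrite lcoset1 lcoset_refl.
- move=> A g; rewrite -(fE _ (g^-1 * repr (val A))%g) ?invMg ?invgK ?actM //=.
  by rewrite mem_lcoset invgK mulKVg mem_coset.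
- by move=> A; rewrite /f xmapJ.
Qed.
End CrossedSets.

(** * Injectivity of the ghost map *)

Section Marks.
Variables (K : fieldType) (gT : finGroupType).
Hypothesis charK : [pchar K] =i pred0.
Implicit Types (X Y : crossed gT) (L : {group gT}) (b : burnside gT K).
Local Notation lcX := (lc_eq (@crossed_iso gT) (@crossed_sum gT)).

Lemma natr_card (T : finType) (P : pred T) : #|[set x | P x]|%:R = \sum_x (P x)%:R :> K.
Proof.
by rewrite -sum1_card natr_sum big_mkcond; apply: eq_bigr => x _; rewrite inE; case: (P x).
Qed.

Lemma natr_neq0 n : (0 < n)%N -> n%:R != 0 :> K.
Proof. by move=> n0; apply/negP => /(natf0_pchar n0)[p]; rewrite charK. Qed.

(* Junk value [crossed_pt] when [a] does not centralize [L]. *)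
Definition cset L (a : gT) : crossed gT :=
  match @idP (a \in 'C(L)%g) with
  | ReflectT aC => coset_crossed aC
  | ReflectF _ => crossed_pt gT
  end.

Lemma csetE L a (aC : a \in 'C(L)%g) : cset L a = coset_crossed aC.
Proof. by rewrite /cset; case: {-}_ / idP => // aC'; rewrite (bool_irrelevance aC' aC). Qed.

Section Additive.
Variables (V : lmodType K) (f : crossed gT -> V).
Hypothesis fi : forall X Y, crossed_iso X Y -> f X = f Y.
Hypothesis fa : forall X Y, f (crossed_sum X Y) = f X + f Y.
Let G1 : K := #|gT|%:R.
(* An orbit [G/H] is counted once for each of its [|G|/|H|] points, whence the weight. *)
Let term X (x : xcar X) := (#|cstab x|%:R / G1) *: f (cset (cstab x) (xmap x)).

Lemma additive_transitive X (x0 : xcar X) :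
  (forall x y : xcar X, exists g, y = xact X x g) -> f X = \sum_(x : xcar X) term x.
Proof.
move=> trX.
have iso (x : xcar X) : f (cset (cstab x) (xmap x)) = f X.
  by rewrite (csetE (xmap_cent (subxx _))); apply/fi/crossed_transitive_iso/trX.
have cardS (x : xcar X) : (#|xcar X| * #|cstab x| = #|gT|)%N.
  have := card_orbit_stab (xact X) [set: gT] x; rewrite setTI cardsT => <-.
  congr (_ * _)%N; rewrite -cardsT; apply: eq_card => y; rewrite inE.
  by have [g ->] := trX x y; apply/esym/mem_orbit; rewrite inE.
rewrite (eq_bigr (fun _ => #|xcar X|%:R^-1 *: f X)).
  rewrite sumr_const -scaler_nat scalerA divff ?scale1r //.
  by apply: natr_neq0; apply/card_gt0P; exists x0.
move=> x _; rewrite /term iso; congr (_ *: _).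
have c0 : #|cstab x|%:R != 0 :> K by rewrite natr_neq0 // cardG_gt0.
by rewrite /G1 -(cardS x) natrM invfM mulrC mulfVK.
Qed.

Lemma additive_sub X (S : {set xcar X}) (SJ : forall x g, (xact X x g \in S) = (x \in S)) :
  \sum_(x : xcar (csub SJ)) term x = \sum_(x in S) term x.
Proof.
rewrite [RHS](reindex_omap (val : csub_car S -> _) insub) /=; last first.
  by move=> x xS; rewrite insubT.
apply: eq_big => [x|x _]; first by rewrite (valP x) valK eqxx.
by rewrite /term cstab_csub.
Qed.

(** Induction on the size of X, splitting off the orbit of a point. Both sides are additive, and
    [additive_transitive] settles a single orbit. *)
Lemma additive_orbits X : f X = \sum_(x : xcar X) term x.
Proof.
have [n] := ubnP #|xcar X|; elim: n X => // n IHn X ltXn.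
have [/eqP X0|] := boolP (#|xcar X| == 0).
  have Xf (x : xcar X) : False by have := card0_eq X0 x; rewrite inE.
  rewrite big1; last by move=> x; case: (Xf x).
  (* For empty X the sum of X with itself is isomorphic to X, so f X + f X = f X forces f X = 0. *)
  have e : f (crossed_sum X X) = f X.
    apply: fi; pose F (z : xcar X + xcar X) := match z with inl x => x | inr x => x end.
    exists F; split; try by case=> x; case: (Xf x).
    by exists inl => [[] x|x] //; case: (Xf x).
  by have := fa X X; rewrite e => /(congr1 (fun v => v - f X)); rewrite addrK subrr => <-.
rewrite -lt0n => /card_gt0P[x0 _].
pose S : {set xcar X} := orbit (xact X) [set: gT]%G x0.
have SJ x g : (xact X x g \in S) = (x \in S).
  by apply: (@orbit_actr _ _ (xact X) [set: gT]%G); rewrite inE.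
have SJ' x g : (xact X x g \in ~: S) = (x \in ~: S) by rewrite !inE SJ.
have x0S : x0 \in S by exact: orbit_refl.
rewrite -(fi (csub_split SJ SJ')) fa.
rewrite (@additive_transitive (csub SJ) (exist (fun x => x \in S) x0 x0S)); last first.
  move=> [x xS] [y yS].
  have /orbitP[g _ e] : y \in orbit (xact X) [set: gT]%G x.
    by move: (xS) => /orbit_eqP->.
  by exists g; apply: val_inj.
rewrite (IHn (csub SJ')); last first.
  rewrite -ltnS; apply: leq_trans ltXn; rewrite ltnS card_sig.
  by apply: (@proper_card _ (mem (~: S))); rewrite properE subset_predT /=; apply/subsetPn;
     exists x0; rewrite // inE x0S.
rewrite !additive_sub [RHS](bigID (mem S)) /=; congr (_ + _).
by apply: eq_bigl => x; rewrite inE.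
Qed.
End Additive.

(* [fmark] gives the coefficients of the ghost map, [smark] counts points whose stabilizer is
   exactly [L]; they determine each other by descending induction on [L], and [smark] determines
   the crossed set by [additive_orbits]. *)
Definition smark X L (a : gT) : K := \sum_(x : xcar X) ((cstab x == L) && (xmap x == a))%:R.
Definition fmark X L (a : gT) : K := \sum_(x : xcar X) ((L \subset cstab x) && (xmap x == a))%:R.

Lemma lc_eval_sum (V : lmodType K) (T I : Type) (c : lcomb K T) (r : seq I) (P : pred I)
    (F : I -> T -> V) :
  lc_eval (fun x => \sum_(i <- r | P i) F i x) c = \sum_(i <- r | P i) lc_eval (F i) c.
Proof.
elim: c => [|x c IHc]; first by rewrite lc_eval_nil big1 // => i _; rewrite lc_eval_nil.
rewrite lc_eval_cons IHc scaler_sumr -big_split.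
by apply: eq_bigr => i _; rewrite lc_eval_cons.
Qed.

Lemma lc_eval_scaler (V : lmodType K) (T : Type) (c : lcomb K T) (F : T -> K) (v : V) :
  lc_eval (fun x => F x *: v) c = lc_eval (F : T -> K^o) c *: v.
Proof.
by rewrite /lc_eval scaler_suml; apply: eq_bigr => x _; rewrite scalerA.
Qed.

Lemma bphiE L b a : bphi L b a = lc_eval (fun X => fmark X L a : K^o) b.
Proof.
rewrite ffunE; apply: eq_bigr => X _; congr (_ * _); rewrite natr_card.
by apply: eq_bigr => x _; rewrite mem_fix.
Qed.

Lemma fmark_smark X L a : fmark X L a = \sum_(L' : {group gT} | L \subset L') smark X L' a.
Proof.
rewrite exchange_big; apply: eq_bigr => x _ /=.
have [sL|nsL] := boolP (L \subset cstab x).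
  rewrite (bigD1 (cstab x)) //= eqxx big1 ?addr0 // => L' /andP[_].
  by rewrite eq_sym => /negPf->.
rewrite big1 // => L' sL'; have [e|//] := eqVneq (cstab x) L'.
by rewrite e sL' in nsL.
Qed.

Lemma smark_eq b b' : (forall L, bphi L b = bphi L b') -> forall L a,
  lc_eval (fun X => smark X L a : K^o) b = lc_eval (fun X => smark X L a : K^o) b'.
Proof.
move=> bb' L a; have [n] := ubnP (#|gT| - #|L|)%N; elim: n L => // n IHn L ltLn.
have /ffunP/(_ a) := bb' L; rewrite !bphiE.
have split (c : burnside gT K) : lc_eval (fun X => fmark X L a : K^o) c
    = lc_eval (fun X => smark X L a : K^o) c +
      \sum_(L' : {group gT} | (L \subset L') && (L' != L))
        lc_eval (fun X => smark X L' a : K^o) c.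
  rewrite -lc_eval_sum /lc_eval -big_split; apply: eq_bigr => X _ /=.
  by rewrite fmark_smark (bigD1 L) //= scalerDr.
rewrite !split => /eqP.
rewrite [X in _ + X == _](eq_bigr (fun L' => lc_eval (fun X => smark X L' a : K^o) b')).
  by move/eqP/addIr.
move=> L' /andP[sLL' neL]; apply: IHn; rewrite -ltnS; apply: leq_trans ltLn; rewrite ltnS.
have ltL : (#|L| < #|L'|)%N.
  by apply: proper_card; rewrite properEneq sLL' andbT eq_sym.
by apply: ltn_sub2l => //; apply: leq_trans ltL _; exact: max_card.
Qed.

Lemma bphi_inj b b' : (forall L, bphi L b = bphi L b') -> lcX b b'.
Proof.
move=> bb' V f fi fa; have sm := smark_eq bb'.
(* Grouping the points of each crossed set by stabilizer and label makes f a combination of the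
   [smark] functions with coefficients independent of the set. *)
have lcE c : lc_eval f c = \sum_(p : {group gT} * gT)
    lc_eval (fun X => smark X p.1 p.2 : K^o) c
      *: ((#|p.1|%:R / #|gT|%:R) *: f (cset p.1 p.2)).
  under eq_bigr do rewrite -lc_eval_scaler.
  rewrite -lc_eval_sum; apply: lc_eval_eq => X.
  rewrite (additive_orbits fi fa).
  under [RHS]eq_bigr do rewrite scaler_suml.
  rewrite exchange_big; apply: eq_bigr => x _ /=.
  rewrite (bigD1 (cstab x, xmap x)) //= !eqxx scale1r big1 ?addr0 // => p np.
  rewrite (_ : _ && _ = false) ?scale0r //.
  by apply: contraNF np => /andP[/eqP-> /eqP->]; rewrite -surjective_pairing.
by rewrite !lcE; apply: eq_bigr => p _; rewrite sm.
Qed.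
End Marks.

(** * Multiplicativity and image of the ghost map *)

Section MarksRing.
Variables (K : fieldType) (gT : finGroupType).
Implicit Types (X Y : crossed gT) (L : {group gT}) (b : burnside gT K).

Lemma cstab_prod X Y (x : xcar X) (y : xcar Y) :
  (@cstab _ (crossed_prod X Y) (x, y) : {set gT}) = cstab x :&: cstab y.
Proof.
apply/setP => g; rewrite [RHS]in_setI [LHS]mem_cstab.
by rewrite [X in X && _]mem_cstab [X in _ && X]mem_cstab -xpair_eqE.
Qed.

Lemma fmark_prod X Y L a :
  fmark K (crossed_prod X Y) L a = \sum_u fmark K X L u * fmark K Y L (u^-1 * a)%g.
Proof.
transitivity (\sum_(x : xcar X) \sum_(y : xcar Y)
    ((L \subset @cstab _ (crossed_prod X Y) (x, y)) && (xmap x * xmap y == a)%g)%:R : K).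
  by rewrite pair_bigA; apply: eq_bigr => -[x y] _.
rewrite /fmark; under [RHS]eq_bigr do rewrite mulr_suml.
rewrite [RHS]exchange_big; apply: eq_bigr => x _.
rewrite [RHS](bigD1 (xmap x)) // [X in _ = _ + X]big1 ?addr0 => [|u /negPf ne]; last first.
  by rewrite [_ == u]eq_sym ne andbF mul0r.
rewrite eqxx andbT mulr_sumr; apply: eq_bigr => y _.
rewrite -natrM mulnb cstab_prod subsetI -andbA.
by rewrite -(inj_eq (mulgI (xmap x)) (xmap y)) mulKVg.
Qed.

Lemma fmark_pt L a : fmark K (crossed_pt gT) L a = cdelta K gT a.
Proof.
rewrite /fmark (bigD1 (tt : xcar (crossed_pt gT))) // [X in _ + X = _]big1 ?addr0; last by case.
rewrite ffunE [a == _]eq_sym; congr (nat_of_bool _)%:R; rewrite -[RHS]andTb; congr (_ && _).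
by apply/subsetP => g _; rewrite mem_cstab.
Qed.

Lemma bphi_mul L b b' :
  bphi L (lc_map2 (@crossed_prod gT) b b') = conv (bphi L b) (bphi L b').
Proof.
apply/ffunP => a; rewrite bphiE [RHS]ffunE lc_eval_map2.
transitivity (lc_eval (fun X => \sum_u
    lc_eval (fun Y => fmark K X L u * fmark K Y L (u^-1 * a)%g : K^o) b' : K^o) b).
  apply: (@lc_eval_eq K K^o) => X.
  rewrite -(@lc_eval_sum K K^o); apply: (@lc_eval_eq K K^o) => Y.
  exact: fmark_prod.
rewrite (@lc_eval_sum K K^o); apply: eq_bigr => u _; rewrite !bphiE.
rewrite /lc_eval mulr_suml; apply: eq_bigr => X _.
apply: etrans (mulrA X.1 _ _); apply: (congr1 ( *%R X.1)); rewrite mulr_sumr.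
by apply: eq_bigr => Y _; exact: mulrCA.
Qed.

Lemma bphi_pt L : bphi L [:: (1, crossed_pt gT)] = cdelta K gT.
Proof. by apply/ffunP => a; rewrite bphiE lc_eval1 fmark_pt. Qed.

Lemma bphi_cat L b b' : bphi L (b ++ b') = bphi L b + bphi L b'.
Proof. by apply/ffunP => a; rewrite [RHS]ffunE !bphiE lc_eval_cat. Qed.

Lemma bphi_nil L : bphi L ([::] : burnside gT K) = 0.
Proof. by apply/ffunP => a; rewrite [RHS]ffunE bphiE lc_eval_nil. Qed.

Lemma bphi_flatten (I : Type) (r : seq I) (F : I -> burnside gT K) L :
  bphi L (flatten [seq F i | i <- r]) = \sum_(i <- r) bphi L (F i).
Proof.
by elim: r => [|i r IHr]; rewrite ?big_nil ?bphi_nil // big_cons /= bphi_cat IHr.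
Qed.

Lemma fmark_conj X L a g : fmark K X (L :^ g)%G (a ^ g)%g = fmark K X L a.
Proof.
rewrite /fmark (reindex_inj (@act_inj _ _ _ (xact X) g)).
by apply: eq_bigr => x _; rewrite cstab_act /= conjSg xmapJ (inj_eq (conjg_inj g)).
Qed.

Lemma fmark_supp X L a : a \notin 'C(L)%g -> fmark K X L a = 0.
Proof.
move=> aC; apply: big1 => x _; case: andP => [[sL /eqP e]|//].
by rewrite -e (xmap_cent sL) in aC.
Qed.

(** Together with [supported] this describes the G-fixed subring of the product of the Z K C_G(L):
    taking g in C_G(L), where L^g = L, shows that z L is a class function on C_G(L). *)
Definition equivariant (z : {group gT} -> {ffun gT -> K}) :=
  forall L g a, z (L :^ g)%G (a ^ g)%g = z L a.
Definition supported (z : {group gT} -> {ffun gT -> K}) :=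
  forall L a, a \notin 'C(L)%g -> z L a = 0.

Lemma bphi_equivariant b : equivariant (fun L => bphi L b).
Proof.
by move=> L g a; rewrite !bphiE; apply: (@lc_eval_eq K K^o) => X; exact: fmark_conj.
Qed.

Lemma bphi_supported b : supported (fun L => bphi L b).
Proof.
move=> L a aC; rewrite bphiE (@lc_eval_eq K K^o _ _ (fun _ => 0)) => [|X].
  by rewrite /lc_eval big1 // => X _; rewrite scaler0.
exact: fmark_supp.
Qed.

Lemma sum_transitive X (x0 : xcar X) (F : xcar X -> K) :
  (forall y, exists g, y = xact X x0 g) ->
  \sum_h F (xact X x0 h) = #|cstab x0|%:R * \sum_x F x.
Proof.
move=> trX; rewrite (partition_big (xact X x0) xpredT) //= mulr_sumr.
apply: eq_bigr => x _; rewrite (eq_bigr (fun _ => F x)) => [|h /eqP->] //.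
rewrite sumr_const mulr_natl; congr (_ *+ _); have [g ->] := trX x.
rewrite -(card_rcoset (cstab x0) g); apply: eq_card => h.
rewrite [RHS]mem_rcoset [RHS]mem_cstab actM [LHS]unfold_in /=.
by rewrite -[RHS](inj_eq (@act_inj _ _ _ (xact X) g)) actKV.
Qed.

(** The bound on orders turns the fixed point condition that L' lies in L^h into L^h = L'. Summing
    over h in G meets every point of G/L exactly |L| times. *)
Lemma fmark_cset L a L' a' : a \in 'C(L)%g -> (#|L| <= #|L'|)%N ->
  #|L|%:R * fmark K (cset L a) L' a' = \sum_h ((L :^ h == L')%g && (a ^ h == a')%g)%:R.
Proof.
move=> aC leL; rewrite (csetE aC); set X := coset_crossed aC.
pose x0 : xcar X := coset_base L.
have st0 : cstab x0 = L.
  apply/val_inj/setP => g; rewrite [LHS]mem_cstab -val_eqE /= lcoset1.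
  apply/eqP/idP => [e|gL]; last by rewrite lcoset_id ?groupV.
  by have := group1 L; rewrite -{1}e mem_lcoset invgK mulg1.
have map0 : xmap x0 = a.
  have /(@conj_coset _ L a aC x0 1%g) : 1%g \in val x0 by rewrite /= lcoset1 group1.
  by rewrite invg1 conjg1 => e; apply/esym.
have tr0 y : exists g, y = xact X x0 g.
  case: (lcosetsP (valP y)) => g _ e; exists g^-1%g; apply: val_inj.
  by rewrite e /= invgK lcoset1.
rewrite -{1}st0 -(sum_transitive (x0 := x0)) //.
apply: eq_bigr => h _; rewrite xmapJ cstab_act map0 st0; congr (nat_of_bool (_ && _))%:R.
by rewrite eq_sym eqEcard cardJg leL andbT.
Qed.

Hypothesis charK : [pchar K] =i pred0.

(* Triangularity of the table of marks: on subgroups of order at least [m], the ghost vector of a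
   combination of classes [G/L] with [#|L| = m] is supported on order [m], where averaging over
   conjugates returns the given [z]. *)
Lemma bphi_layer (z : {group gT} -> {ffun gT -> K}) m L' a' :
  equivariant z -> supported z -> (0 < m)%N -> (m <= #|L'|)%N ->
  bphi L' [seq (z p.1 p.2 * (m%:R / #|gT|%:R), cset p.1 p.2)
          | p : {group gT} * gT <- enum {: {group gT} * gT} & #|p.1| == m] a'
  = if #|L'| == m then z L' a' else 0.
Proof.
move=> ze zs m0 mL; rewrite bphiE /lc_eval big_map big_filter big_enum_cond /=.
have cG : #|gT|%:R != 0 :> K by apply: natr_neq0 => //; apply/card_gt0P; exists 1%g.
transitivity (\sum_(p : {group gT} * gT | #|p.1| == m)
    \sum_h z p.1 p.2 / #|gT|%:R * ((p.1 :^ h == L')%g && (p.2 ^ h == a')%g)%:R).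
  apply: eq_bigr => p /eqP pm; rewrite -mulr_sumr.
  have [pC|npC] := boolP (p.2 \in 'C(p.1)%g); last by rewrite (zs _ _ npC) !mul0r scale0r.
  rewrite -fmark_cset ?pm // mulrA -[LHS]/(_ * _); congr (_ * _).
  by rewrite mulrAC mulrA.
rewrite exchange_big /=.
have [/eqP Lm|Lm] := ifPn; last first.
  rewrite big1 // => h _; rewrite big1 // => p /eqP pm.
  case: eqP => [e|_]; last by rewrite mulr0.
  by rewrite -e cardJg pm eqxx in Lm.
rewrite (eq_bigr (fun _ => z L' a' / #|gT|%:R)) => [|h _].
  by rewrite sumr_const -[LHS]mulr_natr; exact: (mulfVK cG).
(* For a given h only the conjugate of (L', a') by h^-1 contributes, and equivariance of z evaluates
   it to z L' a'. *)
rewrite (bigD1 ((L' :^ h^-1)%G, (a' ^ h^-1)%g)) /=; last by rewrite cardJg Lm.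
rewrite [z _ _]ze conjsgKV conjgKV !eqxx mulr1 big1 ?addr0 // => p /andP[_ np].
rewrite (_ : _ && _ = false) ?mulr0 //; apply: contraNF np => /andP[/eqP e1 /eqP e2].
rewrite (surjective_pairing p) xpair_eqE -e2 conjgK eqxx andbT -val_eqE /=.
by rewrite -e1 conjsgK.
Qed.

(** Induction on a bound n for the orders of the subgroups where z is nonzero: subtracting the layer
    of order n + 1 leaves an equivariant supported family with bound n. *)
Lemma bphi_surj (z : {group gT} -> {ffun gT -> K}) :
  equivariant z -> supported z -> exists b, forall L, bphi L b = z L.
Proof.
move=> ze zs.
suff H n : forall z, equivariant z -> supported z ->
    (forall L, (n < #|L|)%N -> z L = 0) -> exists b, forall L, bphi L b = z L.
  by apply: (H #|gT| z ze zs) => L; rewrite ltnNge max_card.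
elim: n {z ze zs} => [|n IHn] z ze zs z0.
  by exists [::] => L; rewrite bphi_nil z0 // cardG_gt0.
pose b1 : burnside gT K := [seq (z p.1 p.2 * (n.+1%:R / #|gT|%:R), cset p.1 p.2)
  | p : {group gT} * gT <- enum {: {group gT} * gT} & #|p.1| == n.+1].
have subE L a : (z L - bphi L b1) a = z L a - bphi L b1 a.
  by rewrite [LHS]ffunE [X in _ + X = _]ffunE.
have [|||b2 b2E] := IHn (fun L => z L - bphi L b1).
- by move=> L g a; rewrite !subE ze (bphi_equivariant b1).
- by move=> L a aC; rewrite subE zs // (bphi_supported b1) // subr0.
- move=> L ltL; apply/ffunP => a; rewrite subE [bphi _ _ _]bphi_layer //.
  rewrite [RHS]ffunE; have [_|nL] := eqVneq #|L| n.+1; first by rewrite subrr.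
  by rewrite z0 ?subr0 ?ffunE // ltn_neqAle eq_sym nL.
by exists (b1 ++ b2) => L; rewrite bphi_cat b2E addrC subrK.
Qed.
End MarksRing.

(** * Central idempotents of group algebras *)

Section Characters.
Variables (K : fieldType) (gT : finGroupType).
Hypothesis charK : [pchar K] =i pred0.
Implicit Types (t f : {ffun gT -> K}).

Section OneGroup.
Variable L : {group gT}.
Hypothesis splitL : group_splitting_field K L.
Local Notation aG := (regular_repr K L).

Lemma group_pchar0 : ([pchar K]^'.-group L)%g.
Proof. by apply/pgroupP => p pp _; rewrite inE /= charK. Qed.
Local Notation coprL := group_pchar0.

(* The regular representation turns convolution into a matrix product, where the Wedderburn
   decomposition is available. *)
Definition gring f : 'M[K]_#|L| := \sum_(x in L) f x *: aG x.

Lemma gring_inj f f' : (forall x, x \notin L -> f x = 0) -> (forall x, x \notin L -> f' x = 0) ->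
  gring f = gring f' -> f = f'.
Proof.
move=> f0 f'0 e; apply/ffunP => x; have [xL|xL] := boolP (x \in L); last by rewrite f0 ?f'0.
have gE h : gring_proj x (gring h) 0 0 = h x.
  rewrite linear_sum (bigD1 x) //= linearZ /= gring_projE // eqxx.
  rewrite big1 ?addr0 => [|y /andP[yL ne]]; first by rewrite !mxE eqxx mulr1.
  by rewrite linearZ /= gring_projE // eq_sym (negPf ne) scaler0.
by rewrite -(gE f) e gE.
Qed.

Lemma gring_conv f f' : (forall x, x \notin L -> f x = 0) ->
  gring (conv f f') = gring f *m gring f'.
Proof.
move=> f0; rewrite /gring mulmx_suml.
under [RHS]eq_bigr => x xL.
  rewrite mulmx_sumr (reindex_inj (mulgI x^-1%g)) /=.
  under eq_big => [z|z zL] do [rewrite groupMl ?groupV // | rewrite -scalemxAl -scalemxAr].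
  over.
rewrite exchange_big; apply: eq_bigr => z zL.
rewrite ffunE scaler_suml [LHS](bigID (mem L)) [X in _ + X = _]big1 ?addr0 => [|x /= xL]; last first.
  by rewrite (f0 x) // mul0r scale0r.
by apply: eq_bigr => x xL; rewrite -repr_mxM ?groupMl ?groupV // mulKVg scalerA.
Qed.

Lemma gring_delta : gring (cdelta K gT) = 1%:M.
Proof.
rewrite /gring (bigD1 1%g) //= ffunE eqxx scale1r repr_mx1 big1 ?addr0 // => x /andP[_ ne].
by rewrite ffunE (negPf ne) scale0r.
Qed.

Lemma gring_sum (I : Type) (r : seq I) (F : I -> {ffun gT -> K}) :
  gring (\sum_(i <- r) F i) = \sum_(i <- r) gring (F i).
Proof.
rewrite exchange_big; apply: eq_bigr => x _.
by rewrite sum_ffunE scaler_suml.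
Qed.

Lemma mxtrace_regular1 x : x \in L -> \tr (aG x) = (#|L| * (x == 1%g))%:R.
Proof.
move=> xL; have [->|ne] := eqVneq x 1%g; first by rewrite repr_mx1 mxtrace1 muln1.
rewrite muln0 /mxtrace big1 // => i _; rewrite !mxE eqxx /=.
case: eqP => // /(congr1 enum_val); rewrite gring_indexK ?groupM ?enum_valP // => e.
by case/eqP: ne; apply: (mulgI (enum_val i)); rewrite mulg1 -e.
Qed.

Variable sG : irrType K L.

Definition irr_fun (i : sG) : {ffun gT -> K} :=
  [ffun x => if x \in L then \tr (irr_repr i x) else 0].

(** The regular character is the sum of the irreducible ones weighted by their degrees, extended
    linearly to the enveloping algebra. *)
Lemma mxtrace_gring A : (A \in enveloping_algebra_mx aG)%MS ->
  \tr A = \sum_(i : sG) \tr (gring_op (irr_repr i) A) *+ irr_degree i.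
Proof.
case/envelop_mxP => a ->; rewrite linear_sum.
under [RHS]eq_bigr do rewrite !linear_sum -sumrMnl.
rewrite [RHS]exchange_big; apply: eq_bigr => x xL /=.
rewrite linearZ /= (mxtrace_regular_pchar sG coprL splitL) // mulr_sumr.
by apply: eq_bigr => i _; rewrite !linearZ /= gring_opG // mulrnAr.
Qed.

(** The coefficient of x in an element e of the group algebra is the regular trace of e x^-1 divided
    by |L|. For the Wedderburn idempotent only the component i survives, where e acts as the
    identity; it contributes the degree times the character value at x^-1. *)
Lemma e_char_irr_fun (i : sG) : gring (e_char L (irr_fun i)) = Wedderburn_id i.
Proof.
have Rei := Wedderburn_id_mem i.
have ReG : (Wedderburn_id i \in enveloping_algebra_mx aG)%MS.
  by move: Rei; rewrite genmxE mem_sub_gring => /andP[].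
have [a def_e] := envelop_mxP ReG; rewrite [RHS]def_e.
apply: eq_bigr => x xL; congr (_ *: _); rewrite !ffunE group1 groupV xL repr_mx1 mxtrace1.
have xL' : x^-1%g \in L by rewrite groupV.
have cL : #|L|%:R != 0 :> K.
  by apply/negP => /(natf0_pchar (cardG_gt0 L))[p]; rewrite charK.
apply: (mulIf cL); rewrite mulrAC mulfVK //.
transitivity (\tr (Wedderburn_id i *m aG x^-1%g)); last first.
  rewrite def_e mulmx_suml linear_sum (bigD1 x) //= -scalemxAl linearZ /=.
  rewrite -repr_mxM // mulgV mxtrace_regular1 // eqxx muln1 big1 ?addr0 // => y /andP[yL ne].
  rewrite -scalemxAl linearZ /= -repr_mxM // mxtrace_regular1 ?groupM //.
  by rewrite -eq_mulgV1 (negPf ne) muln0 mulr0.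
rewrite mxtrace_gring; last by apply: envelop_mxM => //; apply: envelop_mx_id.
rewrite (bigD1 i) //= big1 ?addr0 => [|j ne].
  rewrite gring_opM ?envelop_mx_id // (op_Wedderburn_id_pchar coprL) mul1mx gring_opG //.
  by rewrite mulr_natl.
rewrite gring_opM ?envelop_mx_id // (irr_repr'_op0_pchar coprL _ Rei) 1?eq_sym //.
by rewrite mul0mx mxtrace0 mul0rn.
Qed.

Lemma irr_fun_supp (i : sG) x : x \notin L -> irr_fun i x = 0.
Proof. by rewrite ffunE => /negPf->. Qed.

Lemma e_char_supp t x : (forall x, x \notin L -> t x = 0) -> x \notin L -> e_char L t x = 0.
Proof. by move=> t0 xL; rewrite ffunE (t0 x^-1%g) ?groupV // mulr0. Qed.

Lemma e_char_irr_supp (i : sG) x : x \notin L -> e_char L (irr_fun i) x = 0.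
Proof. by apply: e_char_supp => y; apply: irr_fun_supp. Qed.

Lemma conv_supp f f' x : (forall x, x \notin L -> f x = 0) -> (forall x, x \notin L -> f' x = 0) ->
  x \notin L -> conv f f' x = 0.
Proof.
move=> f0 f'0 xL; rewrite ffunE big1 // => u _.
have [uL|uL] := boolP (u \in L); last by rewrite f0 // mul0r.
by rewrite f'0 ?mulr0 // groupMl ?groupV.
Qed.

Lemma e_char_irr_idem (i : sG) :
  conv (e_char L (irr_fun i)) (e_char L (irr_fun i)) = e_char L (irr_fun i).
Proof.
apply: gring_inj; try by move=> x; try apply: conv_supp; apply: e_char_irr_supp.
rewrite gring_conv ?e_char_irr_fun; last exact: e_char_irr_supp.
by have [_ _ -> //] := Wedderburn_is_id_pchar coprL i; exact: Wedderburn_id_mem.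
Qed.

Lemma e_char_irr_orth (i j : sG) : i != j ->
  conv (e_char L (irr_fun i)) (e_char L (irr_fun j)) = 0.
Proof.
move=> ne; apply: gring_inj; [by move=> x; apply: conv_supp => y; apply: e_char_irr_supp| |].
  by move=> x _; rewrite ffunE.
rewrite gring_conv ?e_char_irr_fun; last exact: e_char_irr_supp.
rewrite (Wedderburn_mulmx0 ne (Wedderburn_id_mem i) (Wedderburn_id_mem j)).
by rewrite /gring big1 // => x _; rewrite ffunE scale0r.
Qed.

Lemma e_char_irr_sum : \sum_(i : sG) e_char L (irr_fun i) = cdelta K gT.
Proof.
apply: gring_inj => [x xL|x xL|].
- by rewrite sum_ffunE big1 // => i _; apply: e_char_irr_supp.
- by rewrite ffunE; case: eqP xL => // ->; rewrite group1.
- rewrite gring_sum gring_delta -(Wedderburn_sum_id_pchar sG coprL).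
  by apply: eq_bigr => i _; exact: e_char_irr_fun.
Qed.

(** Two distinct components with the same character would have orthogonal and equal idempotents,
    forcing a nonzero idempotent to vanish. *)
Lemma irr_fun_inj : injective irr_fun.
Proof.
move=> i j e; apply/eqP; apply: contraT => ne.
have := e_char_irr_orth ne; rewrite -e e_char_irr_idem => e0.
have [/eqP[]] := Wedderburn_is_id_pchar coprL i.
by rewrite -e_char_irr_fun e0 /gring big1 // => x _; rewrite ffunE scale0r.
Qed.

Lemma is_irr_charP t : is_irr_char L t <-> exists i : sG, t = irr_fun i.
Proof.
split=> [[n [rL [irrL tE]]]|[i ->]].
  have sim := rsim_irr_comp_pchar sG coprL irrL.
  exists (irr_comp sG rL); apply/ffunP => x; rewrite tE ffunE; case: ifP => // xL.
  exact: mxtrace_rsim sim _ xL.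
exists (irr_degree i), (irr_repr i); split; first exact: socle_irr.
by move=> x; rewrite ffunE.
Qed.
End OneGroup.

Section Sum.
Variable L : {group gT}.
Hypothesis splitL : group_splitting_field K L.

Lemma irrType_inhabited : inhabited (irrType K L).
Proof.
apply: NNPP => nI.
suff : false by [].
(* [socle_exists] is a [classically] statement, so it is eliminated against the boolean [false]. *)
by apply: (@socle_exists K gT L _ (regular_repr K L)) => s; case: nI; exact: (inhabits (s : irrType K L)).
Qed.

(** The characters of the irreducible components form a list meeting the specification, so the
    [epsilon] in [irr_chars] does not fall on an arbitrary value. *)
Lemma irr_charsP : uniq (irr_chars K L) /\ forall t, t \in irr_chars K L <-> is_irr_char L t.
Proof.
apply: (epsilon_spec (inhabits [::])
  (fun s => uniq s /\ forall t, t \in s <-> is_irr_char L t)).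
have [sG] := irrType_inhabited; exists [seq irr_fun i | i : sG]; split.
  by rewrite map_inj_uniq ?enum_uniq //; exact: irr_fun_inj.
move=> t; split=> [/mapP[i _ ->]|/(is_irr_charP sG)[i ->]].
  by apply/(is_irr_charP sG); exists i.
by apply: map_f; rewrite mem_enum.
Qed.

Lemma irr_chars_perm (sG : irrType K L) : perm_eq (irr_chars K L) [seq irr_fun i | i : sG].
Proof.
have [u mE] := irr_charsP; apply: uniq_perm => // [|t].
  by rewrite map_inj_uniq ?enum_uniq //; exact: irr_fun_inj.
apply/idP/mapP => [/mE/(is_irr_charP sG)[i ->]|[i _ ->]]; first by exists i; rewrite ?mem_enum.
by apply/mE/(is_irr_charP sG); exists i.
Qed.

Lemma irr_char_supp t x : t \in irr_chars K L -> x \notin L -> t x = 0.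
Proof. by have [_ mE] := irr_charsP => /mE[n [r [_ ->]]] /negPf->. Qed.

Lemma irr_char_class t x g : t \in irr_chars K L -> g \in L -> t (x ^ g)%g = t x.
Proof.
have [_ mE] := irr_charsP => /mE[n [r [_ tE]]] gL; rewrite !tE groupJr //; case: ifP => // xL.
rewrite conjgE !repr_mxM ?groupM ?groupV // mxtrace_mulC -mulmxA -repr_mxM ?groupV //.
by rewrite mulgV repr_mx1 mulmx1.
Qed.

Lemma e_char_idem t : t \in irr_chars K L -> conv (e_char L t) (e_char L t) = e_char L t.
Proof.
have [sG] := irrType_inhabited; rewrite (perm_mem (irr_chars_perm sG)) => /mapP[i _ ->].
exact: e_char_irr_idem.
Qed.

Lemma e_char_orth t t' : t \in irr_chars K L -> t' \in irr_chars K L -> t != t' ->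
  conv (e_char L t) (e_char L t') = 0.
Proof.
have [sG] := irrType_inhabited; rewrite !(perm_mem (irr_chars_perm sG)).
move=> /mapP[i _ ->] /mapP[j _ ->] ne; apply: e_char_irr_orth => //.
by apply: contraNneq ne => ->.
Qed.

Lemma e_char_sum : \sum_(t <- irr_chars K L) e_char L t = cdelta K gT.
Proof.
have [sG] := irrType_inhabited; rewrite (perm_big _ (irr_chars_perm sG)) big_map big_enum.
exact: e_char_irr_sum.
Qed.
End Sum.
End Characters.

(** * The idempotents attached to pairs *)

Section Conjugation.
Variables (K : fieldType) (gT : finGroupType).
Implicit Types (t f : {ffun gT -> K}) (L H : {group gT}).

Definition conjt (g : gT) t : {ffun gT -> K} := [ffun x => t (x ^ g^-1)%g].

Lemma conjtE g t x : conjt g t (x ^ g)%g = t x.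
Proof. by rewrite ffunE conjgK. Qed.

Lemma conjtK g : cancel (conjt g) (conjt g^-1%g).
Proof. by move=> t; apply/ffunP => x; rewrite !ffunE invgK conjgK. Qed.

Lemma conjtVK g : cancel (conjt g^-1%g) (conjt g).
Proof. by move=> t; apply/ffunP => x; rewrite !ffunE invgK conjgKV. Qed.

Lemma is_irr_char_conj L t g : is_irr_char L t -> is_irr_char (L :^ g)%G (conjt g t).
Proof.
move=> [n [rL [/mx_irrP[n0 irrL] tE]]].
have memL x : x \in (L :^ g)%g -> (x ^ g^-1)%g \in L by rewrite mem_conjg.
have rP : mx_repr (L :^ g)%g (fun x => rL (x ^ g^-1)%g).
  split=> [|x y xL yL]; first by rewrite conj1g repr_mx1.
  by rewrite conjMg repr_mxM ?memL.
exists n, (MxRepresentation rP); split; last by move=> x; rewrite ffunE tE mem_conjg.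
apply/mx_irrP; split=> // U /mxmoduleP modU; apply: irrL; apply/mxmoduleP => x xL.
have := modU (x ^ g)%g; rewrite memJ_conjg => /(_ xL) /=.
by rewrite conjgK.
Qed.

Lemma centJ_group L g : 'C(L :^ g)%G = ('C(L) :^ g)%G.
Proof. by apply/val_inj; rewrite /= centJ. Qed.

Implicit Types p q : {group gT} * {ffun gT -> K}.

Lemma pair_conjP p q :
  reflect (exists g, q.1 = (p.1 :^ g)%G /\ q.2 = conjt g p.2) (pair_conj p q).
Proof.
apply: (iffP existsP) => [[g /andP[/eqP e1 /forallP e2]]|[g [e1 e2]]]; exists g.
  split; first exact: val_inj.
  by apply/ffunP => x; rewrite ffunE -(eqP (e2 _)) conjgKV.
rewrite e1 e2 eqxx /=; apply/forallP => x.
by rewrite conjtE.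
Qed.

Lemma pair_conj_refl p : pair_conj p p.
Proof.
apply/pair_conjP; exists 1%g; split; first by apply/val_inj; rewrite /= conjsg1.
by apply/ffunP => x; rewrite ffunE invg1 conjg1.
Qed.

Lemma pair_conj_conjt p L t g : pair_conj p ((L :^ g)%G, conjt g t) = pair_conj p (L, t).
Proof.
have conjtM h h' u : conjt (h * h')%g u = conjt h' (conjt h u).
  by apply/ffunP => x; rewrite !ffunE invMg conjgM.
apply/pair_conjP/pair_conjP => /= -[h [e1 e2]].
  exists (h * g^-1)%g; rewrite conjtM -e2 conjtK; split=> //; apply/val_inj.
  by rewrite /= conjsgM -[(p.1 :^ h)%g]/(gval (p.1 :^ h)%G) -e1 /= conjsgK.
exists (h * g)%g; rewrite conjtM -e2; split=> //; apply/val_inj.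
by rewrite /= conjsgM -[(p.1 :^ h)%g]/(gval (p.1 :^ h)%G) -e1.
Qed.

Lemma pair_conj_sym p q : pair_conj p q = pair_conj q p.
Proof.
suff H p1 q1 : pair_conj p1 q1 -> pair_conj q1 p1 by apply/idP/idP; apply: H.
case: p1 q1 => [L t] [L' t'] /pair_conjP[g /= [-> ->]].
by rewrite -(pair_conj_conjt _ L t g); exact: pair_conj_refl.
Qed.

Lemma pair_conj_trans : ssrbool.transitive (@pair_conj K gT).
Proof.
move=> q p [L t] pq /pair_conjP[g /= [-> ->]].
by rewrite pair_conj_conjt -surjective_pairing.
Qed.

Lemma conv_suml (I : Type) (r : seq I) (P : pred I) (F : I -> {ffun gT -> K}) f :
  conv (\sum_(i <- r | P i) F i) f = \sum_(i <- r | P i) conv (F i) f.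
Proof.
apply/ffunP => x; rewrite sum_ffunE ffunE.
under eq_bigr do rewrite sum_ffunE mulr_suml.
by rewrite exchange_big; apply: eq_bigr => i _; rewrite ffunE.
Qed.

Lemma conv_sumr (I : Type) (r : seq I) (P : pred I) (F : I -> {ffun gT -> K}) f :
  conv f (\sum_(i <- r | P i) F i) = \sum_(i <- r | P i) conv f (F i).
Proof.
apply/ffunP => x; rewrite sum_ffunE ffunE.
under eq_bigr do rewrite sum_ffunE mulr_sumr.
by rewrite exchange_big; apply: eq_bigr => i _; rewrite ffunE.
Qed.

Hypothesis charK : [pchar K] =i pred0.
Hypothesis splitK : forall H : {group gT}, group_splitting_field K 'C(H)%G.

Let irrC L := irr_chars K 'C(L)%G.

Lemma irr_chars_conj L g : perm_eq (irrC (L :^ g)%G) [seq conjt g t | t <- irrC L].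
Proof.
have [u mE] := irr_charsP charK (@splitK L).
have [u' mE'] := irr_charsP charK (@splitK (L :^ g)%G).
apply: uniq_perm => // [|t].
  by rewrite map_inj_uniq //; exact: can_inj (conjtK g).
apply/idP/mapP => [/mE' irt|[t' /mE irt ->]].
  exists (conjt g^-1%g t); last by rewrite conjtVK.
  apply/mE; have := is_irr_char_conj g^-1%g irt; rewrite centJ_group.
  by congr (is_irr_char _ _); apply/val_inj; rewrite /= conjsgK.
by apply/mE'; rewrite centJ_group; apply: is_irr_char_conj.
Qed.

Lemma eps_tilde_equivariant p : equivariant (eps_tilde p).
Proof.
move=> L g x; rewrite /eps_tilde !sum_ffunE (perm_big _ (irr_chars_conj L g)) big_map.
apply: eq_big => [t|t _]; first exact: pair_conj_conjt.
rewrite !ffunE conj1g centJ_group cardJg -conjVg.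
by rewrite conjgK.
Qed.

Lemma eps_tilde_supported p : supported (eps_tilde p).
Proof.
move=> L x xC; rewrite sum_ffunE big_seq_cond big1 // => t /andP[tI _].
by apply: e_char_supp xC => y; exact (irr_char_supp charK (@splitK L) tI).
Qed.

(** Surjectivity of the ghost map provides the witness that gives the [epsilon] in [e_burnside] its
    meaning. *)
Lemma e_burnsideP p L : bphi L (e_burnside p) = eps_tilde p L.
Proof.
rewrite /e_burnside; move: L; apply: (epsilon_spec (inhabits [::])
  (fun b => forall L : {group gT}, bphi L b = eps_tilde p L)).
exact: bphi_surj (eps_tilde_equivariant p) (eps_tilde_supported p).
Qed.

(** Both factors are partial sums of one orthogonal family of idempotents, so their product is the
    sum over the common terms. *)
Lemma conv_eps_tilde p q L :
  conv (eps_tilde p L) (eps_tilde q L)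
  = \sum_(t <- irrC L | pair_conj p (L, t) && pair_conj q (L, t)) e_char 'C(L)%G t.
Proof.
have [uI _] := irr_charsP charK (@splitK L).
rewrite conv_suml [RHS]big_mkcondr [LHS]big_seq_cond [RHS]big_seq_cond.
apply: eq_bigr => t /andP[tI _]; rewrite conv_sumr big_mkcond (bigD1_seq t) //=.
rewrite big_seq_cond big1 ?addr0; last first.
  move=> t' /andP[t'I ne]; case: ifP => // _.
  by rewrite (e_char_orth charK (@splitK L)) // eq_sym.
by case: ifP => // _; rewrite (e_char_idem charK (@splitK L)).
Qed.

Section Families.
Variables (CG : {set {group gT}}) (CGP : conj_class_reps CG).
Variables (Th : {group gT} -> seq {ffun gT -> K}).
Hypothesis ThP : forall H, H \in CG -> irr_reps H (Th H).
Let I := [seq (H, t) | H <- enum CG, t <- Th H].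

Lemma mem_pairs p : (p \in I) = (p.1 \in CG) && (p.2 \in Th p.1).
Proof.
apply/allpairsPdep/andP => [[H [t [HI tI ->]]]|[HI tI]]; first by rewrite -mem_enum.
by exists p.1, p.2; rewrite mem_enum -surjective_pairing.
Qed.

(** L is conjugated to its representative H in [CG], and the resulting character is then moved into
    [Th H] by N_G(H). With [pairs_unique] this makes [I] a transversal of the G-classes of pairs. *)
Lemma pairs_exists L t : t \in irrC L -> exists2 p, p \in I & pair_conj p (L, t).
Proof.
move=> tI; have [H HC /imsetP[g _ eH]] := (CGP.1 L).
have eH' : H = (L :^ g)%G by apply/val_inj.
have [_ _ ex _] := ThP HC.
have /ex[t' t'I pc] : conjt g t \in irr_chars K 'C(H)%G.
  by rewrite eH' (perm_mem (irr_chars_conj L g)) map_f.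
exists (H, t'); first by rewrite mem_pairs HC.
rewrite -(pair_conj_conjt _ L t g) -eH'.
by rewrite pair_conj_sym.
Qed.

Lemma pairs_unique p q r : p \in I -> q \in I -> pair_conj p r -> pair_conj q r -> p = q.
Proof.
rewrite !mem_pairs => /andP[p1 p2] /andP[q1 q2] pr; rewrite pair_conj_sym => rq.
have pq := pair_conj_trans pr rq.
have e : p.1 = q.1.
  have [g [e _]] := pair_conjP _ _ pq; apply: CGP.2 => //.
  by rewrite e; apply/imsetP; exists g; rewrite ?inE.
rewrite (surjective_pairing p) (surjective_pairing q) e in pq *; congr pair.
have [_ _ _ inj] := ThP q1; apply: inj => //.
by rewrite -e.
Qed.

(** Every character of C_G(L) is collected by exactly one pair of the transversal, so the double sum
    is the full Wedderburn decomposition of 1. *)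
Lemma eps_tilde_sum L : \sum_(i : seq_sub I) eps_tilde (ssval i) L = cdelta K gT.
Proof.
rewrite -(e_char_sum charK (@splitK L)) (exchange_big_dep xpredT) //=.
rewrite [LHS]big_seq_cond [RHS]big_seq_cond; apply: eq_bigr => t /andP[tI _].
have [p pI pc] := pairs_exists tI.
rewrite (big_pred1 (SeqSub pI)) // => i; apply/idP/eqP => [ic|-> //].
by apply/val_inj/(pairs_unique (valP i) pI ic pc).
Qed.

Lemma eps_tilde_idem p L : conv (eps_tilde p L) (eps_tilde p L) = eps_tilde p L.
Proof. by rewrite conv_eps_tilde; apply: eq_bigl => t; rewrite andbb. Qed.

Lemma eps_tilde_orth (i j : seq_sub I) L : i != j ->
  conv (eps_tilde (ssval i) L) (eps_tilde (ssval j) L) = 0.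
Proof.
move=> ne; rewrite conv_eps_tilde big1 // => t /andP[it jt].
by case/eqP: ne; apply/val_inj/(pairs_unique (valP i) (valP j) it jt).
Qed.
End Families.

Lemma cent1_group : 'C(1)%G = [set: gT]%G.
Proof.
by apply/val_inj/setP => x; rewrite /= inE; apply/centP => y /set1P->; exact: commute1.
Qed.

(** Characters of G are class functions, so the G-class of (1, t) is reduced to this pair and the
    sum has a single term. *)
Lemma eps_tilde_trivial t : t \in irr_chars K [set: gT]%G ->
  eps_tilde (1%G, t) 1%G = e_char [set: gT]%G t.
Proof.
have splitT : group_splitting_field K [set: gT]%G by rewrite -cent1_group.
move=> tI; rewrite /eps_tilde cent1_group.
have [uI _] := irr_charsP charK splitT.
rewrite (eq_bigl (pred1 t)) => [|t'].
  by rewrite -big_filter filter_pred1_uniq // big_seq1.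
apply/idP/eqP => [/pair_conjP[g [_ /= ->]]|->]; last exact: pair_conj_refl.
by apply/ffunP => x; rewrite ffunE (irr_char_class charK splitT) // inE.
Qed.

Lemma brho_bphi (b : burnside gT K) : val (brho b) = bphi 1%G b.
Proof.
apply/ffunP => z; rewrite bphiE ffunE; apply: eq_bigr => X _; congr (_ * _).
rewrite natr_card; apply: eq_bigr => x _; rewrite sub1set.
by rewrite group1.
Qed.

Lemma e_char_centerE t : t \in irr_chars K [set: gT]%G ->
  val (e_char_center t) = e_char [set: gT]%G t.
Proof.
have splitT : group_splitting_field K [set: gT]%G by rewrite -cent1_group.
move=> tI; rewrite val_insubd ifT //; apply/forallP => x; apply/forallP => g.
by rewrite !ffunE -conjVg (irr_char_class charK splitT) // inE.
Qed.
End Conjugation.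

(** * Motives *)

Section Assembly.
Variables (K : fieldType) (gT : finGroupType).
Hypothesis charK : [pchar K] =i pred0.
Local Notation S := (span_bicat K).
Local Notation C := (biperm_bicat K).
Local Notation P := (span_to_biperm K).
Local Notation GG := (grp gT).

#[local] Instance spanEquivalence G H u v : Equivalence (@eq2 K S G H u v) :=
  eq2_equiv (span_lcat K) u v.
#[local] Instance spanProper G H u v w :
  Proper (@eq2 K S G H v w ==> @eq2 K S G H u v ==> @eq2 K S G H u w) (@vcomp K S G H u v w).
Proof. by move=> y y' yy' x x' xx'; apply: (vcomp_eq2 (span_lcat K)). Qed.
#[local] Instance bipermEquivalence G H u v : Equivalence (@eq2 K C G H u v) :=
  eq2_equiv (biperm_lcat K) u v.
#[local] Instance bipermProper G H u v w :
  Proper (@eq2 K C G H v w ==> @eq2 K C G H u v ==> @eq2 K C G H u w) (@vcomp K C G H u v w).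
Proof. by move=> y y' yy' x x' xx'; apply: (vcomp_eq2 (biperm_lcat K)). Qed.

Lemma biperm_unit_like_id (G : cell0 C) : unit_like (id2 (@id1 K C G)) (id2 (id1 G)).
Proof.
have idE : forall y y' x x' (h : hom y y') (g : hom x' x) (s : bcar (biset_id G) y x),
  bact h g s = bact h g s by [].
have := @biperm_unit_like K G (biset_id G) (fun _ _ s => s) idE
  (fun y x => Bijective (fun _ => erefl) (fun _ => erefl)).
rewrite (_ : bihom_of K idE = id2 (@id1 K C G)); last exact: bihom_ext.
by rewrite (_ : bihom_tr K idE = id2 (@id1 K C G)) //; apply: bihom_ext => y x s t /=; rewrite eq_sym.
Qed.

Lemma complete_orth_id (B : lbicat K) (lB : is_lcat B) (G : cell0 B) :
  complete_orth (fun _ : unit => id2 (id1 G)).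
Proof.
split=> [_|[] []|]; [exact: (vcomp1l lB) | by [] |].
exact: (sum2_unit lB (fun _ : unit => id2 (id1 G))).
Qed.

Lemma burnside_complete_orth (I : finType) (b : I -> burnside gT K) :
  (forall i (L : {group gT}), conv (bphi L (b i)) (bphi L (b i)) = bphi L (b i)) ->
  (forall i j (L : {group gT}), i != j -> conv (bphi L (b i)) (bphi L (b j)) = 0) ->
  (forall L : {group gT}, \sum_i bphi L (b i) = cdelta K gT) ->
  complete_orth (B := S) (fun i => burnside_cell (b i)).
Proof.
move=> b2 b0 b1; split.
- move=> i; rewrite burnside_cell_mul; apply: burnside_cell_eq; apply: (bphi_inj charK) => L.
  by rewrite bphi_mul.
- move=> i j ij; rewrite burnside_cell_mul -[zero2 _ _]/(burnside_cell ([::] : burnside gT K)).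
  by apply: burnside_cell_eq; apply: (bphi_inj charK) => L; rewrite bphi_mul bphi_nil b0.
- rewrite burnside_cell_sum -burnside_cell1.
  apply: burnside_cell_eq; apply: (bphi_inj charK) => L.
  by rewrite bphi_flatten bphi_pt.
Qed.

Section Motives.
Variables (T : choiceType) (s : seq T) (b : T -> burnside gT K).

Lemma bps0_bone : bps0 P (bone S GG) = bone C GG.
Proof.
apply: (f_equal (@BObj K C unit (fun _ => GG))); apply: functional_extensionality_dep => i.
exact: span_to_biperm_id.
Qed.

Lemma bps0_bsum :
  bps0 P (bsum S GG s (fun p => burnside_cell (b p))) = bsum C GG s (fun p => zcell (brho (b p))).
Proof.
apply: (f_equal (@BObj K C (seq_sub s) (fun _ => GG))); apply: functional_extensionality_dep => i.
exact: span_to_biperm_burnside.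
Qed.

Hypothesis bP : complete_orth (B := S) (fun i : seq_sub s => burnside_cell (b (ssval i))).
Hypothesis zP : complete_orth (B := C) (fun i : seq_sub s => zcell (brho (b (ssval i)))).

(** The source (G, 1) is the one-element family consisting of the identity, so f is the row with
    entries (Id, e_j). In the target the same row sits on [span_biset (span_id GG)], which [pu_map]
    identifies with [id1]. *)
Lemma bsum_equiv : exists f : bcell (bone S GG) (bsum S GG s (fun p => burnside_cell (b p))),
  bis_equiv f /\ bis_equiv (bps1 P f).
Proof.
exists (fun _ j => @KObj K S GG GG unit (fun _ => id1 _) (fun _ _ => burnside_cell (b (ssval j)))).
have lS := span_lcat K; have lC := biperm_lcat K; split.
  have uS := span_unit_like (k := K) GG.
  apply: (bis_equiv_orth lS uS uS (e := fun _ : unit => id2 (id1 _)) (complete_orth_id lS _) bP).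
    by move=> _ j; rewrite (vcomp1l lS) (vcomp1r lS); reflexivity.
  by move=> _ j; rewrite !(vcomp1l lS) (vcomp1r lS); reflexivity.
have uC := biperm_unit_like_id GG.
have uP := biperm_unit_like K (@pu_map_equi GG) (@pu_map_bij GG).
have eE : ps_unitV P GG ⊙ ps2 P (id2 (@id1 K S GG)) ⊙ ps_unit P GG = id2 (@id1 K C GG).
  exact: span_to_biperm_id.
(* The families are spelled out in the conjugated form produced by [bps0], so that the objects match
   by conversion. *)
apply: (bis_equiv_orth lC uC uP
  (e := fun _ : unit => ps_unitV P GG ⊙ ps2 P (id2 (@id1 K S GG)) ⊙ ps_unit P GG)
  (d := fun j : seq_sub s => ps_unitV P GG ⊙ ps2 P (burnside_cell (b (ssval j))) ⊙ ps_unit P GG)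
  (phi := fun _ j => ps2 P (burnside_cell (b (ssval j))))).
- by rewrite eE; exact: complete_orth_id.
- rewrite (_ : (fun j => _) = fun j : seq_sub s => zcell (brho (b (ssval j)))) //.
  by apply: functional_extensionality_dep => j; exact: span_to_biperm_burnside.
- by move=> _ j; exact: biperm_id_comm.
- move=> _ j; rewrite eE (vcomp1l lC) !(vcompA lC) (unit_beal uP) (vcomp1l lC).
  by rewrite -(vcompA lC) (unit_beal uP) (vcomp1r lC); reflexivity.
Qed.

Lemma bone_bsum_bequiv : bequiv (bone C GG) (bsum C GG s (fun p => zcell (brho (b p)))).
Proof.
have [f [_ fE]] := bsum_equiv; rewrite -bps0_bone -bps0_bsum.
by exists (bps1 P f).
Qed.
End Motives.

Lemma bsum_bequiv (T T' : choiceType) (s : seq T) (s' : seq T') (z : T -> zgalg gT K)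
    (z' : T' -> zgalg gT K) :
  complete_orth (B := C) (fun i : seq_sub s => zcell (z (ssval i))) ->
  complete_orth (B := C) (fun i : seq_sub s' => zcell (z' (ssval i))) ->
  bequiv (bsum C GG s (fun p => zcell (z p))) (bsum C GG s' (fun p => zcell (z' p))).
Proof.
move=> zP zP'; have lC := biperm_lcat K; have uC := biperm_unit_like_id GG.
exists (fun i j => @KObj K C GG GG unit (fun _ => id1 _)
  (fun _ _ => zcell (z (ssval i)) ⊙ zcell (z' (ssval j)))).
apply: (bis_equiv_orth lC uC uC zP zP') => i j; first exact: biperm_id_comm.
by rewrite (vcomp1l lC) (vcomp1r lC); reflexivity.
Qed.
End Assembly.

Theorem theorem4p7 (K : fieldType) (gT : finGroupType)
    (charK : [pchar K] =i pred0)
    (splitK : forall H : {group gT}, group_splitting_field K 'C(H)%G)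
    (CG : {set {group gT}}) (CGP : conj_class_reps CG)
    (Th : {group gT} -> seq {ffun gT -> K})
    (ThP : forall H : {group gT}, H \in CG -> irr_reps H (Th H)) :
  let P := span_to_biperm K in
  let I := [seq (H, t) | H <- enum CG, t <- Th H] in
  let IrrG := irr_chars K [set: gT]%G in
  let G := bone (span_bicat K) (grp gT) in
  let G' := bone (biperm_bicat K) (grp gT) in
  let M := bsum (span_bicat K) (grp gT) I
    (fun p => burnside_cell (e_burnside p)) in
  let M1 := bsum (biperm_bicat K) (grp gT) I
    (fun p => zcell (brho (e_burnside p))) in
  let M2 := bsum (biperm_bicat K) (grp gT) IrrG
    (fun t => zcell (brho (e_burnside (1%G, t)))) in
  let M3 := bsum (biperm_bicat K) (grp gT) IrrG
    (fun t => zcell (e_char_center t)) in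
  [/\ bps0 P G = G' /\ bps0 P M = M1,
      exists f : bcell G M, bis_equiv f /\ bis_equiv (bps1 P f),
      bequiv G' M1, bequiv M1 M2 & bequiv M2 M3].
Proof.
move=> P I IrrG G G' M M1 M2 M3.
have splitT : group_splitting_field K [set: gT]%G by rewrite -cent1_group.
have eP p L := e_burnsideP charK splitK p L.
have bP : complete_orth (B := span_bicat K)
    (fun i : seq_sub I => burnside_cell (e_burnside (ssval i))).
  apply: (burnside_complete_orth charK (b := fun i : seq_sub I => e_burnside (ssval i)))
    => [i L|i j L ij|L].
  - by rewrite [bphi _ _]eP (eps_tilde_idem charK splitK).
  - by rewrite [bphi L _]eP [X in conv _ X]eP (eps_tilde_orth charK splitK CGP ThP).
  - rewrite (eq_bigr (fun i : seq_sub I => eps_tilde (ssval i) L)) => [|i _]; last exact: eP.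
    exact: (eps_tilde_sum charK splitK CGP ThP).
have z1P : complete_orth (B := biperm_bicat K)
    (fun i : seq_sub I => zcell (brho (e_burnside (ssval i)))).
  apply: zcell_complete_orth => [i|i j ij|].
  - by rewrite brho_bphi eP (eps_tilde_idem charK splitK).
  - by rewrite !brho_bphi !eP (eps_tilde_orth charK splitK CGP ThP).
  - under eq_bigr do rewrite brho_bphi eP; exact: (eps_tilde_sum charK splitK CGP ThP).
(* Stated for any central lifts of the e_theta, since it is used once for rho_G(e_{1,theta}) and
   once for e_theta itself. *)
have irrP (z : {ffun gT -> K} -> zgalg gT K) :
    {in IrrG, forall t, val (z t) = e_char [set: gT]%G t} ->
    complete_orth (B := biperm_bicat K) (fun i : seq_sub IrrG => zcell (z (ssval i))).
  move=> zE; apply: zcell_complete_orth => [i|i j ij|].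
  - by rewrite zE ?(valP i) // (e_char_idem charK splitT) ?(valP i).
  - by rewrite !zE ?(valP i) ?(valP j) // (e_char_orth charK splitT) ?(valP i) ?(valP j).
  - have [uI _] := irr_charsP charK splitT.
    rewrite -(e_char_sum charK splitT) (eq_bigr (fun i => e_char [set: gT]%G (ssval i)));
      last by move=> i _; rewrite zE // (valP i).
    rewrite -(big_map (fun i : seq_sub IrrG => ssval i) xpredT (e_char [set: gT]%G)).
    apply: perm_big; apply: uniq_perm => // [|t].
      by rewrite map_inj_uniq ?index_enum_uniq //; exact: val_inj.
    apply/mapP/idP => [[i _ ->]|tI]; first exact: (valP i).
    by exists (SeqSub tI); rewrite ?mem_index_enum.
have z2P : complete_orth (B := biperm_bicat K)
    (fun i : seq_sub IrrG => zcell (brho (e_burnside (1%G, ssval i)))).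
  apply: (irrP (fun t => brho (e_burnside (1%G, t)))) => t tI.
  by rewrite brho_bphi eP (eps_tilde_trivial charK splitK).
have z3P : complete_orth (B := biperm_bicat K)
    (fun i : seq_sub IrrG => zcell (e_char_center (ssval i))).
  by apply: irrP => t tI; exact: (e_char_centerE charK splitK).
split.
- by split; [exact: bps0_bone | exact: bps0_bsum].
- exact: bsum_equiv.
- exact: bone_bsum_bequiv.
- exact: (bsum_bequiv z1P z2P).
- exact: (bsum_bequiv z2P z3P).
Qed.
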